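(* The elements $p_{\beta,M,N}$, where $\beta\in i\mathbb R\setminus\{0\}$ and $(M,N)$ is an admissible pair of isotropic lines in $\mathbb C^7$ with $sM=\overline M$ and $sN=\overline N$, together with the elements $$q_{\alpha,L,K}=p_{-\alpha,(sL)',(sK)'}\;p_{\alpha,L,K},$$ where $\alpha\in\mathbb C\setminus(\mathbb R\cup i\mathbb R)$, $(L,K)$ is an admissible pair of isotropic lines in $\mathbb C^7$ and $$(sK)'=p_{\alpha,L,K}(-\alpha)\,sK,\qquad (sL)'=(p_{-\alpha,(sK)'}*p_{\alpha,L,K})(-\alpha)\,sL,$$ generate the twisted loop group $\mathcal L_-^{\tau,\sigma}(\mathbb G_2,\mathbb C^7)$.
   Context: Let $\mathbb O$ be the octonions with orthonormal basis $1,e_1,\dots,e_7$, where $e_i^2=-1$, distinct $e_i,e_j$ anticommute, and $e_ae_b=e_c$ for $(a,b,c)$ any cyclic permutation of $(1,5,2),(1,6,3),(1,7,4),(2,7,3),(2,4,6),(3,5,4),(5,6,7)$. Put $\mathbb R^7=\mathrm{Im}(\mathbb O)$ and $\mathbb C^7=\mathrm{Im}(\mathbb O)\otimes\mathbb C$. Let $\langle\cdot,\cdot\rangle$ be the complex bilinear extension of the standard inner product, with $\perp$ and ''isotropic'' taken with respect to it. $\mathbb G_2\subset\mathrm{SO}(7,\mathbb C)$ is the automorphism group of $\mathbb O\otimes\mathbb C$ acting on $\mathbb C^7$. Let $s=\mathrm{diag}(-I_4,I_3)\in\mathbb G_2$, $\sigma(g)=sgs^{-1}$, $\tau(g)=\bar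 g$. For $x,y\in\mathbb C^7$, $x\cdot y\in\mathbb C^7$ is the imaginary part of their octonionic product. A complex coassociative plane is an isotropic $2$-dimensional complex subspace $\mathcal C$ with $\mathcal C\cdot\mathcal C=0$. For $\alpha\in\mathbb C\setminus\mathbb R$ and an isotropic line $L$, $p_{\alpha,L}(\lambda)=\frac{\lambda-\bar\alpha}{\lambda-\alpha}\pi_{\bar L}+\pi_{(L\oplus\bar L)^\perp}+\frac{\lambda-\alpha}{\lambda-\bar\alpha}\pi_L$, with projections relative to $\mathbb C^7=L\oplus(L\oplus\bar L)^\perp\oplus\bar L$. A pair $(L,K)$ of isotropic lines is admissible if $K\subset\bar L^\perp$ and $L\oplus\pi_{(L\oplus\bar L)^\perp}K$ is a complex coassociative plane; for admissible pairs put $p_{\alpha,L,K}=p_{\alpha,L}p_{\alpha,K}$. For an isotropic line $K$, $\gamma\in\mathbb C\setminus\mathbb R$ and a loop $h$ in $\mathrm{SO}(7,\mathbb C)$ holomorphic at $\gamma$, $p_{\gamma,K}*h=p_{\gamma,K}\,h\,p_{\gamma,h(\gamma)^{-1}K}^{-1}$, which is holomorphic at $\gamma$. Loops in $\mathbb G_2$ are holomorphic maps $g:U\to\mathbb G_2$, $U\subset\mathbb{CP}^1$ open and dense; loops agreeing on an open dense set are identified, and multiplication is pointwise. $\mathcal L_-^{\tau,\sigma}(\mathbb G_2,\mathbb C^7)$ is the group of loops that are rational ($g:\mathbb{CP}^1\to\mathrm{End}(\mathbb C^7)$ meromorphic), holomorphic at $\infty$ with $g(\infty)=\mathrm{Id}$,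 and satisfy $\tau(g(\bar\lambda))=g(\lambda)$ and $\sigma(g(-\lambda))=g(\lambda)$. *)

(* Defs.v *)
From HB Require Import structures.
From mathcomp Require Import all_boot all_order all_algebra.
From mathcomp Require Import boolp classical_sets reals complex.

Set Implicit Arguments.
Unset Strict Implicit.
Unset Printing Implicit Defensive.

Import Order.TTheory GRing.Theory Num.Theory.
Local Open Scope ring_scope.

(* The vector e_i of the text, 1 <= i <= 7, is delta_mx (i - 1) 0. *)
Notation C7 R := 'cV[R[i]%C]_7.

Definition fano : seq (nat * nat * nat) :=
  [:: (1, 5, 2); (1, 6, 3); (1, 7, 4); (2, 7, 3); (2, 4, 6); (3, 5, 4);
      (5, 6, 7)]%N.

Definition pos_triple (a b c : nat) : bool :=
  [|| (a, b, c) \in fano, (b, c, a) \in fano | (c, a, b) \in fano].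

(* Coefficient of e_(c+1) in e_(a+1) e_(b+1). *)
Definition oct_coef (R : realType) (a b c : 'I_7) : R[i]%C :=
  if pos_triple a.+1 b.+1 c.+1 then 1
  else if pos_triple b.+1 a.+1 c.+1 then -1 else 0.

Definition dot (R : realType) (x y : C7 R) : R[i]%C :=
  \sum_i x i 0 * y i 0.

Definition cross (R : realType) (x y : C7 R) : C7 R :=
  \col_c \sum_a \sum_b oct_coef R a b c * x a 0 * y b 0.

(* The complexified octonions: (a, x) stands for a 1 + x with x imaginary. *)
Definition octC (R : realType) := ((R[i]%C)^o * C7 R)%type.

Definition omul (R : realType) (u v : octC R) : octC R :=
  (u.1 * v.1 - dot u.2 v.2, u.1 *: v.2 + v.1 *: u.2 + cross u.2 v.2).

Definition oct_aut (R : realType) (phi : octC R -> octC R) : Prop :=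
  [/\ linear phi, bijective phi & {morph phi : u v / omul u v}].

Definition in_G2 (R : realType) (A : 'M[R[i]%C]_7) : Prop :=
  exists2 phi : octC R -> octC R,
    oct_aut phi & forall x : C7 R, phi (0, x) = (0, A *m x).

Definition cconj (R : realType) (m n : nat) (A : 'M[R[i]%C]_(m, n)) :
  'M[R[i]%C]_(m, n) := map_mx Num.conj A.

Definition conjV (R : realType) (U : {vspace C7 R}) : {vspace C7 R} :=
  <<[seq cconj u | u <- vbasis U]>>%VS.

Definition perp (R : realType) (U : {vspace C7 R}) : {vspace C7 R} :=
  (\bigcap_(u <- vbasis U) lker (linfun (mulmx u^T : C7 R -> 'M_1)))%VS.

Definition imgV (R : realType) (A : 'M[R[i]%C]_7) (U : {vspace C7 R}) :
  {vspace C7 R} := (linfun (mulmx A : C7 R -> C7 R) @: U)%VS.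

Definition isotropic (R : realType) (U : {vspace C7 R}) : Prop :=
  forall u v, u \in U -> v \in U -> dot u v = 0.

Definition isotropic_line (R : realType) (L : {vspace C7 R}) : Prop :=
  \dim L = 1%N /\ isotropic L.

Definition coassociative_plane (R : realType) (U : {vspace C7 R}) : Prop :=
  [/\ \dim U = 2%N, isotropic U &
      forall u v, u \in U -> v \in U -> cross u v = 0].

(* Matrix of the projection onto U along V. *)
Definition proj (R : realType) (U V : {vspace C7 R}) : 'M[R[i]%C]_7 :=
  \matrix_(i, j) daddv_pi U V (delta_mx j 0) i 0.

(* Projections for C^7 = L (+) (L (+) conj L)^perp (+) conj L. *)
Definition pi_line (R : realType) (L : {vspace C7 R}) : 'M[R[i]%C]_7 :=
  proj L (perp (L + conjV L) + conjV L)%VS.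

Definition pi_conj (R : realType) (L : {vspace C7 R}) : 'M[R[i]%C]_7 :=
  proj (conjV L) (L + perp (L + conjV L))%VS.

Definition pi_mid (R : realType) (L : {vspace C7 R}) : 'M[R[i]%C]_7 :=
  proj (perp (L + conjV L)) (L + conjV L)%VS.

Definition admissible (R : realType) (L K : {vspace C7 R}) : Prop :=
  [/\ isotropic_line L, isotropic_line K, (K <= perp (conjV L))%VS &
      coassociative_plane (L + imgV (pi_mid L) K)%VS].

(* Meromorphic maps from the Riemann sphere to End(C^7) are the matrices over
   the field of rational functions in lambda.  Such a matrix is viewed as a
   map on the complement of its poles, an open dense set; Leibniz equality is
   then agreement on an open dense set. *)
Notation ratfun R := {fraction {poly R[i]%C}}.
Notation loop R := 'M[{fraction {poly R[i]%C}}]_7.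

Definition has_value (R : realType) (f : ratfun R) (a c : R[i]%C) : Prop :=
  exists p q : {poly R[i]%C},
    [/\ q.[a] != 0, f = tofrac p / tofrac q & c = p.[a] / q.[a]].

(* With size q = deg q + 1, the condition size p <= size q means no pole at
   infinity, and the value there is the quotient of the coefficients of
   degree deg q. *)
Definition has_value_infty (R : realType) (f : ratfun R) (c : R[i]%C) : Prop :=
  exists p q : {poly R[i]%C},
    [/\ q != 0, (size p <= size q)%N, f = tofrac p / tofrac q &
        c = p`_(size q).-1 / lead_coef q].

(* The value of the holomorphic extension at a; 0 at a pole. *)
Definition fval (R : realType) (f : ratfun R) (a : R[i]%C) : R[i]%C :=
  xget 0 [set c | has_value f a c].

Definition holo_at (R : realType) (g : loop R) (a : R[i]%C) : Prop :=
  forall i j, exists c, has_value (g i j) a c.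

Definition eval (R : realType) (g : loop R) (a : R[i]%C) : 'M[R[i]%C]_7 :=
  \matrix_(i, j) fval (g i j) a.

Definition lift_cst (R : realType) (A : 'M[R[i]%C]_7) : loop R :=
  map_mx (fun c => tofrac c%:P) A.

Definition moebius (R : realType) (a b : R[i]%C) : ratfun R :=
  tofrac ('X - a%:P) / tofrac ('X - b%:P).

Definition p1 (R : realType) (a : R[i]%C) (L : {vspace C7 R}) : loop R :=
  moebius a^* a *: lift_cst (pi_conj L) + lift_cst (pi_mid L)
  + moebius a a^* *: lift_cst (pi_line L).

Definition p2 (R : realType) (a : R[i]%C) (L K : {vspace C7 R}) : loop R :=
  p1 a L *m p1 a K.

Definition dress (R : realType) (c : R[i]%C) (K : {vspace C7 R}) (h : loop R) :
  loop R := p1 c K *m h *m invmx (p1 c (imgV (invmx (eval h c)) K)).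

Definition smx (R : realType) : 'M[R[i]%C]_7 :=
  diag_mx (\row_(i < 7) if (i < 4)%N then -1 else 1).

Definition sV (R : realType) (U : {vspace C7 R}) : {vspace C7 R} :=
  imgV (smx R) U.

Definition sigma (R : realType) (A : 'M[R[i]%C]_7) : 'M[R[i]%C]_7 :=
  smx R *m A *m invmx (smx R).

Definition tau (R : realType) (A : 'M[R[i]%C]_7) : 'M[R[i]%C]_7 := cconj A.

Definition q2 (R : realType) (a : R[i]%C) (L K : {vspace C7 R}) : loop R :=
  let sK' := imgV (eval (p2 a L K) (- a)) (sV K) in
  let sL' := imgV (eval (dress (- a) sK' (p2 a L K)) (- a)) (sV L) in
  p2 (- a) sL' sK' *m p2 a L K.

Definition twisted_loop_group (R : realType) (g : loop R) : Prop :=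
  [/\ forall z, holo_at g z -> in_G2 (eval g z),
      forall i j, has_value_infty (g i j) (1%:M i j : R[i]%C),
      forall z, holo_at g z^* -> holo_at g z ->
        tau (eval g z^*) = eval g z &
      forall z, holo_at g (- z) -> holo_at g z ->
        sigma (eval g (- z)) = eval g z].

Inductive generated (R : realType) (S : loop R -> Prop) : loop R -> Prop :=
| generated_mem g : S g -> generated S g
| generated_one : generated S 1%:M
| generated_mul g h : generated S g -> generated S h -> generated S (g *m h)
| generated_inv g : generated S g -> generated S (invmx g).

Lemma has_value_uniq (R : realType) (f : ratfun R) (a c d : R[i]%C) :
  has_value f a c -> has_value f a d -> c = d.
Proof.
move=> [p [q [qa fE ->]]] [p' [q' [qa' fE' ->]]].
have nz (r : {poly R[i]%C}) : r.[a] != 0 -> tofrac r != 0 :> ratfun R.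
  by apply: contra; rewrite tofrac_eq0 => /eqP ->; rewrite horner0.
have /eqP := fE'; rewrite fE eqr_div ?nz // -!tofracM tofrac_eq => /eqP E.
by apply/eqP; rewrite eqr_div // -!hornerM E.
Qed.

Lemma fvalE (R : realType) (f : ratfun R) (a c : R[i]%C) :
  has_value f a c -> fval f a = c.
Proof.
move=> fc; apply: xget_unique => // d fd.
exact: has_value_uniq fd fc.
Qed.

Lemma has_value_infty_uniq (R : realType) (f : ratfun R) (c d : R[i]%C) :
  has_value_infty f c -> has_value_infty f d -> c = d.
Proof.
move=> [p [q [q0 sp fE ->]]] [p' [q' [q0' sp' fE' ->]]].
have nz (r : {poly R[i]%C}) : r != 0 -> tofrac r != 0 :> ratfun R by rewrite tofrac_eq0.
have /eqP := fE'; rewrite fE eqr_div ?nz // -!tofracM tofrac_eq => /eqP E.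
apply/eqP; rewrite eqr_div ?lead_coef_eq0 //.
have key (r s : {poly R[i]%C}) (m n : nat) :
    (size r <= m.+1)%N -> (size s <= n.+1)%N -> r`_m * s`_n = (r * s)`_(m + n).
  move=> sr ss; rewrite coefM (bigD1 (inord m)) //=.
  rewrite inordK ?ltnS ?leq_addr // addKn big1 ?addr0 // => i im.
  have [lt|le] := ltnP i m.
    by rewrite [s`__]nth_default ?mulr0 //; apply: leq_trans ss _;
      rewrite -addnBAC ?(ltnW lt) // -addn1 addnC leq_add2r subn_gt0.
  rewrite [r`__]nth_default ?mul0r //; apply: leq_trans sr _.
  rewrite ltn_neqAle le andbT; apply: contra im => /eqP mi.
  by apply/eqP/val_inj; rewrite /= inordK ?ltnS ?leq_addr.
have sz (r : {poly R[i]%C}) : r != 0 -> (size r <= (size r).-1.+1)%N by case: (size r).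
have sz' (r t : {poly R[i]%C}) : t != 0 -> (size r <= size t)%N -> (size r <= (size t).-1.+1)%N.
  by move=> t0 h; apply: leq_trans h (sz _ t0).
by rewrite !lead_coefE (key _ _ _ _ (sz' _ _ q0 sp) (sz _ q0'))
           (key _ _ _ _ (sz' _ _ q0' sp') (sz _ q0)) E addnC.
Qed.

Lemma mem_perp (R : realType) (U : {vspace C7 R}) (v : C7 R) :
  reflect (forall u, u \in U -> dot u v = 0) (v \in perp U).
Proof.
have dotE (u w : C7 R) : (u^T *m w) 0 0 = dot u w.
  by rewrite mxE; apply: eq_bigr => i _; rewrite mxE.
have memE : (v \in perp U) = all (fun u => dot u v == 0) (vbasis U).
  rewrite /perp; elim: (tval (vbasis U)) => [|u s IH] /=.
    by rewrite big_nil memvf.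
  rewrite big_cons memv_cap IH memv_ker lfunE /= -dotE; congr (_ && _).
  apply/eqP/eqP => [->|h]; first by rewrite mxE.
  by apply/matrixP => i j; rewrite !ord1 h mxE.
rewrite memE; apply: (iffP allP) => [H u Uu|H u bu]; last first.
  by apply/eqP/H/vbasis_mem.
rewrite (coord_vbasis Uu) /dot.
under eq_bigr => i _ do rewrite summxE mulr_suml.
rewrite exchange_big big1 //= => k _.
under eq_bigr => i _ do rewrite mxE -mulrA.
rewrite -mulr_sumr -/(dot _ _) (eqP (H _ _)) ?mulr0 //.
by apply: mem_nth; rewrite size_tuple.
Qed.

Lemma cconjK (R : realType) (m n : nat) : involutive (@cconj R m n).
Proof. by move=> A; apply/matrixP => i j; rewrite !mxE conjCK. Qed.

Lemma mem_conjV (R : realType) (U : {vspace C7 R}) (v : C7 R) :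
  (v \in conjV U) = (cconj v \in U).
Proof.
have cS (c : R[i]%C) (w : C7 R) : cconj (c *: w) = c^* *: cconj w.
  exact: map_mxZ.
have cSum n (F : 'I_n -> C7 R) : cconj (\sum_i F i) = \sum_i cconj (F i).
  exact: raddf_sum.
apply/idP/idP => [/(@coord_span _ _ _ (map_tuple (@cconj R 7 1) (vbasis U)))|].
  move=> ->; rewrite cSum; apply: memv_suml => k _; rewrite cS memvZ //.
  by rewrite (nth_map 0) ?size_tuple // cconjK vbasis_mem // mem_nth ?size_tuple.
move=> /coord_vbasis E; rewrite -[v]cconjK E cSum.
apply: memv_suml => k _; rewrite cS memvZ // memv_span //.
by apply: map_f; apply: mem_nth; rewrite size_tuple.
Qed.

(* Main.v *)
Require Import Defs.
From HB Require Import structures.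
From mathcomp Require Import all_boot all_order all_algebra.
From mathcomp Require Import boolp classical_sets reals complex.
From mathcomp Require Import ring generic_quotient.

Import Order.TTheory GRing.Theory Num.Theory.
Local Open Scope ring_scope.

Set Implicit Arguments.
Unset Strict Implicit.
Unset Printing Implicit Defensive.

(** Multiplication by generators removes the poles of a twisted loop, and a
twisted loop without poles is the identity.

_Liouville._ A rational loop with value 1 at infinity and no pole is constant
([loop_liouville]).  Real poles never occur: at a real pole the leading
coefficient A is a real matrix with A^T A = 0, hence zero ([no_real_pole]).  It
therefore suffices to lower the order of a nonreal pole by multiplying with a
generator that creates no new pole outside the orbit of that pole under
conjugation and negation.

_One pole._  Let g have a pole of order n at a nonreal point a, put
t = lambda - a and t^n g = A + t A1 + ...  The first two orders in t of the
orthogonality and of the multiplicativity of g say that the image of A is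
isotropic with vanishing octonion products, that A^T A1 is skew, and that A and
A1 satisfy a Leibniz rule.  Such an image has dimension at most 2
([coassociative_dim2]).  Choose k in it and multiply g by the simple factor of
k at a, which replaces A by a matrix B ([residue]).  If B is nonzero, the
skewness and the dimension bound force B = l u^T with (l, k) admissible, and a
leading coefficient of rank one is removed by the simple factor of l
([rank_one_pole]).  If B = 0, then A has rank one, the pole is not simple, and l
can be any nonzero vector annihilated by k that is orthogonal to conj k and to the image
of A1.  This is [leading_term_choice], and [reduce_pole] draws the conclusion:
p_{a,L,K} g has a pole of order at most n - 1 at a.

_Pair loops take values in G2._  The product p_{a,L,K} fixes a subspace of
dimension 3 and acts with determinant 1 on an isotropic plane and dually on an
opposite one.  It is a product of four transvections 1 + s (e wedge f) with
e.f = 0, each of which is the exponential of a nilpotent derivation of the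
octonions ([bivec_derivation], [transvection_G2], [hyperbolic_pair_G2]).

_The twist._  If a is imaginary, the map v |-> s conj v preserves everything
above, so l and k can be chosen fixed by it ([conj_s_fixed]); then p_{a,L,K} is
itself twisted.  Otherwise put p = p_{a,L,K} and q = f p with
f = p_{-a,(sL)',(sK)'}.  The dressing identity ([dressing_hol]) makes
f p (twist p)^-1 holomorphic at -a.  [remove_pole] yields a product f' of
G2-valued pair loops at -a with the same property, and f = f' by Liouville, so q
is G2-valued.  Writing twist(q) q^-1 in two ways shows that it has no poles at
all, so q is twisted ([twist_product_fixed]).

Induction on a divisor that bounds the poles ([pole_divisor], [pole_reduction],
[generated_from_poles]) concludes; conversely the generators are twisted, and
twisted loops form a group. *)

(** * Octonion identities over a commutative ring *)

(** The base ring is left arbitrary because the identities are used both over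
the complex numbers and over the field of rational functions. *)
Definition struct_coef (F : comNzRingType) (a b c : 'I_7) : F :=
  if pos_triple a.+1 b.+1 c.+1 then 1
  else if pos_triple b.+1 a.+1 c.+1 then -1 else 0.

Definition bil (F : comNzRingType) (x y : 'cV[F]_7) : F :=
  \sum_i x i 0 * y i 0.

Definition cprod (F : comNzRingType) (x y : 'cV[F]_7) : 'cV[F]_7 :=
  \col_c \sum_a \sum_b struct_coef F a b c * x a 0 * y b 0.

Definition bivec (F : comNzRingType) (e f x : 'cV[F]_7) :=
  bil x e *: f - bil x f *: e.

Section OctonionIdentities.
Variable F : comNzRingType.
Implicit Types x y z e f : 'cV[F]_7.

(** The value 0 beyond index 6 makes the coordinates of a sum or a product an
equation between functions of a natural number, which rewrites without side
condition. *)
Definition co x (k : nat) : F := if (k < 7)%N then x (inord k) 0 else 0.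
Arguments co x k%_N.

Lemma co_ord x (i : 'I_7) : x i 0 = co x i.
Proof. by rewrite /co ltn_ord inord_val. Qed.

Lemma coP x y : (forall k, (k < 7)%N -> co x k = co y k) -> x = y.
Proof.
by move=> h; apply/matrixP => i j; rewrite ord1 !co_ord; apply: h.
Qed.

Lemma coD x y : co (x + y) = fun k => co x k + co y k.
Proof. by apply: funext => k; rewrite /co; case: ifP => _; rewrite ?mxE ?addr0. Qed.
Lemma coN x : co (- x) = fun k => - co x k.
Proof. by apply: funext => k; rewrite /co; case: ifP => _; rewrite ?mxE ?oppr0. Qed.
Lemma coZ a x : co (a *: x) = fun k => a * co x k.
Proof. by apply: funext => k; rewrite /co; case: ifP => _; rewrite ?mxE ?mulr0. Qed.

Lemma sum7 (f : nat -> F) :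
  \sum_(a < 7) f a = f 0%N + f 1%N + f 2%N + f 3%N + f 4%N + f 5%N + f 6%N.
Proof. by rewrite !big_ord_recr big_ord0 /= add0r. Qed.

Definition sp (u v : nat -> F) : F :=
  u 0%N * v 0%N + u 1%N * v 1%N + u 2%N * v 2%N + u 3%N * v 3%N
  + u 4%N * v 4%N + u 5%N * v 5%N + u 6%N * v 6%N.

Lemma bilE x y : bil x y = sp (co x) (co y).
Proof.
rewrite /bil; under eq_bigr => i _ do rewrite !co_ord.
by rewrite (sum7 (fun i => co x i * co y i)).
Qed.

Definition minor (u v : nat -> F) (i j : nat) := u i * v j - u j * v i.
Arguments minor u v (i j)%_N.

Definition cp (u v : nat -> F) (k : nat) : F :=
  match k with
  | 0%N => minor u v 4 1 + minor u v 5 2 + minor u v 6 3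
  | 1%N => minor u v 0 4 + minor u v 6 2 + minor u v 3 5
  | 2%N => minor u v 0 5 + minor u v 1 6 + minor u v 4 3
  | 3%N => minor u v 0 6 + minor u v 5 1 + minor u v 2 4
  | 4%N => minor u v 1 0 + minor u v 3 2 + minor u v 5 6
  | 5%N => minor u v 2 0 + minor u v 1 3 + minor u v 6 4
  | 6%N => minor u v 3 0 + minor u v 2 1 + minor u v 4 5
  | _ => 0
  end.

Lemma coC x y : co (cprod x y) = cp (co x) (co y).
Proof.
apply: funext => k; rewrite {1}/co; case: ifP => [hk|]; last first.
  by move: k => [|[|[|[|[|[|[|]]]]]]].
rewrite mxE; transitivity (\sum_(a < 7) \sum_(b < 7)
    (if pos_triple a.+1 b.+1 k.+1 then 1
     else if pos_triple b.+1 a.+1 k.+1 then -1 else 0) * co x a * co y b).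
  apply: eq_bigr => a _; apply: eq_bigr => b _.
  by rewrite /struct_coef inordK // !co_ord.
rewrite (sum7 (fun a => \sum_(b < 7) (if pos_triple a.+1 b.+1 _ then 1 else
  if pos_triple b.+1 a.+1 _ then -1 else 0) * co x a * co y b)).
rewrite 7!(sum7 (fun b => (if pos_triple _ b.+1 _ then 1 else
  if pos_triple b.+1 _ _ then -1 else 0) * _ * co y b)).
by move: k hk => [|[|[|[|[|[|[|//]]]]]]] _; rewrite /cp /pos_triple /fano /minor /=;
  ring.
Qed.

Definition coE := (coC, coD, coN, coZ, bilE).

Ltac coords := rewrite ?coE; cbv beta iota delta [cp minor sp]; ring.
Ltac coordwise := apply: coP => -[|[|[|[|[|[|[|//]]]]]]] _; coords.

Lemma bilC x y : bil x y = bil y x.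
Proof. coords. Qed.

Lemma bilDr x y z : bil x (y + z) = bil x y + bil x z.
Proof. coords. Qed.

Lemma bilZr a x y : bil x (a *: y) = a * bil x y.
Proof. coords. Qed.

Lemma bilNr x y : bil x (- y) = - bil x y.
Proof. coords. Qed.

Lemma bilDl x y z : bil (x + y) z = bil x z + bil y z.
Proof. coords. Qed.

Lemma bilZl a x y : bil (a *: x) y = a * bil x y.
Proof. coords. Qed.

Lemma bilNl x y : bil (- x) y = - bil x y.
Proof. coords. Qed.

Lemma cprod_anti x y : cprod x y = - cprod y x.
Proof. coordwise. Qed.

Lemma cprodDr x y z : cprod x (y + z) = cprod x y + cprod x z.
Proof. coordwise. Qed.

Lemma cprodZr a x y : cprod x (a *: y) = a *: cprod x y.
Proof. coordwise. Qed.

Lemma cprodNr x y : cprod x (- y) = - cprod x y.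
Proof. by rewrite -scaleN1r cprodZr scaleN1r. Qed.

Lemma cprodDl x y z : cprod (x + y) z = cprod x z + cprod y z.
Proof. by rewrite cprod_anti cprodDr opprD -!(cprod_anti _ z). Qed.

Lemma cprodZl a x y : cprod (a *: x) y = a *: cprod x y.
Proof. by rewrite cprod_anti cprodZr -scalerN -cprod_anti. Qed.

Lemma cprodNl x y : cprod (- x) y = - cprod x y.
Proof. by rewrite -scaleN1r cprodZl scaleN1r. Qed.

Lemma cprodxx x : cprod x x = 0.
Proof. apply: coP; rewrite coC -(scale0r x) coZ => -[|[|[|[|[|[|[|//]]]]]]] _; coords. Qed.

Lemma cprodx0 x : cprod x 0 = 0.
Proof. by rewrite -(scale0r x) cprodZr !scale0r. Qed.

Lemma bilx0 x : bil x 0 = 0.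
Proof. by rewrite -(scale0r x) bilZr mul0r. Qed.

Lemma bil0x x : bil 0 x = 0.
Proof. by rewrite bilC bilx0. Qed.

Lemma cprod0x x : cprod 0 x = 0.
Proof. by rewrite -(scale0r x) cprodZl !scale0r. Qed.

Lemma bil_cprod x y z : bil (cprod x y) z = bil x (cprod y z).
Proof. coords. Qed.

(** Polarized alternativity. *)
Lemma cprod_cprod x z y :
  cprod x (cprod z y) + cprod z (cprod x y)
  = bil x y *: z + bil z y *: x - (bil x z *+ 2) *: y.
Proof. coordwise. Qed.

Lemma cprod_cprod_same x y :
  cprod x (cprod x y) = bil x y *: x - bil x x *: y.
Proof. coordwise. Qed.

Lemma bilE_mx x y : x^T *m y = (bil x y)%:M.
Proof.
apply/matrixP => i j; rewrite !ord1 !mxE /= mulr1n /bil.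
by apply: eq_bigr => k _; rewrite mxE.
Qed.

Lemma bil_mull (g : 'M[F]_7) x y : bil (g *m x) y = bil x (g^T *m y).
Proof.
have := bilE_mx (g *m x) y; rewrite trmx_mul -mulmxA bilE_mx.
by move/matrixP/(_ 0 0); rewrite !mxE /= !mulr1n.
Qed.

Lemma mul_outer (u v x : 'cV[F]_7) : u *m v^T *m x = bil v x *: u.
Proof. by rewrite -mulmxA bilE_mx mul_mx_scalar. Qed.

Lemma col_ext m (g h : 'M[F]_(m, 7)) : (forall x, g *m x = h *m x) -> g = h.
Proof.
move=> gh; apply/matrixP => i j; have := gh (delta_mx j 0).
by rewrite -!colE => /matrixP/(_ i 0); rewrite !mxE.
Qed.

Definition is_G2 (g : 'M[F]_7) :=
  g^T *m g = 1%:M /\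
  forall x y, cprod (g *m x) (g *m y) = g *m cprod x y.

End OctonionIdentities.

(** * Transvections and hyperbolic pairs in G2 *)
Section G2Field.
Variable F : fieldType.
Hypothesis two : 2%:R != 0 :> F.
Implicit Types x y e f k w l m : 'cV[F]_7.

Lemma is_G2_1 : is_G2 (1%:M : 'M[F]_7).
Proof. by split=> [|x y]; rewrite ?trmx1 !mul1mx. Qed.

Lemma is_G2M (g h : 'M[F]_7) : is_G2 g -> is_G2 h -> is_G2 (g *m h).
Proof.
move=> [og pg] [oh ph]; split=> [|x y].
  by rewrite trmx_mul mulmxA -(mulmxA h^T) og mulmx1.
by rewrite -!mulmxA pg ph.
Qed.

Lemma doubleI (V : lmodType F) (v : V) : v *+ 2 = 0 -> v = 0.
Proof.
by rewrite -scaler_nat => /eqP; rewrite scaler_eq0 (negPf two) => /eqP.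
Qed.

Lemma is_G2V (g : 'M[F]_7) : is_G2 g -> is_G2 g^T.
Proof.
move=> [og pg]; have og' := mulmx1C og.
split=> [|x y]; first by rewrite trmxK.
rewrite -[LHS]mul1mx -og -mulmxA -pg !mulmxA.
by rewrite og' !mul1mx.
Qed.

(** Multiply k.w = 0 once more by k and use alternativity. *)
Lemma Ann_orth k w : k != 0 -> bil k k = 0 -> cprod k w = 0 -> bil k w = 0.
Proof.
move=> k0 kk kw; have := cprod_cprod_same k w.
rewrite kw cprodx0 kk scale0r subr0 => /esym/eqP.
by rewrite scaler_eq0 (negPf k0) orbF => /eqP.
Qed.

(** Alternativity gives k.(w.w') = <w, w'> k; the left side is antisymmetric in
w, w' and the right side symmetric. *)
Lemma Ann_isotropic k w w' : k != 0 -> bil k k = 0 ->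
  cprod k w = 0 -> cprod k w' = 0 -> bil w w' = 0.
Proof.
move=> k0 kk kw kw'.
have bw := Ann_orth k0 kk kw; have bw' := Ann_orth k0 kk kw'.
have := cprod_cprod k w w'; have := cprod_cprod k w' w.
rewrite kw kw' bw bw' !cprodx0 !mul0rn !scale0r !addr0 !subr0 !add0r.
rewrite (bilC w') (cprod_anti w') cprodNr => <- /eqP.
rewrite -addr_eq0 -mulr2n => /eqP/doubleI/eqP; rewrite -oppr_eq0.
have := cprod_cprod k w w'.
rewrite kw' bw bw' !cprodx0 !mul0rn !scale0r !addr0 !subr0 !add0r => ->.
by rewrite oppr_eq0 scaler_eq0 (negPf k0) orbF => /eqP.
Qed.

(** Exchanging e and f shows that the commutator of the multiplications by e and
f is three times [bivec e f]. *)
Lemma cprod_cprod_null e f w :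
  bil e f = 0 -> cprod e f = 0 ->
  cprod e (cprod f w) = (bil e w *+ 2) *: f - bil f w *: e.
Proof.
move=> ef exf; have := cprod_cprod e w f.
rewrite exf cprodx0 addr0 ef scale0r add0r.
rewrite cprod_anti (cprod_anti w) cprodNl opprK cprod_anti => /eqP.
rewrite eqr_oppLR => /eqP ->; rewrite (bilC w).
by rewrite opprB addrC.
Qed.

(** Moving e and f past x in e.(f.(x.y)), and comparing with the formula of
[cprod_cprod_null] for the vector x.y, gives twice the identity.  In Lie
algebra terms, such an e wedge f is a long root vector of g2. *)
Lemma bivec_derivation e f x y : bil e f = 0 -> cprod e f = 0 ->
  bivec e f (cprod x y) = cprod (bivec e f x) y + cprod x (bivec e f y).
Proof.
move=> ef exf; apply/eqP; rewrite -subr_eq0; apply/eqP/doubleI.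
have E1 : cprod f (cprod x y) = - cprod x (cprod f y)
  + (bil f y *: x + bil x y *: f - (bil f x *+ 2) *: y).
  by rewrite -cprod_cprod [RHS]addrC addrK.
have E2 : cprod e (cprod x (cprod f y)) = - cprod x (cprod e (cprod f y))
  + (bil e (cprod f y) *: x + bil x (cprod f y) *: e - (bil e x *+ 2) *: cprod f y).
  by rewrite -cprod_cprod [RHS]addrC addrK.
have H := cprod_cprod_null (cprod x y) ef exf.
have exfy : bil e (cprod f y) = 0 by rewrite -bil_cprod exf bil0x.
have fxy : bil x (cprod f y) = - bil f (cprod x y).
  by rewrite bilC bil_cprod (cprod_anti y) bilNr.
have exf' : cprod f e = 0 by rewrite cprod_anti exf oppr0.
move: H; rewrite E1 cprodDr cprodNr E2 (cprod_cprod_null y ef exf) exfy fxy.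
rewrite !(cprodDr, cprodNr, cprodZr) exf scaler0 addr0 scale0r add0r.
move/eqP; rewrite -subr_eq0 => /eqP H; rewrite -[RHS]oppr0 -[in RHS]H.
rewrite /bivec !(cprodDl, cprodNl, cprodZl, cprodDr, cprodNr, cprodZr).
rewrite (bilC (cprod x y)) (bilC (cprod x y) f) (bilC x e) (bilC x f).
rewrite (bilC y) (bilC y f) (cprod_anti e x).
apply: coP => k _; rewrite mulr2n !(coD, coN, coZ); ring.
Qed.

Definition transvection (s : F) e f : 'M[F]_7 :=
  1%:M + s *: (f *m e^T - e *m f^T).

Lemma transvectionE s e f x :
  transvection s e f *m x = x + s *: bivec e f x.
Proof.
rewrite mulmxDl mul1mx -scalemxAl mulmxBl !mul_outer.
by rewrite /bivec (bilC e) (bilC f).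
Qed.

(** The transvection is the exponential of the derivation [bivec e f], which
squares to zero; it is multiplicative because any two values of [bivec e f]
have product zero. *)
Lemma transvection_G2 s e f : bil e e = 0 -> bil f f = 0 -> bil e f = 0 ->
  cprod e f = 0 -> is_G2 (transvection s e f).
Proof.
move=> ee ff ef exf; have fe : bil f e = 0 by rewrite bilC.
have fxe : cprod f e = 0 by rewrite cprod_anti exf oppr0.
split.
  have tT : (transvection s e f)^T = transvection (- s) e f.
    rewrite /transvection linearD /= trmx1 linearZ /= linearB /= !trmx_mul !trmxK.
    by rewrite scaleNr -scalerN opprB.
  apply: col_ext => x; rewrite tT -mulmxA !transvectionE mul1mx.
  rewrite /bivec !(bilDl, bilNl, bilZl) ee ff ef fe.
  by apply: coP => k _; rewrite !(coD, coN, coZ); ring.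
have expand a b x y : cprod (x + s *: a) (y + s *: b)
    = cprod x y + s *: (cprod a y + cprod x b) + (s * s) *: cprod a b.
  rewrite !(cprodDl, cprodDr, cprodZl, cprodZr) !scalerDr !scalerA.
  by apply: coP => k _; rewrite !(coD, coN, coZ); ring.
move=> x y; rewrite !transvectionE expand -bivec_derivation //.
have -> : cprod (bivec e f x) (bivec e f y) = 0.
  rewrite /bivec !(cprodDl, cprodNl, cprodZl, cprodDr, cprodNr, cprodZr).
  by rewrite !cprodxx exf fxe ?(scaler0, oppr0, addr0).
by rewrite scaler0 addr0.
Qed.

(** The orthogonal map that scales the null line of l by z and that of l' by
z^-1, and fixes the orthogonal complement of both. *)
Definition hyperbolic (z : F) l l' : 'M[F]_7 :=
  1%:M + ((z - 1) / bil l l') *: (l *m l'^T)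
  + ((z^-1 - 1) / bil l l') *: (l' *m l^T).

Lemma hyperbolicE (z : F) l l' x :
  hyperbolic z l l' *m x = x + ((z - 1) / bil l l' * bil l' x) *: l
    + ((z^-1 - 1) / bil l l' * bil l x) *: l'.
Proof.
by rewrite !mulmxDl mul1mx -!scalemxAl !mul_outer !scalerA.
Qed.

(** Both factors preserve the isotropic plane spanned by m and l', act dually on
the opposite plane spanned by m' and l, and fix the orthogonal complement of the
two.  On the first plane one has determinant z^-1 and the other determinant z.
The product thus comes from SL2, which is generated by the transvections along
(l, m) and along (l', m'). *)
Lemma hyperbolic_pair_G2 (z c c' : F) l l' m m' :
  bil l l = 0 -> bil l' l' = 0 -> bil m m = 0 -> bil m' m' = 0 ->
  bil l m = 0 -> bil l m' = 0 -> bil l' m = 0 -> bil l' m' = 0 ->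
  cprod l m = 0 -> cprod l' m' = 0 ->
  z != 0 -> bil l l' != 0 -> bil m m' != 0 ->
  bil m m' + c * c' * bil l l' != 0 -> bil m m' + z * (c * c' * bil l l') != 0 ->
  is_G2 (hyperbolic z l l' *m hyperbolic z (m + c *: l') (m' + c' *: l)).
Proof.
move=> ll l'l' mm m'm' lm lm' l'm l'm' lxm l'xm'.
have [ml m'l ml' m'l'] :
  [/\ bil m l = 0, bil m' l = 0, bil m l' = 0 & bil m' l' = 0].
  by split; rewrite bilC.
set N := bil l l'; set M := bil m m'.
have l'l : bil l' l = N by rewrite bilC.
have m'm : bil m' m = M by rewrite bilC.
move=> z0 N0 M0 P0 Q0.
set P := M + c * c' * N.
(* In the basis (m, l') of the plane, the product has columns (a, c1) and
   (b, d) and determinant 1; s4 is chosen so that, once the transvection with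
   parameter s4 is undone, the lower left entry is 1. *)
pose b := (z - 1) * c' * N / P.
pose a := (c * c' * N + z * M) / P.
pose c1 := (z - 1) * c * M / (z * P).
pose d := (M + z * (c * c' * N)) / (z * P).
pose s4 := (1 - c1) / (d * M).
have -> : hyperbolic z l l' *m hyperbolic z (m + c *: l') (m' + c' *: l)
  = transvection ((a + b * s4 * M - 1) / N) l m
    *m (transvection (- M^-1) l' m'
    *m (transvection ((d - 1) / N) l m
    *m transvection s4 l' m')).
  have kk : bil (m + c *: l') (m' + c' *: l) = P.
    rewrite !(bilDl, bilDr, bilZl, bilZr) ml l'm' l'l.
    by rewrite /P /M; ring.
  apply: col_ext => x; rewrite -!mulmxA !hyperbolicE kk !transvectionE.
  rewrite /bivec !(bilDl, bilNl, bilZl, bilDr, bilNr, bilZr).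
  rewrite ?(ll, l'l', mm, m'm', lm, lm', l'm, l'm', ml, m'l, ml', m'l', l'l, m'm).
  rewrite (bilC x l) (bilC x m) (bilC x l') (bilC x m').
  apply: coP => k _; rewrite !(coD, coN, coZ).
  rewrite /s4 /d /c1 /b /a -/M -/N /P.
  by field; rewrite z0 N0 M0 P0 Q0.
by do 3!(apply: is_G2M; first exact: transvection_G2); exact: transvection_G2.
Qed.
End G2Field.

(** * Hermitian geometry of null vectors *)
Lemma kernel_vector (F : fieldType) p (A : 'M[F]_(p, 7)) :
  (\rank A < 7)%N -> exists2 x : 'cV[F]_7, x != 0 & A *m x = 0.
Proof.
move=> rA; exists (nz_row (kermx A^T))^T.
  rewrite trmx_eq0 nz_row_eq0 -mxrank_eq0 mxrank_ker mxrank_tr.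
  by rewrite -lt0n subn_gt0.
have /sub_kermxP : (nz_row (kermx A^T) <= kermx A^T)%MS := nz_row_sub _.
by move=> h; apply: trmx_inj; rewrite trmx_mul trmxK h trmx0.
Qed.

Lemma mxrank_col_mx_leq (F : fieldType) p q n (A : 'M[F]_(p, n)) (B : 'M[F]_(q, n)) :
  (\rank (col_mx A B) <= \rank A + \rank B)%N.
Proof. by rewrite -addsmxE; apply: mxrank_adds_leqif. Qed.

Definition cprod_mx (F : comNzRingType) (k : 'cV[F]_7) : 'M[F]_7 :=
  \matrix_(c, b) \sum_a struct_coef F a b c * k a 0.

Lemma cprod_mxE (F : comNzRingType) (k x : 'cV[F]_7) :
  cprod_mx k *m x = cprod k x.
Proof.
apply/matrixP => i j; rewrite ord1 !mxE exchange_big /=.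
by apply: eq_bigr => b _; rewrite mxE mulr_suml.
Qed.

(** The square of the multiplication by k is k k^T, of rank 1.  Sylvester's
inequality bounds the rank of the multiplication by 4, so its kernel has
dimension at least 3 and survives two linear conditions. *)
Lemma Ann_meets_perp (F : fieldType) (k v1 v2 : 'cV[F]_7) :
  bil k k = 0 -> exists w, [/\ w != 0, cprod k w = 0, bil w v1 = 0 & bil w v2 = 0].
Proof.
move=> kk.
have LL : cprod_mx k *m cprod_mx k = k *m k^T.
  apply: col_ext => x; rewrite -mulmxA !cprod_mxE cprod_cprod_same.
  by rewrite kk scale0r subr0 mul_outer.
have rL : (\rank (cprod_mx k) <= 4)%N.
  have := mxrank_mul_min (cprod_mx k) (cprod_mx k); rewrite LL => h.
  have : (\rank (k *m k^T) <= 1)%N.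
    by apply: leq_trans (mxrankM_maxl _ _) _; apply: rank_leq_col.
  move/(leq_trans h); rewrite leq_subLR => h2.
  by move: h2; case: (\rank _) => [|[|[|[|[|r]]]]] //; rewrite !addnS !addSn.
have [|w w0] := @kernel_vector F _ (col_mx (cprod_mx k) (col_mx v1^T v2^T)).
  apply: leq_ltn_trans (mxrank_col_mx_leq _ _) _.
  apply: (@leq_ltn_trans (4 + (1 + 1))) => //; apply: leq_add => //.
  apply: leq_trans (mxrank_col_mx_leq _ _) _.
  by apply: leq_add; apply: rank_leq_row.
rewrite !mul_col_mx !bilE_mx => h; exists w.
have /eqP := h; rewrite !col_mx_eq0 cprod_mxE => /and3P[/eqP h1 /eqP h2 /eqP h3].
split=> //; rewrite bilC; [move: h2|move: h3] => /matrixP/(_ 0 0);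
  by rewrite !mxE /= mulr1n.
Qed.

Section Hermitian.
Variable C : numClosedFieldType.
Implicit Types x y k l m w v : 'cV[C]_7.

Let two : 2%:R != 0 :> C. Proof. by rewrite pnatr_eq0. Qed.

Definition mxbar p q (A : 'M[C]_(p, q)) : 'M[C]_(p, q) := map_mx Num.conj A.

Lemma mxbarK p q (A : 'M[C]_(p, q)) : mxbar (mxbar A) = A.
Proof. by apply/matrixP => i j; rewrite !mxE conjCK. Qed.

Lemma mxbarD p q (A B : 'M[C]_(p, q)) : mxbar (A + B) = mxbar A + mxbar B.
Proof. exact: map_mxD. Qed.
Lemma mxbarZ p q a (A : 'M[C]_(p, q)) : mxbar (a *: A) = a^* *: mxbar A.
Proof. exact: map_mxZ. Qed.
Lemma mxbarM p q r (A : 'M[C]_(p, q)) (B : 'M[C]_(q, r)) :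
  mxbar (A *m B) = mxbar A *m mxbar B.
Proof. exact: map_mxM. Qed.
Lemma mxbar_eq0 p q (A : 'M[C]_(p, q)) : (mxbar A == 0) = (A == 0).
Proof. exact: map_mx_eq0. Qed.

Lemma bil_bar x y : bil (mxbar x) (mxbar y) = (bil x y)^*.
Proof.
by rewrite /bil rmorph_sum; apply: eq_bigr => i _; rewrite !mxE rmorphM.
Qed.

Lemma bil_barl x y : bil (mxbar x) y = (bil x (mxbar y))^*.
Proof. by rewrite -bil_bar mxbarK. Qed.

Lemma cprod_bar x y : cprod (mxbar x) (mxbar y) = mxbar (cprod x y).
Proof.
apply/matrixP => i j; rewrite !mxE rmorph_sum; apply: eq_bigr => a _.
rewrite rmorph_sum; apply: eq_bigr => b _; rewrite !mxE !rmorphM.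
congr (_ * _ * _); rewrite /struct_coef; case: ifP => _; first by rewrite rmorph1.
by case: ifP => _; rewrite ?rmorphN ?rmorph1 ?rmorph0.
Qed.

Lemma norm_neq0 x : x != 0 -> bil x (mxbar x) != 0.
Proof.
apply: contra; rewrite /bil psumr_eq0 => [/allP h|i _]; last first.
  by rewrite mxE mul_conjC_ge0.
apply/eqP/matrixP => i j; rewrite ord1 !mxE.
by have := h i (mem_index_enum _); rewrite mxE mul_conjC_eq0 => /eqP.
Qed.

Lemma norm_real x : (bil x (mxbar x))^* = bil x (mxbar x).
Proof. by rewrite -bil_bar mxbarK bilC. Qed.

Lemma bil_nondeg v : (forall y, bil v y = 0) -> v = 0.
Proof.
by move=> h; apply/eqP; apply: contraTT isT => /norm_neq0; rewrite h eqxx.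
Qed.

(** The combination u on the left is annihilated by l and, being anti-invariant
under conjugation, by conj l.  It is then orthogonal to both, and alternativity
for l, conj l and u leaves -2 <l, conj l> u = 0. *)
Lemma coassociative_opposite l m : l != 0 -> m != 0 ->
  bil l l = 0 -> bil m m = 0 -> bil l m = 0 -> bil l (mxbar m) = 0 ->
  cprod l m = 0 ->
  bil m (mxbar m) *: cprod l (mxbar l) + bil l (mxbar l) *: cprod m (mxbar m) = 0.
Proof.
move=> l0 m0 ll mm lm lm' lxm.
have half x y : bil x x = 0 -> bil x y = 0 -> bil x (mxbar y) = 0 -> cprod x y = 0 ->
  cprod x (bil y (mxbar y) *: cprod x (mxbar x)
             + bil x (mxbar x) *: cprod y (mxbar y)) = 0.
  move=> xx xy xy' xxy; rewrite cprodDr !cprodZr cprod_cprod_same xx scale0r subr0.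
  have := cprod_cprod x (mxbar y) y.
  rewrite xxy cprodx0 addr0 xy xy' scale0r mul0rn scale0r subr0 add0r.
  rewrite (cprod_anti (mxbar y)) cprodNr => /eqP; rewrite eqr_oppLR => /eqP ->.
  by rewrite (bilC (mxbar y)) scalerN !scalerA mulrC subrr.
set u := _ + _.
have lu : cprod l u = 0 by apply: half.
have ubar : mxbar u = - u.
  rewrite mxbarD !mxbarZ !norm_real -!cprod_bar !mxbarK.
  by rewrite (cprod_anti _ l) (cprod_anti _ m) !scalerN opprD.
have l'u : cprod (mxbar l) u = 0.
  by rewrite -[u]mxbarK cprod_bar ubar cprodNr lu oppr0 (_ : mxbar 0 = 0) //;
     apply/eqP; rewrite mxbar_eq0.
have bl : bil l u = 0 by apply: (Ann_orth l0).
have bl' : bil (mxbar l) u = 0.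
  apply: Ann_orth l'u; first by rewrite mxbar_eq0.
  by rewrite bil_bar ll rmorph0.
have := cprod_cprod l (mxbar l) u; rewrite lu l'u bl bl' !cprodx0 !scale0r addr0 sub0r.
move/esym/eqP; rewrite oppr_eq0 scaler_eq0 mulrn_eq0 /= (negPf (norm_neq0 l0)) /=.
by move/eqP.
Qed.

(** By [coassociative_opposite] the vectors v.conj v for v = k, l, m are, after
rescaling, pairwise opposite; hence all vanish.  But k.(k.conj k) is a nonzero
multiple of k. *)
Lemma coassociative_dim2 k l m : k != 0 -> l != 0 -> m != 0 ->
  bil k k = 0 -> bil l l = 0 -> bil m m = 0 ->
  bil k l = 0 -> bil k m = 0 -> bil l m = 0 ->
  bil k (mxbar l) = 0 -> bil k (mxbar m) = 0 -> bil l (mxbar m) = 0 ->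
  cprod k l = 0 -> cprod k m = 0 -> cprod l m = 0 -> False.
Proof.
move=> k0 l0 m0 kk ll mm kl km lm kl' km' lm' kxl kxm lxm.
have E1 := coassociative_opposite k0 l0 kk ll kl kl' kxl.
have E2 := coassociative_opposite k0 m0 kk mm km km' kxm.
have E3 := coassociative_opposite l0 m0 ll mm lm lm' lxm.
move: E1 E2 E3 (norm_neq0 k0) (norm_neq0 l0) (norm_neq0 m0).
have : cprod k (cprod k (mxbar k)) = bil k (mxbar k) *: k.
  by rewrite cprod_cprod_same kk scale0r subr0.
set K := bil k _; set L := bil l _; set M := bil m _.
set uk := cprod k (mxbar k); set ul := cprod l _; set um := cprod m _.
move=> kuk E1 E2 E3 K0 L0 M0.
have : (L * M * 2%:R) *: uk = 0.
  have -> : (L * M * 2%:R) *: uk = M *: (L *: uk + K *: ul) + L *: (M *: uk + K *: um)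
     - K *: (M *: ul + L *: um).
    by apply: coP => i _; rewrite !(coD, coN, coZ); ring.
  by rewrite E1 E2 E3 !scaler0 subr0 addr0.
move/eqP; rewrite scaler_eq0 !mulf_eq0 (negPf L0) (negPf M0) (negPf two) /=.
move=> /eqP uk0; move/eqP: kuk.
by rewrite uk0 cprodx0 eq_sym scaler_eq0 (negPf K0) (negPf k0).
Qed.

(** Otherwise choose x nonzero and orthogonal to k, conj k and k.conj k.  Then k
annihilates x and conj x, so x is annihilated by k and conj k while orthogonal
to both, and alternativity gives -2 <k, conj k> x = 0. *)
Lemma null_three_form k : k != 0 -> bil k k = 0 ->
  exists x y, [/\ bil k x = 0, bil k y = 0 & bil k (cprod x y) != 0].
Proof.
move=> k0 kk; apply: contrapT => H.
have {}H x y : bil k x = 0 -> bil k y = 0 -> bil k (cprod x y) = 0.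
  by move=> kx ky; apply/eqP; apply: contrapT => /negP h; apply: H; exists x, y.
have N0 := norm_neq0 k0.
have [|x x0] := @kernel_vector C _
  (col_mx k^T (col_mx (mxbar k)^T (cprod k (mxbar k))^T)).
  apply: leq_ltn_trans (mxrank_col_mx_leq _ _) _.
  apply: (@leq_ltn_trans (1 + (1 + 1))) => //.
  apply: leq_add; first exact: rank_leq_row.
  apply: leq_trans (mxrank_col_mx_leq _ _) _.
  by apply: leq_add; apply: rank_leq_row.
have scal0 (a : C) : (a%:M == 0 :> 'M_1) -> a = 0.
  by move/eqP/matrixP/(_ 0 0); rewrite !mxE /= mulr1n.
rewrite !mul_col_mx !bilE_mx => /eqP; rewrite !col_mx_eq0.
move=> /and3P[/scal0 h1 /scal0 h2 /scal0 h3].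
have ann v : bil k v = 0 -> bil (cprod k (mxbar k)) v = 0 -> cprod k v = 0.
  move=> kv kkv; apply: bil_nondeg => y.
  pose c := bil k y / bil k (mxbar k).
  have -> : y = (y - c *: mxbar k) + c *: mxbar k by rewrite subrK.
  rewrite bilDr bilZr !bil_cprod H ?add0r //.
    by rewrite cprod_anti bilNr -bil_cprod kkv oppr0 mulr0.
  by rewrite bilDr bilNr bilZr divfK ?subrr.
have kx := ann _ h1 h3.
have kx' : cprod k (mxbar x) = 0.
  apply: ann; first by rewrite bilC bil_barl bilC h2 rmorph0.
  rewrite -[cprod k _]mxbarK bil_bar -cprod_bar mxbarK cprod_anti bilNl h3.
  by rewrite oppr0 rmorph0.
have k'x : cprod (mxbar k) x = 0.
  by rewrite -[x]mxbarK cprod_bar kx'; apply/eqP; rewrite mxbar_eq0.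
have := cprod_cprod k (mxbar k) x.
rewrite kx k'x h1 h2 !cprodx0 !scale0r !addr0 sub0r => /esym/eqP.
by rewrite oppr_eq0 scaler_eq0 mulrn_eq0 /= (negPf N0) (negPf x0).
Qed.

(** Admissibility of the pair of lines in terms of spanning vectors; m is the
projection of k to the orthogonal complement of l and conj l. *)
Definition admissible_pair l k :=
  [/\ l != 0 /\ k != 0, bil l l = 0, bil k k = 0, bil k (mxbar l) = 0 &
      let m := k - (bil k l / bil l (mxbar l)) *: mxbar l in
      m != 0 /\ cprod l m = 0].

(** Admissibility seen from the second line.  In p_{a,L,K} g the factor of K acts
first, so k is found before l, and l is then determined only up to a multiple of
conj k.  The product of l with the projection of k vanishes because of
[coassociative_opposite]. *)
Lemma adm_swap k m c : k != 0 -> m != 0 -> bil k k = 0 -> bil m m = 0 ->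
  bil k m = 0 -> bil m (mxbar k) = 0 -> cprod k m = 0 ->
  admissible_pair (m + c *: mxbar k) k.
Proof.
move=> k0 m0 kk mm km mk' kxm.
have km' : bil k (mxbar m) = 0 by rewrite bilC bil_barl mk' rmorph0.
have k'k' : bil (mxbar k) (mxbar k) = 0 by rewrite bil_bar kk rmorph0.
have k'm' : bil (mxbar k) (mxbar m) = 0 by rewrite bil_bar km rmorph0.
have mk : bil m k = 0 by rewrite bilC.
have k'm : bil (mxbar k) m = 0 by rewrite bilC.
have := norm_neq0 k0; have := norm_neq0 m0.
set M := bil m (mxbar m); set N := bil k (mxbar k) => M0 N0.
have k'k : bil (mxbar k) k = N by rewrite bilC.
have l'E : mxbar (m + c *: mxbar k) = mxbar m + c^* *: k.
  by rewrite mxbarD mxbarZ mxbarK.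
have Nl : bil (m + c *: mxbar k) (mxbar m + c^* *: k) = M + c * c^* * N.
  rewrite !(bilDl, bilDr, bilZl, bilZr) mk k'm' k'k /M; ring.
have l0 : m + c *: mxbar k != 0.
  apply: contra M0 => /eqP h; rewrite /M.
  have : bil (m + c *: mxbar k) (mxbar m) = 0 by rewrite h bil0x.
  by rewrite bilDl bilZl k'm' mulr0 addr0 => ->.
have := norm_neq0 l0; rewrite l'E Nl => P0.
have kl : bil k (m + c *: mxbar k) = c * N by rewrite bilDr bilZr km add0r.
split=> //.
- by rewrite !(bilDl, bilDr, bilZl, bilZr) mm k'm mk' k'k' !mulr0 !addr0.
- by rewrite l'E bilDr bilZr kk km' mulr0 addr0.
rewrite /= l'E Nl kl; split.
  apply: contra M0 => /eqP h.
  have : bil (k - (c * N / (M + c * c^* * N)) *: (mxbar m + c^* *: k)) (mxbar k) = 0.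
    by rewrite h bil0x.
  rewrite !(bilDl, bilNl, bilZl) (bilC (mxbar m)) k'm' -/N add0r.
  have -> : N - c * N / (M + c * c^* * N) * (c^* * N) = N * M / (M + c * c^* * N).
    by field; rewrite P0.
  by move/eqP; rewrite !mulf_eq0 invr_eq0 (negPf P0) (negPf N0) /= orbF.
have E : cprod m (mxbar m) = - (M / N) *: cprod k (mxbar k).
  have := coassociative_opposite k0 m0 kk mm km km' kxm.
  rewrite -/M -/N => /eqP; rewrite addrC addr_eq0 => /eqP E.
  by rewrite scaleNr mulrC -scalerA -scalerN -E scalerA mulVf // scale1r.
have mxk : cprod m k = 0 by rewrite cprod_anti kxm oppr0.
have k'xm' : cprod (mxbar k) (mxbar m) = 0.
  by rewrite cprod_bar kxm; apply/eqP; rewrite mxbar_eq0.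
rewrite !(cprodDl, cprodDr, cprodNr, cprodZl, cprodZr) mxk k'xm' E.
rewrite (cprod_anti (mxbar k)).
apply: coP => i _; rewrite !(coD, coN, coZ) (_ : co 0 i = 0); last first.
  by rewrite /co mxE if_same.
by field; rewrite P0 N0.
Qed.

End Hermitian.

(** * Leading terms of a pole *)
Section LeadingTerms.
Variable C : numClosedFieldType.
Implicit Types x y k l m w v : 'cV[C]_7.
Variable S : 'M[C]_7.
Hypotheses (SG2 : is_G2 S) (SS : S *m S = 1%:M) (Sbar : mxbar S = S).

Let two : 2%:R != 0 :> C. Proof. by rewrite pnatr_eq0. Qed.

(** The real structure on vectors induced by the two symmetries of a twisted loop
at an imaginary point. *)
Definition conj_s v := S *m mxbar v.
Local Notation j := conj_s.

Lemma conj_sK v : j (j v) = v.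
Proof. by rewrite /j mxbarM Sbar mxbarK mulmxA SS mul1mx. Qed.

Lemma conj_sD x y : j (x + y) = j x + j y.
Proof. by rewrite /j mxbarD mulmxDr. Qed.

Lemma conj_sZ a x : j (a *: x) = a^* *: j x.
Proof. by rewrite /j mxbarZ scalemxAr. Qed.

Lemma bil_conj_s x y : bil (j x) (j y) = (bil x y)^*.
Proof.
by rewrite bil_mull mulmxA (proj1 SG2) mul1mx bil_bar.
Qed.

Lemma cprod_conj_s x y : cprod (j x) (j y) = j (cprod x y).
Proof. by rewrite (proj2 SG2) cprod_bar. Qed.

Lemma mxbar_conj_s x : mxbar (j x) = j (mxbar x).
Proof. by rewrite /j mxbarM Sbar. Qed.

(** For a nonzero w in a subspace stable under j, either w + j w is nonzero, or
i w is fixed. *)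
Lemma conj_s_fixed (symm : bool) (P : 'cV[C]_7 -> Prop) w :
  (forall a x, P x -> P (a *: x)) -> (forall x y, P x -> P y -> P (x + y)) ->
  (symm -> forall x, P x -> P (j x)) -> w != 0 -> P w ->
  exists v, [/\ v != 0, P v & symm -> j v = v].
Proof.
move=> PZ PD Pj w0 Pw; case: symm Pj => [/(_ isT) Pj|_]; last by exists w.
have [s0|s0] := eqVneq (w + j w) 0; last first.
  exists (w + j w); split=> // [|_]; first exact: PD (Pj _ Pw).
  by rewrite conj_sD conj_sK addrC.
exists ('i *: w); split=> [||_]; first by rewrite scaler_eq0 negb_or neq0Ci.
  exact: PZ.
move/eqP: s0; rewrite addrC addr_eq0 => /eqP jw.
by rewrite conj_sZ conjCi jw scalerN scaleNr opprK.
Qed.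

Lemma rank_one_of_image (B : 'M[C]_7) l :
  l != 0 -> (forall x, exists r, B *m x = r *: l) ->
  exists k, B = l *m k^T.
Proof.
move=> l0 h.
exists (\col_i (bil (mxbar l) (B *m delta_mx i 0) / bil l (mxbar l))).
apply/matrixP => i c; rewrite !mxE big_ord1 !mxE.
have [r Br] := h (delta_mx c 0).
rewrite Br bilZr (bilC (mxbar l)) mulfK ?norm_neq0 //.
by have := Br; rewrite -colE => /matrixP/(_ i 0); rewrite !mxE mulrC.
Qed.

(** A and A1 are the first two coefficients of t^n g.  The flag [simple_pole] says
that n = 1, where the Leibniz rule for A and A1 has a right hand side; [symm]
asks for a choice compatible with j, and eps is then the sign (-1)^n.  The scalar
tau0 stands for a - conj a. *)
Section Reduce.
Variables (A A1 : 'M[C]_7) (simple_pole symm : bool) (tau0 eps : C).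
Hypothesis A0 : A != 0.
Hypothesis tau_imag : tau0^* = - tau0.
Hypothesis iso : A^T *m A = 0.
Hypothesis iso' : A *m A^T = 0.
Hypothesis null : forall x y, cprod (A *m x) (A *m y) = 0.
Hypothesis skew : A^T *m A1 + A1^T *m A = 0.
Hypothesis cross1 : forall x y,
  cprod (A *m x) (A1 *m y) + cprod (A1 *m x) (A *m y)
  = if simple_pole then A *m cprod x y else 0.
Hypothesis eps0 : eps != 0.
Hypothesis jA : symm -> S *m mxbar A *m S = eps *: A.
Hypothesis jA1 : symm -> S *m mxbar A1 *m S = - eps *: A1.

(** Leading coefficient of p g when p is the simple factor of k at a: as
k^T A = 0, the pole of p meets only A1. *)
Definition residue k : 'M[C]_7 :=
  A - (bil k (mxbar k))^-1 *: (k *m (mxbar k)^T *m A)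
  + (tau0 / bil k (mxbar k)) *: (mxbar k *m k^T *m A1).

Lemma residueE k x : residue k *m x =
  A *m x - ((bil k (mxbar k))^-1 * bil (mxbar k) (A *m x)) *: k
  + (tau0 / bil k (mxbar k) * bil k (A1 *m x)) *: mxbar k.
Proof.
rewrite /residue mulmxDl mulmxBl -!scalemxAl.
by rewrite -(mulmxA _ A) -(mulmxA _ A1) !mul_outer !scalerA.
Qed.

Let isoE x y : bil (A *m x) (A *m y) = 0.
Proof. by rewrite bil_mull mulmxA iso mul0mx bilx0. Qed.

Let skewE x y : bil (A *m x) (A1 *m y) = - bil (A1 *m x) (A *m y).
Proof.
rewrite !bil_mull !mulmxA; apply/eqP; rewrite -addr_eq0 -bilDr -mulmxDl skew.
by rewrite mul0mx bilx0.
Qed.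

Let half (a : C) : a = - a -> a = 0.
Proof.
by move/eqP; rewrite -addr_eq0 -mulr2n mulrn_eq0 /= => /eqP.
Qed.

Let jAx : symm -> forall x, j (A *m x) = A *m (eps *: j x).
Proof.
move=> J x; rewrite /j mxbarM mulmxA -scalemxAr scalemxAl -jA //.
by rewrite -!mulmxA (mulmxA S S) SS mul1mx.
Qed.

Let jA1x : symm -> forall x, j (A1 *m x) = A1 *m (- eps *: j x).
Proof.
move=> J x; rewrite /j mxbarM mulmxA -scalemxAr scalemxAl -jA1 //.
by rewrite -!mulmxA (mulmxA S S) SS mul1mx.
Qed.

(** Take k in the image of A.  Write md x for the component of A x orthogonal to
conj k; then B x is md x plus a multiple of conj k that, by skewness, vanishes
with md x.  By [coassociative_dim2] the values of md lie on one line, so B has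
rank at most one.

If B = 0, then A = k u^T with u null.  For a simple pole the Leibniz rule would
give <u, x.y> = 0 for all x, y orthogonal to u, against [null_three_form].  For a
multiple pole it gives k.(A1 x) = 0 for x orthogonal to u.  By [Ann_isotropic],
an l annihilated by k is orthogonal to these A1 x, so a single further condition,
at a vector z with A z = k, makes it orthogonal to the whole image of A1;
[Ann_meets_perp] provides l. *)
Lemma leading_term_choice :
  exists k, [/\ k != 0, bil k k = 0, k^T *m A = 0, symm -> j k = k &
    (exists l u, [/\ residue k = l *m u^T, u != 0, admissible_pair l k & symm -> j l = l])
    \/ (residue k = 0 /\ ~~ simple_pole /\ exists l, [/\ admissible_pair l k,
         bil l k = 0 /\ bil l (mxbar k) = 0, l^T *m A = 0, l^T *m A1 = 0
       & symm -> j l = l])].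
Proof.
have [x0 Ax0] : exists x, A *m x != 0.
  apply: contrapT => h; move/eqP: A0; apply; apply: col_ext => x.
  rewrite mul0mx; apply/eqP; apply: contrapT => /negP Ax; apply: h; by exists x.
have [k [k0 [z kz] jk]] : exists k,
    [/\ k != 0, exists z, k = A *m z & symm -> j k = k].
  apply: (@conj_s_fixed symm _ (A *m x0)) => //; last by exists x0.
  - by move=> a x [y ->]; exists (a *: y); rewrite scalemxAr.
  - by move=> x y [x' ->] [y' ->]; exists (x' + y'); rewrite mulmxDr.
  - by move=> J x [y ->]; exists (eps *: j y); rewrite jAx.
have kk : bil k k = 0 by rewrite kz isoE.
have kAx x : bil k (A *m x) = 0 by rewrite kz isoE.
have kA : k^T *m A = 0.
  apply: col_ext => x; rewrite -mulmxA bilE_mx kAx mul0mx.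
  by apply/matrixP => a b; rewrite !ord1 !mxE.
exists k; split=> //.
have N0 := norm_neq0 k0; set N := bil k (mxbar k) in N0.
have k'k : bil (mxbar k) k = N by rewrite bilC.
have k'k' : bil (mxbar k) (mxbar k) = 0 by rewrite bil_bar kk rmorph0.
have jN : symm -> j (mxbar k) = mxbar k.
  by move=> J; rewrite -mxbar_conj_s jk.
pose mu x := N^-1 * bil (mxbar k) (A *m x).
pose md x := A *m x - mu x *: k.
have mdA x : md x = A *m (x - mu x *: z).
  by rewrite mulmxBr -scalemxAr -kz.
have mdk x : bil (md x) (mxbar k) = 0.
  rewrite /md /mu bilC bilDr bilNr bilZr k'k mulrAC mulVf // mul1r subrr //.
have resE x : residue k *m x = md x + (tau0 / N * bil k (A1 *m x)) *: mxbar k.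
  by rewrite residueE.
have kA1z : bil k (A1 *m z) = 0.
  by apply: half; rewrite {1}kz skewE -kz bilC.
have resD x : md x = 0 -> residue k *m x = 0.
  move=> m0; rewrite resE m0 add0r.
  have: bil k (A1 *m (x - mu x *: z)) = 0.
    by rewrite {1}kz skewE -mdA m0 bilx0 oppr0.
  by rewrite mulmxBr bilDr bilNr -scalemxAr bilZr kA1z mulr0 subr0 => ->;
     rewrite mulr0 scale0r.
have [R0|Rn0] := eqVneq (residue k) 0; last first.
  left.
  have [x1 Rx1] : exists x, residue k *m x != 0.
    apply: contrapT => h; move/eqP: Rn0; apply; apply: col_ext => x.
    rewrite mul0mx; apply/eqP; apply: contrapT => /negP Rx; apply: h; by exists x.
  have jR : symm -> forall x, j (residue k *m x) = residue k *m (eps *: j x).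
    move=> J x; rewrite !residueE !(conj_sD, conj_sZ) -scaleNr conj_sZ jk // jN //.
    rewrite -/N jAx // -!scalemxAr.
    have NR : N^* = N by apply: norm_real.
    have E1 : (bil k (A1 *m x))^* = - eps * bil k (A1 *m j x).
      by rewrite -bil_conj_s jk // jA1x // -scalemxAr bilZr.
    have E2 : (bil (mxbar k) (A *m x))^* = eps * bil (mxbar k) (A *m j x).
      by rewrite -bil_conj_s jN // jAx // -scalemxAr bilZr.
    rewrite !(rmorphM, rmorphN, fmorphV) /= NR E1 E2 tau_imag !(bilZr).
    by apply: coP => i _; rewrite !(coD, coN, coZ); ring.
  have [l [l0 [x2 lx] jl]] : exists l,
      [/\ l != 0, exists x, l = residue k *m x & symm -> j l = l].
    apply: (@conj_s_fixed symm _ (residue k *m x1)) => //; last by exists x1.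
    - by move=> a x [y ->]; exists (a *: y); rewrite scalemxAr.
    - by move=> x y [x' ->] [y' ->]; exists (x' + y'); rewrite mulmxDr.
    - by move=> J x [y ->]; exists (eps *: j y); rewrite jR.
  have m0 : md x2 != 0.
    by apply: contra l0 => /eqP h; rewrite lx resD.
  set m := md x2 in m0.
  have mm : bil m m = 0 by rewrite /m mdA isoE.
  have km : bil k m = 0 by rewrite /m mdA kAx.
  have kxm : cprod k m = 0 by rewrite /m mdA kz null.
  have [u Ru] : exists u, residue k = l *m u^T.
    apply: rank_one_of_image => // x.
    pose r := bil (md x) (mxbar m) / bil m (mxbar m).
    exists r; apply/eqP; rewrite -subr_eq0 lx scalemxAr -mulmxBr; apply/eqP/resD.
    have mdL : md (x - r *: x2) = md x - r *: m.
      rewrite /m /md /mu mulmxBr -scalemxAr !(bilDr, bilNr, bilZr).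
      by apply: coP => i _; rewrite !(coD, coN, coZ); ring.
    rewrite mdL; apply/eqP; apply: contrapT => /negP d0.
    have dA : md x - r *: m = A *m (x - mu x *: z - r *: (x2 - mu x2 *: z)).
      by rewrite /m !mdA [RHS]mulmxBr -scalemxAr.
    have dm : bil (md x - r *: m) (mxbar m) = 0.
      by rewrite bilDl bilNl bilZl /r divfK ?norm_neq0 // subrr.
    have dk : bil (md x - r *: m) (mxbar k) = 0.
      by rewrite bilDl bilNl bilZl !mdk mulr0 subrr.
    set d := md x - r *: m in d0 dA dm dk.
    apply: (@coassociative_dim2 C k m d) => //; rewrite ?dA ?kAx ?isoE //.
    + by rewrite /m mdA isoE.
    + by rewrite bilC bil_barl mdk rmorph0.
    + by rewrite -dA bilC bil_barl dk rmorph0.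
    + by rewrite -dA bilC bil_barl dm rmorph0.
    + by rewrite kz null.
    + by rewrite /m mdA null.
  exists l, u; split=> //.
    by apply: contra Rn0 => /eqP u0; rewrite Ru u0 trmx0 mulmx0.
  rewrite lx resE; exact: adm_swap.
right; split=> //.
pose u := N^-1 *: (A^T *m mxbar k).
have uz : bil u z = 1.
  by rewrite /u bilZl bil_mull trmxK bilC -kz bilC k'k mulVf.
have Au x : A *m x = bil u x *: k.
  have := resE x; rewrite R0 mul0mx => h.
  have c0 : tau0 / N * bil k (A1 *m x) = 0.
    have : bil k (md x + (tau0 / N * bil k (A1 *m x)) *: mxbar k) = 0.
      by rewrite -h bilx0.
    rewrite bilDr mdA kAx add0r bilZr -/N => /eqP; rewrite mulf_eq0 (negPf N0) orbF.
    by move/eqP.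
  move/esym/eqP: h; rewrite c0 scale0r addr0 subr_eq0 => /eqP ->.
  by rewrite /u /mu bilZl bil_mull trmxK bilC.
have kA1 x : bil k (A1 *m x) = 0.
  rewrite kz skewE Au bilZr.
  by rewrite (bilC (A1 *m z)) kA1z mulr0 oppr0.
have nn1 : ~~ simple_pole.
  apply/negP => N1.
  have u0 : u != 0.
    by apply: contra_eq_neq uz => ->; rewrite bil0x eq_sym oner_eq0.
  have uu : bil u u = 0.
    have : A *m u = 0.
      by rewrite /u -scalemxAr mulmxA iso' mul0mx scaler0.
    by rewrite Au => /eqP; rewrite scaler_eq0 (negPf k0) orbF => /eqP.
  have [x [y [ux uy /negP]]] := null_three_form u0 uu; apply.
  have := cross1 x y; rewrite N1 !Au ux uy !scale0r cprod0x cprodx0 addr0.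
  by move/esym/eqP; rewrite scaler_eq0 (negPf k0) orbF.
split=> //.
have cr0 x y : cprod (A *m x) (A1 *m y) + cprod (A1 *m x) (A *m y) = 0.
  by rewrite cross1 (negPf nn1).
have A1ann x : bil u x = 0 -> cprod k (A1 *m x) = 0.
  move=> ux; have := cr0 z x; rewrite -kz (Au x) ux scale0r cprodx0 addr0.
  by [].
have [w1 [w10 kw1 w1k w1z]] := Ann_meets_perp (mxbar k) (A1 *m z) kk.
have [l [l0 [kl lk' lA1] jl]] : exists l, [/\ l != 0,
   [/\ cprod k l = 0, bil l (mxbar k) = 0 & forall x, bil l (A1 *m x) = 0] &
   symm -> j l = l].
  apply: (@conj_s_fixed symm _ w1) => //.
  - move=> a x [h1 h2 h3]; split; rewrite ?cprodZr ?bilZl ?h1 ?h2 ?scaler0 ?mulr0 //.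
    by move=> y; rewrite bilZl h3 mulr0.
  - move=> x y [h1 h2 h3] [h1' h2' h3']; split.
    + by rewrite cprodDr h1 h1' addr0.
    + by rewrite bilDl h2 h2' addr0.
    + by move=> v; rewrite bilDl h3 h3' addr0.
  - move=> J x [h1 h2 h3]; split.
    + rewrite -{1}(jk J) cprod_conj_s h1 /j (_ : mxbar 0 = 0) ?mulmx0 //.
      by apply/eqP; rewrite mxbar_eq0.
    + by rewrite -(jN J) bil_conj_s h2 rmorph0.
    + move=> y; rewrite -[y]conj_sK.
      have e0 : - eps != 0 by rewrite oppr_eq0.
      have -> : j (j y) = (- eps)^-1 *: (- eps *: j (j y)).
        by rewrite scalerA mulVf // scale1r.
      by rewrite -scalemxAr -jA1x // bilZr bil_conj_s h3 rmorph0 mulr0.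
  - split=> // x.
    have -> : x = (x - bil u x *: z) + bil u x *: z by rewrite subrK.
    rewrite mulmxDr bilDr -scalemxAr bilZr w1z mulr0 addr0.
    apply: (Ann_isotropic two k0 kk kw1); apply: A1ann.
    by rewrite bilDr bilNr bilZr uz mulr1 subrr.
have bkl : bil k l = 0 by apply: (Ann_orth k0).
exists l; split=> //.
- rewrite -[l]addr0 -(scale0r (mxbar k)); apply: adm_swap => //.
  exact: (Ann_isotropic two k0 kk).
- by split=> //; rewrite bilC.
- apply: col_ext => x; rewrite -mulmxA bilE_mx Au bilZr (bilC l) bkl mulr0 mul0mx.
  by apply/matrixP => a b; rewrite !ord1 !mxE.
- apply: col_ext => x; rewrite -mulmxA bilE_mx lA1 mul0mx.
  by apply/matrixP => a b; rewrite !ord1 !mxE.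
Qed.
End Reduce.
End LeadingTerms.

(** * Morphisms of fraction fields *)
Section FractionMorphism.
Variable D : idomainType.
Local Notation tofrac := (@FracField.tofrac D).

Lemma fraction_numden (f : {fraction D}) :
  exists p q, q != 0 /\ f = tofrac p / tofrac q.
Proof.
elim/quotW: f => x; exists \n_x, \d_x; split; first exact: denom_ratioP.
have d0 : tofrac \d_x != 0 by rewrite tofrac_eq0 denom_ratioP.
apply: (mulIf d0); rewrite divfK //.
rewrite -[LHS]/(FracField.mul _ _) !piE.
apply/eqmodP; rewrite /= FracField.equivfE /FracField.mulf.
by rewrite !numden_Ratio ?oner_eq0 ?mulr1 ?denom_ratioP // mulrC.
Qed.

Variable theta : {rmorphism D -> D}.
Hypothesis theta_inj : injective theta.

Let theta0 p : p != 0 -> tofrac (theta p) != 0.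
Proof. by move=> ?; rewrite tofrac_eq0 -(rmorph0 theta) (inj_eq theta_inj). Qed.

(** An arbitrary representation as a quotient is chosen; [frac_map_divE] shows that
the choice does not matter. *)
Definition frac_map_def (f : {fraction D}) : {fraction D} :=
  let pq := xget (0, 1) [set pq | pq.2 != 0 /\ f = tofrac pq.1 / tofrac pq.2]%classic in
  tofrac (theta pq.1) / tofrac (theta pq.2).

Lemma frac_map_divE p q : q != 0 ->
  frac_map_def (tofrac p / tofrac q) = tofrac (theta p) / tofrac (theta q).
Proof.
move=> q0; rewrite /frac_map_def.
case: xgetP => [[p' q'] _ /= [q'0 E]|/(_ (p, q))]; last by case.
apply/eqP; rewrite eqr_div ?theta0 // -!tofracM -!rmorphM tofrac_eq.
rewrite (inj_eq theta_inj) -tofrac_eq !tofracM -eqr_div ?tofrac_eq0 //.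
by rewrite E.
Qed.

End FractionMorphism.

HB.lock Definition frac_map (D : idomainType) (theta : {rmorphism D -> D})
  (theta_inj : injective theta) (f : {fraction D}) := frac_map_def theta f.

Section FractionMorphism2.
Variable D : idomainType.
Variable theta : {rmorphism D -> D}.
Hypothesis theta_inj : injective theta.
Local Notation tofrac := (@FracField.tofrac D).
Local Notation F := (frac_map theta_inj).

Lemma frac_mapE p q : q != 0 ->
  F (tofrac p / tofrac q) = tofrac (theta p) / tofrac (theta q).
Proof. by rewrite frac_map.unlock; apply: frac_map_divE. Qed.

Lemma frac_map_tofrac p : F (tofrac p) = tofrac (theta p).
Proof.
by have := @frac_mapE p 1 (oner_neq0 _); rewrite rmorph1 tofrac1 !divr1.
Qed.

Let theta0 p : p != 0 -> theta p != 0.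
Proof. by move=> ?; rewrite -(rmorph0 theta) (inj_eq theta_inj). Qed.

Lemma frac_map_zmod : zmod_morphism F.
Proof.
move=> f g; have [p [q [q0 ->]]] := fraction_numden f.
have [p' [q' [q'0 ->]]] := fraction_numden g.
rewrite -mulNr addf_div ?tofrac_eq0 // -tofracN -!tofracM -tofracD.
rewrite !frac_mapE ?mulf_neq0 // -mulNr addf_div ?tofrac_eq0 ?theta0 //.
by rewrite -tofracN -!tofracM -tofracD !rmorphD !rmorphM rmorphN.
Qed.

Lemma frac_map_monoid : monoid_morphism F.
Proof.
split=> [|f g]; first by rewrite -tofrac1 frac_map_tofrac rmorph1.
have [p [q [q0 ->]]] := fraction_numden f.
have [p' [q' [q'0 ->]]] := fraction_numden g.
rewrite mulf_div -!tofracM !frac_mapE ?mulf_neq0 // mulf_div.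
by rewrite -!tofracM !rmorphM.
Qed.

HB.instance Definition _ := GRing.isZmodMorphism.Build _ _ F frac_map_zmod.
HB.instance Definition _ := GRing.isMonoidMorphism.Build _ _ F frac_map_monoid.
End FractionMorphism2.

(** * Values of rational functions *)
Section Values.
Variable R : realType.
Local Notation C := (R[i]%C).
Local Notation K := (ratfun R).
Implicit Types (f : K) (a c : C).

Lemma tofrac_neq0 (q : {poly C}) a : q.[a] != 0 -> tofrac q != 0 :> K.
Proof. by apply: contra; rewrite tofrac_eq0 => /eqP ->; rewrite horner0. Qed.

Lemma has_value_poly (p : {poly C}) a : has_value (tofrac p : K) a p.[a].
Proof.
by exists p, 1; rewrite hornerC oner_neq0 tofrac1 !divr1.
Qed.

Lemma has_value_cst c a : has_value (tofrac c%:P : K) a c.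
Proof. by have := has_value_poly c%:P a; rewrite hornerC. Qed.

Lemma has_valueD f g a c d :
  has_value f a c -> has_value g a d -> has_value (f + g) a (c + d).
Proof.
move=> [p [q [q0 -> ->]]] [p' [q' [q'0 -> ->]]].
exists (p * q' + p' * q), (q * q'); split.
- by rewrite hornerM mulf_neq0.
- rewrite (addf_div _ _ (tofrac_neq0 q0) (tofrac_neq0 q'0)).
  by rewrite tofracD !tofracM.
- by rewrite addf_div // hornerD !hornerM.
Qed.

Lemma has_valueM f g a c d :
  has_value f a c -> has_value g a d -> has_value (f * g) a (c * d).
Proof.
move=> [p [q [q0 -> ->]]] [p' [q' [q'0 -> ->]]].
exists (p * p'), (q * q'); split.
- by rewrite hornerM mulf_neq0.
- by rewrite mulf_div !tofracM.
- by rewrite mulf_div !hornerM.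
Qed.

Lemma has_valueN f a c : has_value f a c -> has_value (- f) a (- c).
Proof.
move=> h; have := has_valueM (has_value_cst (-1) a) h.
by rewrite mulN1r polyCN tofracN tofrac1 mulN1r.
Qed.

Lemma has_valueB f g a c d :
  has_value f a c -> has_value g a d -> has_value (f - g) a (c - d).
Proof. by move=> h h'; apply: has_valueD h (has_valueN h'). Qed.

Lemma has_valueV f a c : c != 0 -> has_value f a c -> has_value f^-1 a c^-1.
Proof.
move=> c0 [p [q [q0 -> cE]]]; exists q, p; rewrite cE !invf_div; split=> //.
by apply: contra c0 => /eqP p0; rewrite cE p0 mul0r.
Qed.

Lemma has_valueX f a c n : has_value f a c -> has_value (f ^+ n) a (c ^+ n).
Proof.
move=> h; elim: n => [|n IH]; last by rewrite !exprS; apply: has_valueM.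
by rewrite !expr0; have := has_value_cst 1 a; rewrite tofrac1.
Qed.

Lemma has_value_sum I (r : seq I) (f : I -> K) (c : I -> C) a :
  (forall i, has_value (f i) a (c i)) ->
  has_value (\sum_(i <- r) f i) a (\sum_(i <- r) c i).
Proof.
move=> h; elim: r => [|i r IH]; last by rewrite !big_cons; apply: has_valueD.
by rewrite !big_nil; have := has_value_cst 0 a; rewrite tofrac0.
Qed.

Definition lin a : K := tofrac ('X - a%:P).

Lemma lin_neq0 a : lin a != 0.
Proof. by rewrite tofrac_eq0 polyXsubC_eq0. Qed.

Lemma has_value_lin a b : has_value (lin a) b (b - a).
Proof. by have := has_value_poly ('X - a%:P) b; rewrite !hornerE. Qed.

Lemma has_value_div_lin f a : has_value f a 0 -> exists d, has_value (f / lin a) a d.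
Proof.
move=> [p [q [q0 -> /esym/eqP]]].
rewrite mulf_eq0 invr_eq0 (negPf q0) orbF => /factor_theorem[p' ->].
exists (p'.[a] / q.[a]); exists p', q; split=> //.
by rewrite tofracM -/(lin a) mulrAC (mulfK (lin_neq0 a)).
Qed.

Lemma poly_values_inj (p q d : {poly C}) : d != 0 ->
  (forall z, d.[z] != 0 -> p.[z] = q.[z]) -> p = q.
Proof.
move=> d0 h; apply/eqP; rewrite -subr_eq0; apply: contraT => pq0.
have dpq : d * (p - q) != 0 by rewrite mulf_neq0.
have := max_poly_roots dpq (rs := [seq n%:R | n <- iota 0 (size (d * (p - q)))]).
rewrite size_map size_iota ltnn; apply.
  apply/allP => z _; rewrite /root hornerM mulf_eq0.
  have [//|dz] := eqVneq d.[z] 0.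
  by rewrite hornerD hornerN h // subrr eqxx orbT.
by rewrite map_inj_uniq ?iota_uniq // => i j /eqP; rewrite eqr_nat => /eqP.
Qed.

(** After cross-multiplication, two polynomials with the same values outside a
finite set are equal. *)
Lemma has_value_dense f g (d : {poly C}) : d != 0 ->
  (forall z, d.[z] != 0 -> exists2 c, has_value f z c & has_value g z c) -> f = g.
Proof.
move=> d0 h; have [p [q [q0 fE]]] := fraction_numden f.
have [p' [q' [q'0 gE]]] := fraction_numden g.
have [qK q'K] : tofrac q != 0 :> K /\ tofrac q' != 0 :> K by rewrite !tofrac_eq0.
rewrite fE gE; apply/eqP; rewrite (eqr_div _ _ qK q'K) -!tofracM tofrac_eq.
apply/eqP; apply: (@poly_values_inj _ _ (d * (q * q'))).
  by rewrite !mulf_neq0.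
move=> z; rewrite !hornerM !mulf_eq0 !negb_or => /and3P[dz qz q'z].
have [c hf hg] := h z dz.
have /has_value_uniq/(_ hf) cE : has_value f z (p.[z] / q.[z]) by exists p, q.
have /has_value_uniq/(_ hg) cE' : has_value g z (p'.[z] / q'.[z]) by exists p', q'.
by apply/eqP; rewrite -eqr_div // cE cE'.
Qed.

(** A root of the denominator at which there is no pole is a root of the numerator
too, and the common factor can be cancelled. *)
Lemma entire_poly f : (forall a, exists c, has_value f a c) ->
  exists p, f = tofrac p.
Proof.
have [p [q [q0 ->]]] := fraction_numden f.
have [n] := ubnP (size q); elim: n p q q0 => // n IH p q q0 sq h.
have [/eqP s1|s1] := eqVneq (size q) 1%N.
  move/size_poly1P: s1 => [c c0 ->]; exists (p * c^-1%:P).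
  rewrite tofracM; congr (_ * _).
  apply: (mulIf (_ : tofrac c%:P != 0 :> K)); first by rewrite tofrac_eq0 polyC_eq0.
  rewrite mulVf; last by rewrite tofrac_eq0 polyC_eq0.
  by rewrite -tofracM -polyCM mulVf // tofrac1.
have [a ra] := closed_rootP q s1.
have [c [p' [q' [q'a E _]]]] := h a.
have qK : tofrac q != 0 :> K by rewrite tofrac_eq0.
have /eqP := E; rewrite (eqr_div _ _ qK (tofrac_neq0 q'a)) -!tofracM tofrac_eq => /eqP.
move/(congr1 (fun r => r.[a])); rewrite !hornerM (eqP ra) mulr0.
move/eqP; rewrite mulf_eq0 (negPf q'a) orbF => /factor_theorem[p1 pE].
move/factor_theorem: ra => [q1 qE].
have q10 : q1 != 0 by apply: contra q0 => /eqP q1E; rewrite qE q1E mul0r.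
have E1 : tofrac p / tofrac q = tofrac p1 / tofrac q1 :> K.
  by rewrite pE qE !tofracM -mulf_div (mulfV (lin_neq0 a)) mulr1.
rewrite E1; apply: IH => //; last by rewrite -E1.
rewrite -ltnS; apply: leq_trans sq; rewrite qE size_Mmonic ?monicXsubC //.
by rewrite size_XsubC addn2.
Qed.

(** Rational functions that vanish at infinity. *)
Definition vanishing f := exists p q : {poly C},
  [/\ q != 0, (size p < size q)%N & f = tofrac p / tofrac q].

Lemma has_value_inftyP f c : has_value_infty f c <-> vanishing (f - tofrac c%:P).
Proof.
split=> [[p [q [q0 spq -> ->]]]|[p [q [q0 spq fE]]]].
  set c' := p`__ / _; exists (p - c'%:P * q), q; split; [exact: q0 | | ].
    have le : (size (p - c'%:P * q)%R <= size q)%N.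
      apply: leq_trans (size_polyD _ _) _; rewrite size_polyN geq_max spq.
      by rewrite mul_polyC size_scale_leq.
    rewrite ltn_neqAle le andbT; apply/eqP => sE.
    have : lead_coef (p - c'%:P * q) = 0.
      rewrite lead_coefE sE coefB coefCM -lead_coefE /c' divfK ?subrr //.
      by rewrite lead_coef_eq0.
    by move/eqP; rewrite lead_coef_eq0 -size_poly_eq0 sE size_poly_eq0 (negPf q0).
  by rewrite tofracB tofracM mulrBl mulfK // tofrac_eq0.
exists (p + c%:P * q), q; split; [exact: q0 | | | ].
- apply: leq_trans (size_polyD _ _) _; rewrite geq_max ltnW //.
  by rewrite mul_polyC size_scale_leq.
- have qK : tofrac q != 0 :> K by rewrite tofrac_eq0.
  by rewrite tofracD tofracM mulrDl -fE (mulfK qK) subrK.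
- rewrite coefD coefCM -lead_coefE nth_default ?add0r ?mulfK ?lead_coef_eq0 //.
  by move: spq; case: (size q).
Qed.

Lemma vanishing0 : vanishing 0.
Proof.
by exists 0, 1; rewrite oner_neq0 size_poly0 size_poly1 [tofrac 0]tofrac0 mul0r.
Qed.

Lemma vanishingD f g : vanishing f -> vanishing g -> vanishing (f + g).
Proof.
move=> [p [q [q0 s ->]]] [p' [q' [q'0 s' ->]]].
exists (p * q' + p' * q), (q * q'); split; first by rewrite mulf_neq0.
  have sq : (0 < size q)%N by rewrite size_poly_gt0.
  have sq' : (0 < size q')%N by rewrite size_poly_gt0.
  rewrite size_mul //; apply: leq_ltn_trans (size_polyD _ _) _; rewrite gtn_max.
  have aux (u v : {poly C}) n : (size u < n)%N -> (0 < size v)%N ->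
    (size (u * v)%R < (n + size v).-1)%N.
    move=> su sv; apply: leq_ltn_trans (size_polyMleq _ _) _.
    move: su sv; case: (size v) => // m su _; case: n su => // n su.
    rewrite !addnS /= -addSn addSn ltn_add2r //.
  by rewrite aux // addnC aux.
have [qK q'K] : tofrac q != 0 :> K /\ tofrac q' != 0 :> K by rewrite !tofrac_eq0.
by rewrite (addf_div _ _ qK q'K) tofracD !tofracM.
Qed.

Lemma vanishingZ c f : vanishing f -> vanishing (tofrac c%:P * f).
Proof.
move=> [p [q [q0 s ->]]]; exists (c%:P * p), q; split=> //.
  by apply: leq_ltn_trans s; rewrite mul_polyC size_scale_leq.
by rewrite tofracM mulrA.
Qed.

Lemma vanishingM f g : vanishing f -> vanishing g -> vanishing (f * g).
Proof.
move=> [p [q [q0 s ->]]] [p' [q' [q'0 s' ->]]].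
exists (p * p'), (q * q'); split; first by rewrite mulf_neq0.
  rewrite (size_mul q0 q'0); apply: leq_ltn_trans (size_polyMleq _ _) _.
  move: s s'; case: (size q) (size q') => // n [] // m s s'.
  by rewrite addnS /= addSn /= ltnS; apply: leq_trans (leq_pred _) _; apply: leq_add.
by rewrite mulf_div !tofracM.
Qed.

Lemma vanishing_sum I (r : seq I) (f : I -> K) :
  (forall i, vanishing (f i)) -> vanishing (\sum_(i <- r) f i).
Proof.
by move=> h; elim/big_ind: _ => //; [apply: vanishing0 | apply: vanishingD].
Qed.

Lemma vanishing_entire f : vanishing f -> (forall a, exists c, has_value f a c) -> f = 0.
Proof.
move=> [p [q [q0 s fE]]] /entire_poly[r rE]; rewrite rE.
have : r * q = p.
  by apply/eqP; rewrite -tofrac_eq tofracM -rE fE divfK // tofrac_eq0.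
move=> pE; have [->|r0] := eqVneq r 0; first exact: tofrac0.
move: s; rewrite -pE size_mul // -ltnS prednK ?addn_gt0 ?size_poly_gt0 ?r0 //.
rewrite ltnS -{2}(add0n (size q)) leq_add2r leqn0 size_poly_eq0 (negPf r0) //.
Qed.

End Values.

(** * Twisted loops as matrices of rational functions *)
Section Loops.
Variable R : realType.
Local Notation C := (R[i]%C).
Local Notation K := (ratfun R).

(** An automorphism fixes the unit; the real and imaginary parts of the product of
two imaginary octonions then give the two conditions of [is_G2]. *)
Lemma in_G2P (A : 'M[C]_7) : in_G2 A <-> is_G2 A.
Proof.
have omul1 (u : octC R) : omul u (1, 0) = u.
  case: u => [c x]; rewrite /omul /= -[dot _ _]/(bil _ _) -[cross _ _]/(cprod _ _).
  by rewrite bilx0 cprodx0 mulr1 subr0 scaler0 scale1r add0r addr0.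
have mulo1 (u : octC R) : omul (1, 0) u = u.
  case: u => [c x]; rewrite /omul /= -[dot _ _]/(bil _ _) -[cross _ _]/(cprod _ _).
  by rewrite bil0x cprod0x mul1r subr0 scaler0 scale1r !addr0.
split=> [[phi [lin_phi [psi phiK psiK] mor_phi] phiA]|[oA pA]].
  have phi1 : phi (1, 0) = (1, 0).
    by have := mor_phi (1, 0) (psi (1, 0)); rewrite mulo1 psiK omul1.
  have key x y : bil (A *m x) (A *m y) = bil x y /\
                 cprod (A *m x) (A *m y) = A *m cprod x y.
    have := mor_phi (0, x) (0, y); rewrite !phiA /omul /=.
    rewrite !mul0r !scale0r !add0r.
    have -> : (- dot x y, cross x y) = - dot x y *: (1, 0) + (0, cross x y) :> octC R.
      by congr pair; rewrite /= ?scaler0 ?addr0 ?add0r // [_ *: _]mulr1.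
    rewrite lin_phi phi1 phiA => -[]; rewrite scaler0 addr0 add0r [_ *: _]mulr1.
    by move/oppr_inj=> h1 h2; split; [exact/esym | exact/esym].
  split=> [|x y]; last by case: (key x y).
  apply: col_ext => x; rewrite mul1mx; apply/eqP; rewrite -subr_eq0; apply/eqP.
  apply: bil_nondeg => y; rewrite bilDl bilNl -mulmxA.
  by rewrite bil_mull trmxK (proj1 (key x y)) subrr.
exists (fun u => (u.1, A *m u.2)) => //; split.
- move=> c u v; rewrite -[RHS]/(c * u.1 + v.1, c *: (A *m u.2) + A *m v.2).
  by rewrite scalemxAr -mulmxDr.
- exists (fun u => (u.1, A^T *m u.2)) => -[c x] /=; congr pair.
    by rewrite mulmxA oA mul1mx.
  by rewrite mulmxA (mulmx1C oA) mul1mx.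
- move=> [c x] [d y] /=; rewrite /omul /=.
  rewrite -[dot _ _]/(bil _ _) -[cross _ _]/(cprod _ _).
  rewrite -[dot (A *m _) _]/(bil _ _) -[cross (A *m _) _]/(cprod _ _).
  by rewrite pA bil_mull mulmxA oA mul1mx !mulmxDr -!scalemxAr.
Qed.

Lemma smxE (x : 'cV[C]_7) (i : 'I_7) :
  (smx R *m x) i 0 = if (i < 4)%N then - x i 0 else x i 0.
Proof.
by rewrite mul_diag_mx !mxE; case: ifP; rewrite ?mulN1r ?mul1r.
Qed.

Lemma smx_sq : smx R *m smx R = 1%:M.
Proof.
apply: col_ext => x; apply/matrixP => i j; rewrite ord1 -mulmxA mul1mx !smxE.
by case: (i < 4)%N; rewrite ?opprK.
Qed.

Lemma smx_tr : (smx R)^T = smx R. Proof. exact: tr_diag_mx. Qed.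

Lemma invmx_smx : invmx (smx R) = smx R.
Proof.
have /mulmx1_unit[u _] := smx_sq.
by rewrite -[LHS]mulmx1 -smx_sq mulKmx.
Qed.

Lemma smx_G2 : is_G2 (smx R).
Proof.
split=> [|x y]; first by rewrite smx_tr smx_sq.
have coS z : co (smx R *m z) = fun k => if (k < 4)%N then - co z k else co z k.
  apply: funext => k; rewrite {1}/co; case: ifP => k7; last first.
    by rewrite /co k7 oppr0 if_same.
  by rewrite smxE !co_ord inordK.
apply: coP => k hk; rewrite coS !coC !coS.
by move: k hk => [|[|[|[|[|[|[|//]]]]]]] _; rewrite /cp /minor /=; ring.
Qed.

Lemma mxbar_smx : mxbar (smx R) = smx R.
Proof.
rewrite /mxbar /smx map_diag_mx; congr diag_mx; apply/matrixP => i j.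
by rewrite !mxE; case: ifP => _; rewrite ?rmorphN rmorph1.
Qed.

(** On rational functions the symmetries of a twisted loop become the ring
morphisms [rbar] and [ropp], which send f to the functions with values
conj f(conj lambda) and f(- lambda). *)
Definition conj_poly : {poly C} -> {poly C} := map_poly Num.conj.
HB.instance Definition _ := GRing.RMorphism.on conj_poly.
Definition opp_poly : {poly C} -> {poly C} := comp_poly (- 'X).
HB.instance Definition _ := GRing.RMorphism.on opp_poly.

Lemma conj_poly_inj : injective conj_poly.
Proof. exact: (map_inj_poly (fmorph_inj Num.conj) (rmorph0 Num.conj)). Qed.

Lemma opp_polyK : involutive opp_poly.
Proof.
move=> p; rewrite /opp_poly -comp_polyA (_ : - 'X \Po - 'X = 'X) ?comp_polyXr //.
by rewrite raddfN /= comp_polyX opprK.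
Qed.

Lemma size_opp_poly p : size (opp_poly p) = size p.
Proof. by rewrite /opp_poly; apply: size_comp_poly2; rewrite size_polyN size_polyX. Qed.

Lemma opp_poly_inj : injective opp_poly.
Proof. exact: inv_inj opp_polyK. Qed.

Definition rbar : K -> K := frac_map conj_poly_inj.
HB.instance Definition _ := GRing.RMorphism.on rbar.
Definition ropp : K -> K := frac_map opp_poly_inj.
HB.instance Definition _ := GRing.RMorphism.on ropp.

Lemma roppK : involutive ropp.
Proof.
move=> f; have [p [q [q0 ->]]] := fraction_numden f.
have q0' : opp_poly q != 0 by rewrite (raddf_eq0 _ opp_poly_inj).
by rewrite /ropp (frac_mapE _ _ q0) (frac_mapE _ _ q0') /= !opp_polyK.
Qed.

Lemma vanishing_ropp (x : K) : vanishing x -> vanishing (ropp x).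
Proof.
move=> [p [q [q0 s ->]]]; exists (opp_poly p), (opp_poly q).
split; [by rewrite (raddf_eq0 _ opp_poly_inj) | by rewrite !size_opp_poly |].
exact: frac_mapE q0.
Qed.

Lemma has_value_rbar f (a c : C) :
  has_value f a c -> has_value (rbar f) a^* c^*.
Proof.
move=> [p [q [q0 -> ->]]].
have q0' : q != 0 by apply: contra q0 => /eqP ->; rewrite horner0.
exists (conj_poly p), (conj_poly q); rewrite /conj_poly !horner_map /= conjC_eq0.
split; [exact: q0 | exact: frac_mapE q0' | by rewrite rmorphM fmorphV].
Qed.

Lemma has_value_ropp f (a c : C) :
  has_value f a c -> has_value (ropp f) (- a) c.
Proof.
move=> [p [q [q0 -> ->]]].
have q0' : q != 0 by apply: contra q0 => /eqP ->; rewrite horner0.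
exists (opp_poly p), (opp_poly q); rewrite /opp_poly !horner_comp !hornerE opprK.
split; [exact: q0 | exact: frac_mapE q0' | by []].
Qed.

Definition cst : C -> K := fun c => tofrac c%:P.
HB.instance Definition _ := GRing.RMorphism.copy cst (@FracField.tofrac _ \o polyC).

Lemma conj_polyC c : conj_poly c%:P = (c^*)%:P.
Proof. exact: map_polyC. Qed.
Lemma opp_polyC c : opp_poly c%:P = c%:P.
Proof. exact: comp_polyC. Qed.
Lemma conj_polyX : conj_poly 'X = 'X.
Proof. exact: map_polyX. Qed.
Lemma opp_polyX : opp_poly 'X = - 'X.
Proof. exact: comp_polyX. Qed.

Lemma rbar_cst c : rbar (cst c) = cst c^*.
Proof. by rewrite /rbar /cst frac_map_tofrac /= conj_polyC. Qed.
Lemma ropp_cst c : ropp (cst c) = cst c.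
Proof. by rewrite /ropp /cst frac_map_tofrac /= opp_polyC. Qed.
Lemma rbar_lin a : rbar (lin a) = lin a^*.
Proof. by rewrite /rbar /lin frac_map_tofrac /= rmorphB /= conj_polyX conj_polyC. Qed.
Lemma ropp_lin a : ropp (lin a) = - lin (- a).
Proof.
rewrite /ropp /lin frac_map_tofrac /= rmorphB /= opp_polyX opp_polyC.
by rewrite -tofracN polyCN opprK opprD.
Qed.

Definition cstm m n (A : 'M[C]_(m, n)) : 'M[K]_(m, n) := map_mx cst A.

Lemma bil_cstm x y : bil (cstm x) (cstm y) = cst (bil x y).
Proof.
by rewrite /bil rmorph_sum; apply: eq_bigr => i _; rewrite !mxE rmorphM.
Qed.

Lemma cprod_cstm x y : cprod (cstm x) (cstm y) = cstm (cprod x y).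
Proof.
apply/matrixP => i j; rewrite !mxE rmorph_sum; apply: eq_bigr => a _.
rewrite rmorph_sum; apply: eq_bigr => b _; rewrite !mxE !rmorphM.
congr (_ * _ * _); rewrite /struct_coef; case: ifP => _; first by rewrite rmorph1.
by case: ifP => _; rewrite ?rmorphN ?rmorph1 ?rmorph0.
Qed.

Definition mval m n (M : 'M[K]_(m, n)) (a : C) (A : 'M[C]_(m, n)) : Prop :=
  forall i j, has_value (M i j) a (A i j).

Lemma mval_uniq m n (M : 'M[K]_(m, n)) a A B : mval M a A -> mval M a B -> A = B.
Proof. by move=> h h'; apply/matrixP => i j; apply: has_value_uniq (h i j) (h' i j). Qed.

Lemma mval_cstm m n (A : 'M[C]_(m, n)) a : mval (cstm A) a A.
Proof. by move=> i j; rewrite mxE; apply: has_value_cst. Qed.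

Lemma mvalD m n (M N : 'M[K]_(m, n)) a A B :
  mval M a A -> mval N a B -> mval (M + N) a (A + B).
Proof. by move=> h h' i j; rewrite !mxE; apply: has_valueD. Qed.

Lemma mvalN m n (M : 'M[K]_(m, n)) a A : mval M a A -> mval (- M) a (- A).
Proof. by move=> h i j; rewrite !mxE; apply: has_valueN. Qed.

Lemma mvalB m n (M N : 'M[K]_(m, n)) a A B :
  mval M a A -> mval N a B -> mval (M - N) a (A - B).
Proof. by move=> h h'; apply: mvalD h (mvalN h'). Qed.

Lemma mvalZ m n f (M : 'M[K]_(m, n)) a c A :
  has_value f a c -> mval M a A -> mval (f *: M) a (c *: A).
Proof. by move=> h h' i j; rewrite !mxE; apply: has_valueM. Qed.

Lemma mvalM m n p (M : 'M[K]_(m, n)) (N : 'M[K]_(n, p)) a A B :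
  mval M a A -> mval N a B -> mval (M *m N) a (A *m B).
Proof.
by move=> h h' i j; rewrite !mxE; apply: has_value_sum => k; apply: has_valueM.
Qed.

Lemma mval_tr m n (M : 'M[K]_(m, n)) a A : mval M a A -> mval M^T a A^T.
Proof. by move=> h i j; rewrite !mxE. Qed.

Lemma mval_cprod x y a u v :
  mval x a u -> mval y a v -> mval (cprod x y) a (cprod u v).
Proof.
move=> h h' i j; rewrite !mxE; apply: has_value_sum => b; apply: has_value_sum => c.
do 2!apply: has_valueM => //; rewrite /struct_coef; case: ifP => _.
  by rewrite -(rmorph1 cst); apply: has_value_cst.
case: ifP => _.
  by rewrite -(rmorph1 cst) -rmorphN; apply: has_value_cst.
by rewrite -(rmorph0 cst); apply: has_value_cst.
Qed.

Lemma mval_rbar m n (M : 'M[K]_(m, n)) a A :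
  mval M a A -> mval (map_mx rbar M) a^* (mxbar A).
Proof. by move=> h i j; rewrite !mxE; apply: has_value_rbar. Qed.

Lemma mval_ropp m n (M : 'M[K]_(m, n)) a A :
  mval M a A -> mval (map_mx ropp M) (- a) A.
Proof. by move=> h i j; rewrite !mxE; apply: has_value_ropp. Qed.

Definition hol m n (M : 'M[K]_(m, n)) a := exists A, mval M a A.

Lemma hol_entries m n (M : 'M[K]_(m, n)) a :
  (forall i j, exists c, has_value (M i j) a c) -> hol M a.
Proof.
move=> h; exists (\matrix_(i, j) fval (M i j) a) => i j; rewrite mxE.
by have [c hc] := h i j; rewrite (fvalE hc).
Qed.

Lemma mval_eval (g : loop R) a : holo_at g a -> mval g a (eval g a).
Proof.
move=> h i j; rewrite mxE; have [c hc] := h i j; by rewrite (fvalE hc).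
Qed.

Lemma eval_mval (g : loop R) a A : mval g a A -> holo_at g a /\ eval g a = A.
Proof.
move=> h; split; first by move=> i j; exists (A i j).
by apply/matrixP => i j; rewrite mxE (fvalE (h i j)).
Qed.

(** A common denominator of the entries bounds the poles. *)
Lemma generic_hol m n (M : 'M[K]_(m, n)) :
  exists2 d : {poly C}, d != 0 & forall z, d.[z] != 0 -> hol M z.
Proof.
pose den (f : K) : {poly C} :=
  xget 1 [set q | q != 0 /\ exists p, f = tofrac p / tofrac q]%classic.
have denP f : den f != 0 /\ exists p, f = tofrac p / tofrac (den f).
  rewrite /den; case: xgetP => [q _ [q0 h]|h]; first by split.
  have [p [q [q0 E]]] := fraction_numden f.
  by case: (h q); split=> //; exists p.
exists (\prod_i \prod_j den (M i j)).
  by apply/prodf_neq0 => i _; apply/prodf_neq0 => j _; case: (denP (M i j)).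
move=> z hz; apply: hol_entries => i j.
have [_ [p E]] := denP (M i j); exists (p.[z] / (den (M i j)).[z]).
exists p, (den (M i j)); split=> //; apply: contra hz => /eqP h.
by rewrite (bigD1 i) //= (bigD1 j) //= !hornerM h !mul0r.
Qed.

Lemma mval_dense m n (M N : 'M[K]_(m, n)) (d : {poly C}) : d != 0 ->
  (forall z, d.[z] != 0 -> exists2 A, mval M z A & mval N z A) -> M = N.
Proof.
move=> d0 h; apply/matrixP => i j; apply: (has_value_dense d0) => z dz.
by have [A hM hN] := h z dz; exists (A i j).
Qed.

Definition twist (g : loop R) : loop R :=
  cstm (smx R) *m map_mx ropp g *m cstm (smx R).

Record real_G2_loop (g : loop R) : Prop := RealG2Loop {
  rg_G2 : is_G2 g;
  rg_bar : map_mx rbar g = g;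
  rg_infty : forall i j, vanishing ((g - 1%:M) i j) }.

(** Pointwise conditions at all points of holomorphy are the same as identities
between matrices of rational functions, by [mval_dense]. *)
Lemma twisted_loopP g :
  twisted_loop_group g <-> real_G2_loop g /\ twist g = g.
Proof.
split.
  move=> [hG hinf hbar htw]; have [d d0 hd] := generic_hol g.
  have hol_at z : d.[z] != 0 -> mval g z (eval g z).
    by move=> /hd[A /eval_mval[h _]]; apply: mval_eval.
  have bd0 : conj_poly d != 0 by rewrite (raddf_eq0 _ conj_poly_inj).
  have od0 : opp_poly d != 0 by rewrite (raddf_eq0 _ opp_poly_inj).
  have bdz z : (conj_poly d).[z] != 0 -> d.[z^*] != 0.
    by rewrite -{1}[z]conjCK /conj_poly horner_map /= conjC_eq0.
  have odz z : (opp_poly d).[z] != 0 -> d.[- z] != 0.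
    by rewrite /opp_poly horner_comp !hornerE.
  split; last first.
    apply: (@mval_dense _ _ _ _ (d * opp_poly d)); first by rewrite mulf_neq0.
    move=> z; rewrite hornerM mulf_eq0 negb_or => /andP[dz /odz dz'].
    exists (eval g z); last exact: hol_at.
    have [h h'] := (proj1 (eval_mval (hol_at _ dz)), proj1 (eval_mval (hol_at _ dz'))).
    rewrite -(htw _ h' h) /sigma invmx_smx.
    apply: mvalM (mval_cstm _ _); apply: mvalM; first exact: mval_cstm.
    by have := mval_ropp (hol_at _ dz'); rewrite opprK.
  split.
  - have G2z z : d.[z] != 0 -> is_G2 (eval g z).
      by move=> dz; apply/in_G2P; apply: hG; case: (eval_mval (hol_at z dz)).
    split.
      apply: (mval_dense d0) => z dz; exists 1%:M.
        have := mvalM (mval_tr (hol_at z dz)) (hol_at z dz).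
        by rewrite (proj1 (G2z z dz)).
      have -> : 1%:M = cstm 1%:M :> loop R by rewrite /cstm map_mx1.
      exact: mval_cstm.
    move=> x y; have [dx dx0 hx] := generic_hol x; have [dy dy0 hy] := generic_hol y.
    apply: (@mval_dense _ _ _ _ (d * (dx * dy))); first by rewrite !mulf_neq0.
    move=> z; rewrite !hornerM !mulf_eq0 !negb_or => /and3P[dz /hx[u xu] /hy[v yv]].
    exists (cprod (eval g z *m u) (eval g z *m v)).
      by apply: mval_cprod; apply: mvalM => //; apply: hol_at.
    rewrite (proj2 (G2z z dz)); apply: mvalM; first exact: hol_at.
    exact: mval_cprod.
  - apply: (@mval_dense _ _ _ _ (d * conj_poly d)); first by rewrite mulf_neq0.
    move=> z; rewrite hornerM mulf_eq0 negb_or => /andP[dz /bdz dz'].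
    exists (eval g z); last exact: hol_at.
    have [h h'] := (proj1 (eval_mval (hol_at _ dz)), proj1 (eval_mval (hol_at _ dz'))).
    rewrite -(hbar _ h' h) -{1}[z]conjCK.
    exact: mval_rbar (hol_at _ dz').
  - move=> i j; have /has_value_inftyP := hinf i j.
    by rewrite !mxE -/(cst _) rmorph_nat.
move=> [[hG hbar hinf] htw]; split.
- move=> z /mval_eval hz; apply/in_G2P; split.
    apply: mval_uniq (mvalM (mval_tr hz) hz) _; rewrite (proj1 hG).
    have -> : 1%:M = cstm 1%:M :> loop R by rewrite /cstm map_mx1.
    exact: mval_cstm.
  move=> x y; apply: (@mval_uniq _ _ (cprod (g *m cstm x) (g *m cstm y)) z).
    by apply: mval_cprod; apply: mvalM => //; apply: mval_cstm.
  rewrite (proj2 hG) cprod_cstm; apply: mvalM => //; exact: mval_cstm.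
- move=> i j; apply/has_value_inftyP; have := hinf i j.
  by rewrite !mxE -/(cst _) rmorph_nat.
- move=> z /mval_eval h /mval_eval h'; rewrite /tau; apply: mval_uniq h'.
  by have := mval_rbar h; rewrite hbar conjCK.
- move=> z /mval_eval h /mval_eval h'; rewrite /sigma invmx_smx; apply: mval_uniq h'.
  rewrite -{1}htw; apply: mvalM (mval_cstm _ _); apply: mvalM; first exact: mval_cstm.
  by have := mval_ropp h; rewrite opprK.
Qed.

End Loops.

Lemma trmx_add (F : nmodType) m n (A B : 'M[F]_(m, n)) : (A + B)^T = A^T + B^T.
Proof. by apply/matrixP => i j; rewrite !mxE. Qed.

Lemma trmx_scale (F : nzRingType) m n c (A : 'M[F]_(m, n)) : (c *: A)^T = c *: A^T.
Proof. by apply/matrixP => i j; rewrite !mxE. Qed.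

Section Hyperbolic.
Variable F : fieldType.
Implicit Types (l k x : 'cV[F]_7) (z w : F).

Lemma hyperbolic1 l l' : hyperbolic 1 l l' = 1%:M.
Proof. by rewrite /hyperbolic invr1 subrr mul0r !scale0r !addr0. Qed.

Lemma hyperbolicM z w l l' : bil l l = 0 -> bil l' l' = 0 -> bil l l' != 0 ->
  hyperbolic z l l' *m hyperbolic w l l' = hyperbolic (z * w) l l'.
Proof.
move=> ll l'l' N0; apply: col_ext => x; rewrite -mulmxA !hyperbolicE.
rewrite !(bilDr, bilZr) ll l'l' (bilC l' l) !mulr0 !addr0.
apply: coP => i _; rewrite !(coD, coN, coZ) invfM.
by set N := bil l l' in N0 *; set u := z^-1; set v := w^-1; field.
Qed.

Lemma hyperbolic_tr z l l' : (hyperbolic z l l')^T = hyperbolic z^-1 l l'.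
Proof.
rewrite /hyperbolic !linearD /= trmx1 !linearZ /= !trmx_mul !trmxK invrK.
by rewrite addrAC.
Qed.

Lemma hyperbolic_swap z l l' : hyperbolic z^-1 l' l = hyperbolic z l l'.
Proof. by rewrite /hyperbolic invrK (bilC l') addrAC. Qed.

Lemma hyperbolicZ z c d l l' : c != 0 -> d != 0 ->
  hyperbolic z (c *: l) (d *: l') = hyperbolic z l l'.
Proof.
move=> c0 d0; apply: col_ext => x; rewrite !hyperbolicE !(bilZl, bilZr) !scalerA.
have [N0|N0] := eqVneq (bil l l') 0; first by rewrite N0 !mulr0 invr0 !mulr0 !mul0r.
congr (_ + _ *: _ + _ *: _).
  by field; rewrite c0 d0 N0.
by set u := z^-1; field; rewrite c0 d0 N0.
Qed.

Lemma hyperbolic_orth z l l' : z != 0 ->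
  bil l l = 0 -> bil l' l' = 0 -> bil l l' != 0 ->
  (hyperbolic z l l')^T *m hyperbolic z l l' = 1%:M.
Proof.
by move=> z0 ll l'l' N0; rewrite hyperbolic_tr hyperbolicM // mulVf // hyperbolic1.
Qed.

Lemma hyperbolic_conj (S : 'M[F]_7) z l l' : S^T *m S = 1%:M ->
  S *m hyperbolic z l l' *m S^T = hyperbolic z (S *m l) (S *m l').
Proof.
move=> SS; rewrite /hyperbolic !mulmxDr !mulmxDl mulmx1 (mulmx1C SS).
rewrite bil_mull mulmxA SS mul1mx -!scalemxAr -!scalemxAl.
by rewrite !trmx_mul !mulmxA.
Qed.
End Hyperbolic.

Arguments rbar {R} _.
Arguments ropp {R} _.
Arguments cst {R} _.

Lemma map_bil (F : fieldType) (phi : {rmorphism F -> F}) (x y : 'cV[F]_7) :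
  bil (map_mx phi x) (map_mx phi y) = phi (bil x y).
Proof.
by rewrite /bil rmorph_sum; apply: eq_bigr => i _; rewrite !mxE rmorphM.
Qed.

Lemma map_hyperbolic (F : fieldType) (phi : {rmorphism F -> F}) z (l l' : 'cV[F]_7) :
  map_mx phi (hyperbolic z l l') = hyperbolic (phi z) (map_mx phi l) (map_mx phi l').
Proof.
rewrite /hyperbolic !map_mxD map_mx1 !map_mxZ !map_mxM -!map_trmx.
by rewrite !rmorphM !rmorphB !fmorphV !rmorph1 !map_bil.
Qed.

(* Comparing two rational functions must not unfold the construction of the
   fraction field. *)
Local Opaque FracField.add FracField.mul FracField.opp FracField.inv tofrac.
Local Opaque bil cprod.

(** * Simple factors *)
Section SimpleFactors.
Variable R : realType.
Local Notation C := (R[i]%C).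
Local Notation K := (ratfun R).
Implicit Types (l k : 'cV[C]_7) (a b c : C) (f g h : loop R).

(** The loop p_{a,L} for the line L spanned by l. *)
Definition simple_factor a l : loop R :=
  hyperbolic (lin a / lin a^*) (cstm l) (cstm (mxbar l)).

Lemma sfE a l :
  simple_factor a l = hyperbolic (lin a / lin a^*) (cstm l) (cstm (mxbar l)).
Proof. by []. Qed.

Lemma moebius_neq0 a : lin a / lin a^* != 0 :> K.
Proof. by rewrite mulf_neq0 ?invr_eq0 ?lin_neq0. Qed.

Definition null l := l != 0 /\ bil l l = 0.

Lemma cst_eq0 c : (cst c == 0 :> K) = (c == 0).
Proof. exact: fmorph_eq0. Qed.

Lemma cstm_null l : null l ->
  [/\ bil (cstm l) (cstm l) = 0, bil (cstm (mxbar l)) (cstm (mxbar l)) = 0 &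
      bil (cstm l) (cstm (mxbar l)) != 0].
Proof.
move=> [l0 ll]; rewrite !bil_cstm bil_bar ll rmorph0 rmorph0; split=> //.
by rewrite cst_eq0 norm_neq0.
Qed.

Lemma sf_orth a l : null l -> (simple_factor a l)^T *m simple_factor a l = 1%:M.
Proof.
by move/cstm_null => [h1 h2 h3]; apply: (hyperbolic_orth (moebius_neq0 a) h1 h2 h3).
Qed.

Lemma rbar_cstm m n (A : 'M[C]_(m, n)) : map_mx rbar (cstm A) = cstm (mxbar A).
Proof. by apply/matrixP => i j; rewrite !mxE rbar_cst. Qed.

Lemma ropp_cstm m n (A : 'M[C]_(m, n)) : map_mx ropp (cstm A) = cstm A.
Proof. by apply/matrixP => i j; rewrite !mxE ropp_cst. Qed.

Lemma sf_bar a l : map_mx rbar (simple_factor a l) = simple_factor a l.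
Proof.
rewrite /simple_factor map_hyperbolic !rbar_cstm mxbarK rmorphM fmorphV /= !rbar_lin conjCK.
by rewrite -hyperbolic_swap invf_div.
Qed.

Lemma sf_twist a l : twist (simple_factor a l) = simple_factor (- a) (smx R *m l).
Proof.
have oS : (cstm (smx R))^T *m cstm (smx R) = 1%:M.
  by rewrite /cstm map_trmx -map_mxM (proj1 (smx_G2 R)) map_mx1.
have ST : (cstm (smx R))^T = cstm (smx R) by rewrite /cstm map_trmx smx_tr.
rewrite /twist -{2}ST /simple_factor map_hyperbolic (hyperbolic_conj _ _ _ oS) !ropp_cstm.
rewrite rmorphM fmorphV /= !ropp_lin invrN mulrNN /cstm -!map_mxM.
by rewrite mxbarM mxbar_smx rmorphN.
Qed.

Lemma sfZ a c l : c != 0 -> simple_factor a (c *: l) = simple_factor a l.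
Proof.
move=> c0; rewrite /simple_factor mxbarZ /cstm !map_mxZ.
by apply: hyperbolicZ; rewrite cst_eq0 ?conjC_eq0.
Qed.

Lemma sf_conj a l : simple_factor a^* (mxbar l) = simple_factor a l.
Proof. by rewrite /simple_factor conjCK mxbarK -hyperbolic_swap invf_div. Qed.

Lemma vanishing_moebius a b : vanishing (lin a / lin b - 1 : K).
Proof.
exists (b - a)%:P, ('X - b%:P); split; first by rewrite polyXsubC_eq0.
  by rewrite size_XsubC ltnS size_polyC leq_b1.
rewrite -(mulfV (lin_neq0 b)) -mulrBl -tofracB; congr (tofrac _ / _).
by rewrite polyCB; ring.
Qed.

Lemma sf_infty a l i j : vanishing ((simple_factor a l - 1%:M) i j).
Proof.
rewrite /simple_factor /hyperbolic addrAC (addrAC 1%:M) subrr add0r !bil_cstm invf_div.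
set N := bil _ _; rewrite !mxE !big_ord1 !mxE.
have E (u v w : C) (x : K) : vanishing x -> vanishing (x / cst u * (cst v * cst w)).
  move=> sx; rewrite (_ : _ * _ = cst (u^-1 * (v * w)) * x); first exact: vanishingZ.
  by rewrite !rmorphM fmorphV [RHS]mulrC [RHS]mulrA.
by apply: vanishingD; apply: E; apply: vanishing_moebius.
Qed.

Lemma mval_hyperbolic (z : K) b w l l' : w != 0 -> has_value z b w ->
  mval (hyperbolic z (cstm l) (cstm l')) b (hyperbolic w l l').
Proof.
move=> w0 zw; have one : has_value (1 : K) b 1.
  by rewrite -(rmorph1 cst); apply: has_value_cst.
rewrite /hyperbolic bil_cstm -!fmorphV !map_trmx -![cstm _ *m _]map_mxM.
apply: mvalD; first apply: mvalD.
- by rewrite -(map_mx1 cst); apply: mval_cstm.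
- apply: mvalZ (mval_cstm _ _); apply: has_valueM (has_value_cst _ _).
  exact: has_valueB.
- apply: mvalZ (mval_cstm _ _); apply: has_valueM (has_value_cst _ _).
  apply: has_valueB one; exact: has_valueV.
Qed.

Lemma sf_val a l b : b != a -> b != a^* ->
  mval (simple_factor a l) b (hyperbolic ((b - a) / (b - a^*)) l (mxbar l)).
Proof.
move=> ba ba'; apply: mval_hyperbolic.
  by rewrite mulf_eq0 invr_eq0 !subr_eq0 negb_or ba ba'.
apply: has_valueM (has_value_lin _ _) _; apply: has_valueV (has_value_lin _ _).
by rewrite subr_eq0.
Qed.

Lemma sf_hol a l b : b != a -> b != a^* -> hol (simple_factor a l) b.
Proof. by move=> h h'; eexists; apply: sf_val. Qed.

(** First-order Taylor expansion, with the remainder kept as a rational matrix. *)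
Lemma mval_expand m n (f : 'M[K]_(m, n)) a A : mval f a A ->
  exists (f1 : 'M[K]_(m, n)) (A1 : 'M[C]_(m, n)),
    f = cstm A + lin a *: f1 /\ mval f1 a A1.
Proof.
move=> fA; have [A1 h] : hol ((lin a)^-1 *: (f - cstm A)) a.
  apply: hol_entries => i j; rewrite mxE mulrC; apply: has_value_div_lin.
  by have := mvalB fA (mval_cstm A a) i j; rewrite subrr [X in has_value _ _ X]mxE.
exists ((lin a)^-1 *: (f - cstm A)), A1; split; last exact: h.
by rewrite scalerA (mulfV (lin_neq0 a)) scale1r addrC subrK.
Qed.

Lemma lin_a a : has_value (lin a) a 0.
Proof. by rewrite -(subrr a); apply: has_value_lin. Qed.

Lemma moebius_a a : a^* != a -> has_value (lin a / lin a^*) a 0.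
Proof.
move=> ra; rewrite -(mul0r (a - a^*)^-1); apply: has_valueM (lin_a a) _.
by apply: has_valueV (has_value_lin _ _); rewrite subr_eq0 eq_sym.
Qed.

Lemma mval_collapse m n (f1 : 'M[K]_(m, n)) a A A1 :
  mval f1 a A1 -> mval (cstm A + lin a *: f1) a A.
Proof.
move=> h; have := mvalD (mval_cstm A a) (mvalZ (lin_a a) h).
by rewrite scale0r addr0.
Qed.

(** Coefficients of order 0 and 1 in f^T f, which vanishes to order 2 at a. *)
Lemma orth_expand n f f1 a A A1 :
  f^T *m f = (lin a ^+ n.+2)%:M -> f = cstm A + lin a *: f1 -> mval f1 a A1 ->
  A^T *m A = 0 /\ A^T *m A1 + A1^T *m A = 0.
Proof.
move=> ff fE f1A; have fA : mval f a A by rewrite fE; apply: mval_collapse f1A.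
have t0 m : has_value (lin a ^+ m.+1) a 0.
  by have := has_valueX m.+1 (lin_a a); rewrite expr0n.
have iso : A^T *m A = 0.
  apply: mval_uniq (mvalM (mval_tr fA) fA) _; rewrite ff -scalemx1 -(scale0r 1%:M).
  by apply: mvalZ (t0 _) _; rewrite -(map_mx1 cst); apply: mval_cstm.
split; first exact: iso.
have E : cstm A^T *m f1 + f1^T *m cstm A + lin a *: (f1^T *m f1)
    = lin a ^+ n.+1 *: 1%:M.
  apply: (scalerI (lin_neq0 a)); rewrite [RHS]scalerA -exprS scalemx1 -ff fE.
  rewrite trmx_add trmx_scale mulmxDl !mulmxDr /cstm map_trmx -map_mxM iso map_mx0.
  rewrite -!scalemxAr -!scalemxAl !scalerDr add0r !addrA; by [].
apply: (@mval_uniq _ _ _ (lin a ^+ n.+1 *: 1%:M) a); last first.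
  rewrite -(scale0r 1%:M).
  by apply: mvalZ (t0 _) _; rewrite -(map_mx1 cst); apply: mval_cstm.
rewrite -E -[_ + A1^T *m _]addr0 -(scale0r (A1^T *m A1)).
apply: mvalD; last by apply: mvalZ (lin_a a) _; apply: mvalM (mval_tr f1A) f1A.
apply: mvalD; first by apply: mvalM f1A; apply: mval_cstm.
by apply: mvalM (mval_tr f1A) _; apply: mval_cstm.
Qed.

(** The pole of the factor has coefficient a multiple of conj l l^T.  It kills A,
so that only its product with A1 contributes at a. *)
Lemma sf_residue f f1 a A A1 l : a^* != a -> null l ->
  f = cstm A + lin a *: f1 -> mval f1 a A1 -> l^T *m A = 0 ->
  mval (simple_factor a l *m f) a (residue A A1 (a - a^*) l).
Proof.
move=> ra nl fE f1A lA; have fA : mval f a A by rewrite fE; apply: mval_collapse f1A.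
have := cstm_null nl; rewrite bil_cstm; set N := bil l (mxbar l) => -[_ _ N0].
have lf : (cstm l)^T *m f = lin a *: ((cstm l)^T *m f1).
  by rewrite fE mulmxDr /cstm map_trmx -map_mxM lA map_mx0 add0r scalemxAr.
have -> : simple_factor a l *m f =
   f + ((lin a / lin a^* - 1) / cst N) *: (cstm l *m (cstm (mxbar l))^T *m f)
   + ((lin a^* - lin a) / cst N) *: (cstm (mxbar l) *m ((cstm l)^T *m f1)).
  rewrite /simple_factor /hyperbolic bil_cstm -/N !mulmxDl mul1mx -!scalemxAl.
  rewrite -(mulmxA (cstm (mxbar l))).
  rewrite lf -scalemxAr scalerA; congr (_ + _ *: _).
  rewrite invf_div -mulrA [_^-1 * _]mulrC mulrA mulrBl mul1r.
  by rewrite (divfK (lin_neq0 a)).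
rewrite /residue; apply: mvalD; first apply: (mvalD fA).
  rewrite -scaleNr; apply: mvalZ.
    rewrite (_ : - N^-1 = (0 - 1) * N^-1) -?fmorphV; last by rewrite sub0r mulN1r.
    apply: has_valueM (has_value_cst _ _); apply: has_valueB.
      exact: moebius_a.
    by rewrite -(rmorph1 cst); apply: has_value_cst.
  by apply: mvalM fA; rewrite /cstm map_trmx -map_mxM; apply: mval_cstm.
apply: mvalZ.
  rewrite -fmorphV; apply: has_valueM (has_value_cst _ _).
  by rewrite -[a - _]subr0; apply: has_valueB (has_value_lin _ _) (lin_a _).
rewrite -mulmxA; apply: mvalM (mval_cstm _ _) _; apply: mvalM f1A.
by rewrite /cstm map_trmx; apply: mval_cstm.
Qed.

(** The skewness of A^T A1 for A = l u^T reads u v + v^T u^T = 0 with v = l^T A1, and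
forces v = 0.  The simple factor then acts at a as a projection that kills l. *)
Lemma rank_one_pole n f a l (u : 'cV[C]_7) : a^* != a -> null l ->
  f^T *m f = (lin a ^+ n.+2)%:M -> mval f a (l *m u^T) -> u != 0 ->
  mval (simple_factor a l *m f) a 0.
Proof.
move=> ra nl ff fA u0; have [f1 [A1 [fE f1A]]] := mval_expand fA.
have [_ skew] := orth_expand ff fE f1A.
have ll : l^T *m l = 0.
  by rewrite bilE_mx (proj2 nl); apply/matrixP => i j; rewrite !mxE mul0rn.
have v0 : l^T *m A1 = 0.
  set v := l^T *m A1.
  have {}skew i j : u i 0 * v 0 j + v 0 i * u j 0 = 0.
    have : u *m v + v^T *m u^T = 0.
      by rewrite /v trmx_mul trmxK mulmxA -[u in u *m l^T]trmxK -trmx_mul -mulmxA.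
    by move/matrixP/(_ i j); rewrite !mxE !big_ord1 !mxE.
  have [i ui] : exists i, u i 0 != 0.
    apply: contrapT => h; move/eqP: u0; apply; apply/matrixP => i j.
    rewrite ord1 mxE; apply/eqP; apply: contrapT => /negP hi; by apply: h; exists i.
  have vi : v 0 i = 0.
    have /eqP := skew i i; rewrite [v 0 i * _]mulrC -mulr2n mulrn_eq0 /= mulf_eq0.
    by rewrite (negPf ui) => /eqP.
  apply/matrixP => i' j; rewrite ord1 [RHS]mxE; have /eqP := skew i j.
  by rewrite vi mul0r addr0 mulf_eq0 (negPf ui) => /eqP.
have lA : l^T *m (l *m u^T) = 0 by rewrite mulmxA ll mul0mx.
have := sf_residue ra nl fE f1A lA; rewrite /residue.
rewrite -(mulmxA (mxbar l)) v0 mulmx0 scaler0 addr0.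
have -> : l *m (mxbar l)^T *m (l *m u^T) = bil l (mxbar l) *: (l *m u^T).
  by rewrite mulmxA -(mulmxA l) bilE_mx mul_mx_scalar bilC scalemxAl.
by rewrite scalerA mulVf ?norm_neq0 ?scale1r ?subrr //; case: nl.
Qed.

Lemma sf_polar a k : a^* != a -> null k ->
  mval (lin a *: simple_factor a k) a (((a - a^*) / bil k (mxbar k)) *: (mxbar k *m k^T)).
Proof.
move=> ra nk; have one : has_value (1 : K) a 1.
  by rewrite -(rmorph1 cst); apply: has_value_cst.
have -> : lin a *: simple_factor a k = lin a *: 1%:M
   + (lin a * ((lin a / lin a^* - 1) / cst (bil k (mxbar k)))) *: cstm (k *m (mxbar k)^T)
   + ((lin a^* - lin a) / cst (bil k (mxbar k))) *: cstm (mxbar k *m k^T).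
  rewrite sfE /hyperbolic bil_cstm invf_div !scalerDr !scalerA /cstm !map_mxM -!map_trmx.
  rewrite (_ : lin a * ((lin a^* / lin a - 1) / _)
      = (lin a^* - lin a) / cst (bil k (mxbar k))); first by [].
  by rewrite mulrA mulrBr mulr1 mulrCA (mulfV (lin_neq0 a)) mulr1.
rewrite -[X in mval _ _ X]add0r -(add0r 0) -{1}(scale0r 1%:M).
rewrite -(scale0r (k *m (mxbar k)^T)); apply: mvalD; first apply: mvalD.
- by apply: mvalZ (lin_a a) _; rewrite -(map_mx1 cst); apply: mval_cstm.
- apply: mvalZ (mval_cstm _ _); rewrite -fmorphV.
  rewrite -[X in has_value _ _ X](mul0r ((0 - 1) * (bil k (mxbar k))^-1)).
  apply: has_valueM (lin_a a) _; apply: has_valueM (has_value_cst _ _).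
  by apply: has_valueB one; apply: moebius_a.
- apply: mvalZ (mval_cstm _ _); rewrite -fmorphV.
  apply: has_valueM (has_value_cst _ _).
  by rewrite -[a - _]subr0; apply: has_valueB (has_value_lin _ _) (lin_a _).
Qed.

(** The loop t h p^T, for p the simple factor of k, is orthogonal up to the scalar
t^2 and has a leading coefficient of rank one with image spanned by H k; so
[rank_one_pole] applies. *)
Lemma dressing_hol a h H k : a^* != a -> null k -> h^T *m h = 1%:M ->
  mval h a H -> hol (simple_factor a (H *m k) *m h *m (simple_factor a k)^T) a.
Proof.
move=> ra nk oh hH.
have oH : H^T *m H = 1%:M.
  apply: mval_uniq (mvalM (mval_tr hH) hH) _; rewrite oh.
  by rewrite -(map_mx1 cst); apply: mval_cstm.
have nHk : null (H *m k).
  case: nk => k0 kk; split; last by rewrite bil_mull mulmxA oH mul1mx.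
  apply: contra k0 => /eqP h0; rewrite -[k]mul1mx -oH -mulmxA h0 mulmx0 //.
have osf := mulmx1C (sf_orth a nk).
pose f := h *m (lin a *: simple_factor a k)^T.
have ff : f^T *m f = (lin a ^+ 2)%:M.
  rewrite /f trmx_mul trmxK mulmxA -(mulmxA _ h^T) oh mulmx1 trmx_scale.
  by rewrite -scalemxAl -scalemxAr scalerA osf scalemx1.
pose u := ((a - a^*) / bil k (mxbar k)) *: mxbar k.
have u0 : u != 0.
  rewrite scaler_eq0 mulf_eq0 invr_eq0 subr_eq0 eq_sym mxbar_eq0.
  by case: nk => k0 _; rewrite (negPf ra) (negPf k0) (negPf (norm_neq0 k0)).
have fA : mval f a (H *m k *m u^T).
  have := mvalM hH (mval_tr (sf_polar ra nk)).
  rewrite (_ : (_ *: (mxbar k *m k^T))^T = k *m u^T) ?mulmxA //.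
  by rewrite trmx_scale trmx_mul trmxK /u trmx_scale scalemxAr.
have := @rank_one_pole 0 f a _ u ra nHk ff fA u0.
rewrite /f trmx_scale -2!scalemxAr mulmxA => /mval_expand[f1 [A1 [E h1]]].
exists A1; move: E; rewrite /cstm map_mx0 add0r => E.
by rewrite (scalerI (lin_neq0 a) E).
Qed.

End SimpleFactors.

Local Opaque simple_factor lin.

(** * Removing poles *)
Section Reduction.
Variable R : realType.
Local Notation C := (R[i]%C).
Local Notation K := (ratfun R).
Implicit Types (l k : 'cV[C]_7) (a b c : C) (f g h : loop R).

Lemma loop_liouville g : (forall a, hol g a) ->
  (forall i j, vanishing ((g - 1%:M) i j)) -> g = 1%:M.
Proof.
move=> hg sg; apply/eqP; rewrite -subr_eq0; apply/eqP/matrixP => i j.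
rewrite [RHS]mxE; apply: vanishing_entire => // a.
have [A hA] := hg a; exists ((A - 1%:M) i j).
have : mval (g - cstm 1%:M) a (A - 1%:M) by apply: mvalB hA (mval_cstm _ _).
by rewrite /cstm map_mx1; apply.
Qed.

Lemma holM m n p (g : 'M[K]_(m, n)) (h : 'M[K]_(n, p)) a :
  hol g a -> hol h a -> hol (g *m h) a.
Proof. by move=> [A hA] [B hB]; exists (A *m B); apply: mvalM. Qed.

Lemma hol_tr m n (g : 'M[K]_(m, n)) a : hol g a -> hol g^T a.
Proof. by move=> [A hA]; exists A^T; apply: mval_tr. Qed.

Lemma hol_divlin m n (f : 'M[K]_(m, n)) a :
  mval (lin a *: f) a 0 -> hol f a.
Proof.
move=> /mval_expand[f1 [A1 [E h1]]]; exists A1; move: E.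
by rewrite /cstm map_mx0 add0r => E; rewrite (scalerI (lin_neq0 a) E).
Qed.

Lemma adm_null l k : admissible_pair l k -> null l /\ null k.
Proof. by case=> -[l0 k0] ll kk _ _; split; split. Qed.

(** The composite of the two symmetries, g(lambda) |-> s conj g(- conj lambda) s: it
is antiholomorphic and fixes every imaginary point, so it acts on the Laurent
coefficients there. *)
Definition theta f : loop R := twist (map_mx rbar f).

Lemma mval_theta f a A : a^* = - a -> mval f a A ->
  mval (theta f) a (smx R *m mxbar A *m smx R).
Proof.
move=> ia fA; apply: mvalM (mval_cstm _ _); apply: mvalM (mval_cstm _ _) _.
by have := mval_ropp (mval_rbar fA); rewrite ia opprK.
Qed.

Lemma thetaZ (x : K) f : theta (x *: f) = ropp (rbar x) *: theta f.
Proof.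
by rewrite /theta /twist !map_mxZ /= -scalemxAr -scalemxAl.
Qed.

Lemma thetaD f g : theta (f + g) = theta f + theta g.
Proof. by rewrite /theta /twist !map_mxD mulmxDr mulmxDl. Qed.

Lemma theta_cstm A : theta (cstm A) = cstm (smx R *m mxbar A *m smx R).
Proof. by rewrite /theta /twist rbar_cstm ropp_cstm /cstm -!map_mxM. Qed.

Section Expansion.
Variables (n : nat) (a : C) (g : loop R) (f1 : loop R) (A A1 : 'M[C]_7).
Hypothesis cg : forall x y, cprod (g *m x) (g *m y) = g *m cprod x y.
Local Notation t := (lin a : K).
Local Notation f := (t ^+ n.+1 *: g).
Hypothesis fE : f = cstm A + t *: f1.
Hypothesis f1A : mval f1 a A1.

Let fA : mval f a A. Proof. by rewrite fE; apply: mval_collapse f1A. Qed.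

Let crossf x y : cprod (f *m x) (f *m y) = t ^+ n.+1 *: (f *m cprod x y).
Proof.
by rewrite -!scalemxAl cprodZl cprodZr cg.
Qed.

Let tn : has_value (t ^+ n) a (n == 0%N)%:R.
Proof. by have := has_valueX n (lin_a a); rewrite expr0n. Qed.

(** Multiplicativity of g at leading order: the left side carries twice as many
powers of t as the right side. *)
Lemma leading_null x y : cprod (A *m x) (A *m y) = 0.
Proof.
have fx (z : 'cV[C]_7) : mval (f *m cstm z) a (A *m z) by apply: mvalM fA (mval_cstm _ _).
apply: mval_uniq (mval_cprod (fx x) (fx y)) _.
rewrite crossf -(scale0r (A *m cprod x y)); apply: mvalZ.
  by have := has_valueX n.+1 (lin_a a); rewrite expr0n.
by rewrite cprod_cstm; apply: mvalM fA (mval_cstm _ _).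
Qed.

(** Multiplicativity of g at the next order; the product term contributes only for
a simple pole. *)
Lemma leading_cross x y : cprod (A *m x) (A1 *m y) + cprod (A1 *m x) (A *m y)
  = if n == 0%N then A *m cprod x y else 0.
Proof.
have fx (z : 'cV[C]_7) : f *m cstm z = cstm (A *m z) + t *: (f1 *m cstm z).
  by rewrite fE mulmxDl /cstm map_mxM scalemxAl.
have f1x (z : 'cV[C]_7) : mval (f1 *m cstm z) a (A1 *m z) by apply: mvalM f1A (mval_cstm _ _).
have expand (s : K) (u v u' v' : 'cV[K]_7) : cprod (u + s *: u') (v + s *: v')
    = cprod u v + s *: (cprod u v' + cprod u' v + s *: cprod u' v').
  by apply: coP => i _; rewrite !(cprodDl, cprodDr, cprodZl, cprodZr) !(coD, coZ); ring.
have E : cprod (cstm (A *m x)) (f1 *m cstm y) + cprod (f1 *m cstm x) (cstm (A *m y))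
    + t *: cprod (f1 *m cstm x) (f1 *m cstm y) = t ^+ n *: (f *m cstm (cprod x y)).
  apply: (scalerI (lin_neq0 a)); rewrite [RHS]scalerA -exprS -cprod_cstm -crossf.
  by rewrite !fx expand cprod_cstm leading_null /cstm map_mx0 add0r.
have -> : (if n == 0%N then A *m cprod x y else 0) = (n == 0%N)%:R *: (A *m cprod x y).
  by case: eqP => _; rewrite ?scale1r ?scale0r.
apply: (@mval_uniq _ _ _ (t ^+ n *: (f *m cstm (cprod x y))) a); last first.
  by apply: mvalZ tn _; apply: mvalM fA (mval_cstm _ _).
rewrite -E -[_ + cprod (A1 *m x) _]addr0 -(scale0r (cprod (A1 *m x) (A1 *m y))).
apply: mvalD; last by apply: mvalZ (lin_a a) _; apply: mval_cprod.
by apply: mvalD; apply: mval_cprod => //; apply: mval_cstm.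
Qed.

Hypotheses (ia : a^* = - a) (tg : theta g = g).

(** The symmetry sends t to - t, which gives consecutive coefficients opposite
signs. *)
Lemma leading_theta :
  smx R *m mxbar A *m smx R = (-1) ^+ n.+1 *: A /\
  smx R *m mxbar A1 *m smx R = - (-1) ^+ n.+1 *: A1.
Proof.
have rt : ropp (rbar t) = - t by rewrite rbar_lin ropp_lin ia opprK.
have eE m : has_value ((-1) ^+ m : K) a ((-1) ^+ m).
  apply: has_valueX; rewrite -(rmorph1 cst) -rmorphN; exact: has_value_cst.
have tf : theta f = (-1) ^+ n.+1 *: f.
  by rewrite thetaZ tg !rmorphXn /= rt scalerA -exprMn mulN1r.
have EA : smx R *m mxbar A *m smx R = (-1) ^+ n.+1 *: A.
  apply: mval_uniq (mval_theta ia fA) _; rewrite tf; exact: mvalZ (eE _) fA.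
split; first exact: EA.
apply: mval_uniq (mval_theta ia f1A) _.
have -> : theta f1 = - (-1) ^+ n.+1 *: f1.
  apply: (scalerI (lin_neq0 a)).
  have : theta f = theta (cstm A) + theta (t *: f1) by rewrite -thetaD -fE.
  rewrite tf (thetaZ _ f1) rt scaleNr fE theta_cstm EA /cstm map_mxZ rmorphXn rmorphN1.
  rewrite scalerDr => /addrI H; rewrite -[t *: theta f1]opprK -H.
  by rewrite scaleNr scalerN !scalerA mulrC.
by apply: mvalZ f1A; apply: has_valueN.
Qed.
End Expansion.

(** The vectors come from [leading_term_choice].  When the factor of k leaves a
nonzero leading coefficient, it has rank one and [rank_one_pole] applies.
Otherwise the factor of k already lowers the order, and the factor of l creates
no new pole, because l^T kills the next coefficient too. *)
Lemma reduce_pole g a n (symm : bool) : a^* != a -> is_G2 g ->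
  hol (lin a ^+ n.+1 *: g) a -> ~ hol (lin a ^+ n *: g) a ->
  (symm -> a^* = - a /\ theta g = g) ->
  exists l k, [/\ admissible_pair l k,
    symm -> conj_s (smx R) l = l /\ conj_s (smx R) k = k &
    hol (lin a ^+ n *: (simple_factor a l *m (simple_factor a k *m g))) a].
Proof.
move=> ra [og cg] [A fA] nh J.
set t := lin a in fA nh *.
have [f1 [A1 [fE f1A]]] := mval_expand fA.
set f := t ^+ n.+1 *: g in fA fE.
have ff : f^T *m f = (t ^+ (n + n).+2)%:M.
  by rewrite /f trmx_scale -scalemxAl -scalemxAr scalerA og scalemx1 -exprD addSn addnS.
have ff' : f^T^T *m f^T = (t ^+ (n + n).+2)%:M.
  rewrite trmxK /f trmx_scale -scalemxAl -scalemxAr scalerA (mulmx1C og) scalemx1.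
  by rewrite -exprD addSn addnS.
have [iso skew] := orth_expand ff fE f1A.
have fTE : f^T = cstm A^T + lin a *: f1^T.
  by rewrite fE trmx_add trmx_scale /cstm map_trmx.
have [iso' _] := orth_expand ff' fTE (mval_tr f1A).
rewrite trmxK in iso'.
have A0 : A != 0.
  apply/eqP => A0; apply: nh; exists A1.
  suff -> : t ^+ n *: g = f1 by [].
  apply: (scalerI (lin_neq0 a)); rewrite scalerA -exprS -[LHS]/f fE A0.
  by rewrite /cstm map_mx0 add0r.
have tau_imag : (a - a^*)^* = - (a - a^*) by rewrite rmorphB /= conjCK opprB.
have jA J1 := proj1 (leading_theta fE f1A (proj1 (J J1)) (proj2 (J J1))).
have jA1 J1 := proj2 (leading_theta fE f1A (proj1 (J J1)) (proj2 (J J1))).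
have e0 : (-1) ^+ n.+1 != 0 :> C by rewrite signr_eq0.
have [k [k0 kk kA jk H]] := leading_term_choice (smx_G2 R) (smx_sq R) (mxbar_smx R)
  A0 tau_imag iso iso' (leading_null cg fE f1A) skew
  (leading_cross cg fE f1A) e0 jA jA1.
have nk : null k by split.
have [f' f'D] : exists f', f' = simple_factor a k *m f by exists (simple_factor a k *m f).
have f'B : mval f' a (residue A A1 (a - a^*) k).
  by rewrite f'D; apply: (sf_residue ra nk fE f1A kA).
move: (residue A A1 (a - a^*) k) H f'B => B H f'B.
suff [l [al jl fin]] : exists l, [/\ admissible_pair l k, symm -> conj_s (smx R) l = l
    & mval (simple_factor a l *m f') a 0].
  exists l, k; split; [exact: al | by move=> J1; split; auto | ].
  apply: hol_divlin; rewrite scalerA -exprS.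
  rewrite (scalemxAr (lin a ^+ n.+1) (simple_factor a l)).
  rewrite (scalemxAr (lin a ^+ n.+1) (simple_factor a k)).
  have E : simple_factor a k *m (lin a ^+ n.+1 *: g) = f' by exact: esym f'D.
  exact: (eq_ind_r (fun X => mval (simple_factor a l *m X) a 0) fin E).
have ff'2 : f'^T *m f' = (t ^+ (n + n).+2)%:M.
  by rewrite f'D trmx_mul mulmxA -(mulmxA f^T) (sf_orth a nk) mulmx1.
case: H => [[l [u [Bu u0 al jl]]]|[B0 [_ [l [al [lk lk'] lA lA1 jl]]]]].
  exists l; split; [exact: al | exact: jl | ].
  apply: (rank_one_pole ra _ ff'2 _ u0); first by case: (adm_null al).
  by rewrite -Bu.
exists l; split; [exact: al | exact: jl | ].
have [nl _] := adm_null al.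
have [f1' [B1 [f'E f1'B]]] := mval_expand f'B.
have lsf : (cstm l)^T *m simple_factor a k = (cstm l)^T.
  rewrite sfE /hyperbolic !mulmxDr mulmx1 -!scalemxAr !mulmxA !bilE_mx !bil_cstm.
  by rewrite lk lk' [cst 0]rmorph0 !mul_scalar_mx !scale0r !scaler0 !addr0.
have lf1 : (cstm l)^T *m f1' = (cstm l)^T *m f1.
  apply: (scalerI (lin_neq0 a)); rewrite !scalemxAr.
  have -> : lin a *: f1' = f' by rewrite f'E B0 /cstm map_mx0 add0r.
  rewrite f'D mulmxA lsf fE mulmxDr {1}/cstm map_trmx /cstm -map_mxM lA.
  by rewrite map_mx0 add0r.
have lB1 : l^T *m B1 = 0.
  rewrite -lA1; apply: (@mval_uniq _ _ _ ((cstm l)^T *m f1') a).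
    by apply: mvalM f1'B; rewrite /cstm map_trmx; apply: mval_cstm.
  by rewrite lf1; apply: mvalM f1A; rewrite /cstm map_trmx; apply: mval_cstm.
have lB : l^T *m B = 0 by rewrite B0 mulmx0.
have := sf_residue ra nl f'E f1'B lB.
by rewrite /residue B0 -(mulmxA (mxbar l)) lB1 !mulmx0 !scaler0 subr0 addr0.
Qed.

(** Decompose k as m + d conj l and apply [hyperbolic_pair_G2] over the rational
functions; its last hypothesis is checked at a, where the parameter z vanishes. *)
Lemma adm_pair_G2 a l k : a^* != a -> admissible_pair l k ->
  is_G2 (simple_factor a l *m simple_factor a k).
Proof.
move=> ra [[l0 k0] ll kk kl']; have := norm_neq0 l0.
set N := bil l (mxbar l) => N0; set d := bil k l / N.
rewrite /=; set m := k - _ => -[m0 lxm].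
have kE : k = m + d *: mxbar l by rewrite subrK.
have k'E : mxbar k = mxbar m + d^* *: l by rewrite {1}kE mxbarD mxbarZ mxbarK.
have l'l' : bil (mxbar l) (mxbar l) = 0 by rewrite bil_bar ll rmorph0.
have lk' : bil l (mxbar k) = 0 by rewrite bilC bil_barl kl' rmorph0.
have mm : bil m m = 0.
  rewrite /m !(bilDl, bilDr, bilNl, bilNr, bilZl, bilZr) kk kl' l'l' (bilC _ k) kl'.
  by ring.
have lm : bil l m = 0.
  by rewrite /m bilDr bilNr bilZr (bilC l k) -/N /d divfK ?subrr.
have l'm : bil (mxbar l) m = 0.
  by rewrite /m bilDr bilNr bilZr l'l' (bilC _ k) kl' mulr0 subr0.
have lm' : bil l (mxbar m) = 0 by rewrite bilC bil_barl bilC l'm rmorph0.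
have l'm' : bil (mxbar l) (mxbar m) = 0 by rewrite bil_bar lm rmorph0.
have m'm' : bil (mxbar m) (mxbar m) = 0 by rewrite bil_bar mm rmorph0.
have l'xm' : cprod (mxbar l) (mxbar m) = 0.
  by rewrite cprod_bar lxm; apply/eqP; rewrite mxbar_eq0.
have M0 := norm_neq0 m0; set M := bil m (mxbar m) in M0.
clearbody m.
have PE : M + d * d^* * N = bil k (mxbar k).
  have -> : bil k (mxbar k) = bil (m + d *: mxbar l) (mxbar m + d^* *: l).
    by rewrite -kE -k'E.
  have ml : bil m l = 0 by rewrite bilC.
  have l'l : bil (mxbar l) l = N by rewrite bilC.
  by rewrite !(bilDl, bilDr, bilZl, bilZr) l'm' ml l'l !mulr0 addr0 add0r mulrA.
rewrite !sfE.
have -> : cstm k = cstm m + cst d *: cstm (mxbar l).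
  by rewrite {1}kE /cstm map_mxD map_mxZ.
have -> : cstm (mxbar k) = cstm (mxbar m) + cst d^* *: cstm l.
  by rewrite k'E /cstm map_mxD map_mxZ.
have lift0 x y : bil x y = 0 -> bil (cstm x) (cstm y) = 0.
  by move=> h; rewrite bil_cstm h rmorph0.
have liftx0 x y : cprod x y = 0 -> cprod (cstm x) (cstm y) = 0.
  by move=> h; rewrite cprod_cstm h /cstm map_mx0.
apply: hyperbolic_pair_G2; try exact: lift0; try exact: liftx0.
- by rewrite -(rmorph_nat cst) cst_eq0 pnatr_eq0.
- exact: moebius_neq0.
- by rewrite bil_cstm cst_eq0.
- by rewrite bil_cstm cst_eq0.
- by rewrite !bil_cstm -!rmorphM -rmorphD cst_eq0 PE norm_neq0.
apply/eqP => E; case/eqP: M0.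
apply: (@has_value_uniq _ (0 : K) a); last first.
  by rewrite -(rmorph0 cst); apply: has_value_cst.
rewrite -E !bil_cstm -!rmorphM.
have := has_valueD (has_value_cst M a)
  (has_valueM (moebius_a ra) (has_value_cst (d * d^* * N) a)).
by rewrite mul0r addr0.
Qed.

End Reduction.

(** * Subspaces and spanning vectors *)
Section Subspaces.
Variable R : realType.
Local Notation C := (R[i]%C).
Implicit Types (l k u v x : 'cV[C]_7) (U V : {vspace C7 R}) (a b c : C).

Lemma dotE u v : dot u v = bil u v. Proof. by []. Qed.
Lemma crossE u v : cross u v = cprod u v. Proof. by []. Qed.
Lemma cconjE m n (A : 'M[C]_(m, n)) : cconj A = mxbar A. Proof. by []. Qed.

Lemma regroup (V : zmodType) (i x0 x1 y0 y1 : V) :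
  x1 + (i - y0 - x0) + y1 = i + (y1 - y0) + (x1 - x0).
Proof. by rewrite !addrA [LHS](ACl (2*5*3*1*4)). Qed.

Lemma imgV_line (A : 'M[C]_7) v : imgV A <[v]>%VS = <[A *m v]>%VS.
Proof. by rewrite /imgV limg_line lfunE. Qed.

Lemma conjV_line v : conjV <[v]>%VS = <[mxbar v]>%VS.
Proof.
apply/vspaceP => x; rewrite mem_conjV cconjE; apply/vlineP/vlineP => -[c h].
  by exists c^*; rewrite -[x]mxbarK h mxbarZ.
by exists c^*; rewrite h mxbarZ mxbarK.
Qed.

Lemma vline_scale c v : c != 0 -> <[c *: v]>%VS = <[v]>%VS.
Proof.
move=> c0; apply/eqP; rewrite eqEsubv; apply/andP; split; apply/subvP => x.
  by move=> /vlineP[d ->]; rewrite scalerA memvZ ?memv_line.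
move=> /vlineP[d ->]; have -> : d *: v = (d / c) *: (c *: v).
  by rewrite scalerA divfK.
by rewrite memvZ ?memv_line.
Qed.

Lemma mem_perp_pair l x : x \in perp (<[l]> + conjV <[l]>)%VS <->
  bil l x = 0 /\ bil (mxbar l) x = 0.
Proof.
rewrite conjV_line; split=> [/mem_perp h|[h1 h2]].
  split; apply: h; first by apply: (subvP (addvSl _ _)); apply: memv_line.
  by apply: (subvP (addvSr _ _)); apply: memv_line.
apply/mem_perp => u /memv_addP[_ /vlineP[c ->] [_ /vlineP[d ->] ->]].
by rewrite dotE bilDl !bilZl h1 h2 !mulr0 addr0.
Qed.

Lemma proj_unique U V (P : 'M[C]_7) : (U :&: V = 0)%VS ->
  (forall x, P *m x \in U) -> (forall x, x - P *m x \in V) -> proj U V = P.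
Proof.
move=> UV hU hV; apply: col_ext => x.
have projE y : proj U V *m y = daddv_pi U V y.
  apply/matrixP => i j; rewrite ord1 mxE {2}(matrix_sum_delta y).
  rewrite linear_sum summxE /=; apply: eq_bigr => m _; rewrite big_ord1 linearZ !mxE.
  by rewrite mulrC.
have xUV : x \in (U + V)%VS.
  by rewrite -[x](subrK (P *m x)) addrC memv_add.
have := daddv_pi_add UV xUV.
rewrite projE; set p := daddv_pi U V x; set q := daddv_pi V U x => pq.
have pU : p \in U by apply: memv_pi.
have qV : q \in V by apply: memv_pi.
apply/eqP; rewrite -subr_eq0 -memv0 -UV memv_cap rpredB ?hU //=.
rewrite (_ : p = x - q) ?[_ - q - _]addrAC; last by rewrite -pq addrK.
by rewrite rpredB ?hV.
Qed.

Section Line.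
Variable l : 'cV[C]_7.
Hypothesis nl : null l.
Local Notation N := (bil l (mxbar l)).
Local Notation L := (<[l]>%VS : {vspace C7 R}).

Let N0 : N != 0. Proof. by apply: norm_neq0; case: nl. Qed.
Let ll : bil l l = 0. Proof. by case: nl. Qed.
Let l'l' : bil (mxbar l) (mxbar l) = 0. Proof. by rewrite bil_bar ll rmorph0. Qed.
Let l'l : bil (mxbar l) l = N. Proof. exact: bilC. Qed.

Definition outer_line : 'M[C]_7 := N^-1 *: (l *m (mxbar l)^T).
Definition outer_conj : 'M[C]_7 := N^-1 *: (mxbar l *m l^T).

Lemma outer_lineE x : outer_line *m x = (N^-1 * bil (mxbar l) x) *: l.
Proof. by rewrite -scalemxAl mul_outer scalerA. Qed.
Lemma outer_conjE x : outer_conj *m x = (N^-1 * bil l x) *: mxbar l.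
Proof. by rewrite -scalemxAl mul_outer scalerA. Qed.

Let mid_perp x :
  x - outer_line *m x - outer_conj *m x \in perp (L + conjV L)%VS.
Proof.
apply/mem_perp_pair; rewrite outer_lineE outer_conjE !(bilDr, bilNr, bilZr).
rewrite ll l'l' l'l !mulr0 !subr0; split; by field.
Qed.

Let memL c : c *: l \in L. Proof. by rewrite memvZ ?memv_line. Qed.
Let memL' c : c *: mxbar l \in conjV L.
Proof. by rewrite conjV_line memvZ ?memv_line. Qed.

Lemma pi_lineE : pi_line L = outer_line.
Proof.
apply: proj_unique => [|x|x].
- apply/eqP; rewrite -subv0; apply/subvP => x.
  rewrite memv_cap => /andP[/vlineP[c ->] /memv_addP[p /mem_perp_pair[_ p0] [q]]].
  rewrite conjV_line => /vlineP[d ->] /(congr1 (bil (mxbar l))).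
  rewrite bilDr !bilZr p0 l'l' l'l mulr0 addr0 => /eqP.
  by rewrite mulf_eq0 (negPf N0) orbF => /eqP ->; rewrite scale0r mem0v.
- by rewrite outer_lineE.
rewrite -[x - _](subrK (outer_conj *m x)) memv_add ?mid_perp //.
by rewrite outer_conjE.
Qed.

Lemma pi_conjE : pi_conj L = outer_conj.
Proof.
apply: proj_unique => [|x|x].
- apply/eqP; rewrite -subv0; apply/subvP => x; rewrite memv_cap {1}conjV_line.
  move=> /andP[/vlineP[c ->] /memv_addP[_ /vlineP[d ->] [p /mem_perp_pair[p0 _]]]].
  move=> /(congr1 (bil l)); rewrite bilDr !bilZr p0 ll mulr0 addr0 => /eqP.
  by rewrite mulf_eq0 (negPf N0) orbF => /eqP ->; rewrite scale0r mem0v.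
- by rewrite outer_conjE.
have -> : x - outer_conj *m x = outer_line *m x + (x - outer_line *m x - outer_conj *m x).
  by rewrite [RHS]addrA [_ + (x - _)]addrC subrK.
by rewrite memv_add ?mid_perp // outer_lineE.
Qed.

Lemma pi_midE : pi_mid L = 1%:M - outer_line - outer_conj.
Proof.
apply: proj_unique => [|x|x].
- apply/eqP; rewrite -subv0; apply/subvP => x; rewrite memv_cap.
  move=> /andP[/mem_perp_pair[h1 h2] /memv_addP[_ /vlineP[c ->] [q]]].
  rewrite conjV_line => /vlineP[d ->] xE.
  move: h1 h2; rewrite xE !bilDr !bilZr ll l'l' l'l !mulr0 addr0 add0r => /eqP.
  rewrite mulf_eq0 (negPf N0) orbF => /eqP -> /eqP.
  by rewrite mulf_eq0 (negPf N0) orbF => /eqP ->; rewrite !scale0r addr0 mem0v.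
- by rewrite !mulmxBl mul1mx mid_perp.
rewrite !mulmxBl mul1mx -addrA -opprD opprB addrC subrK.
by rewrite outer_lineE outer_conjE memv_add.
Qed.

Lemma p1E a : p1 a L = simple_factor a l.
Proof.
rewrite /p1 pi_lineE pi_conjE pi_midE sfE /hyperbolic bil_cstm.
rewrite -[moebius a^* a]/(lin a^* / lin a) -[moebius a a^*]/(lin a / lin a^*) invf_div.
have E A : Defs.lift_cst A = cstm A by [].
rewrite !E /outer_line /outer_conj /cstm !map_mxB map_mx1 !map_mxZ !map_mxM -!map_trmx.
rewrite fmorphV /= !scalerA !mulrBl !mul1r !scalerBl.
exact: regroup.
Qed.

Lemma isotropic_vline : isotropic_line L.
Proof.
split; first by rewrite dim_vline (proj1 nl).
by move=> u v /vlineP[c ->] /vlineP[d ->]; rewrite dotE bilZl bilZr ll !mulr0.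
Qed.

End Line.

Lemma isotropic_lineP U : isotropic_line U -> exists2 l, null l & U = <[l]>%VS.
Proof.
move=> [d1 iU]; have vU : vpick U \in U by apply: memv_pick.
have v0 : vpick U != 0 by rewrite vpick0 -dimv_eq0 d1.
exists (vpick U); first by split=> //; rewrite -dotE iU.
apply/eqP; rewrite eq_sym eqEdim -memvE vU /= d1 dim_vline v0 //.
Qed.

Lemma pi_mid_admissible l k : null l -> bil k (mxbar l) = 0 ->
  pi_mid <[l]> *m k = k - (bil k l / bil l (mxbar l)) *: mxbar l.
Proof.
move=> nl kl'; rewrite (pi_midE nl) !mulmxBl mul1mx outer_lineE outer_conjE.
by rewrite (bilC (mxbar l)) kl' mulr0 scale0r subr0 (bilC l k) mulrC.
Qed.

Lemma admissibleP L K : admissible L K <->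
  exists l k, [/\ admissible_pair l k, L = <[l]>%VS & K = <[k]>%VS].
Proof.
split.
  move=> [/isotropic_lineP[l nl ->] /isotropic_lineP[k nk ->] kl [d2 _ cr]].
  exists l, k; split=> //.
  have kl' : bil k (mxbar l) = 0.
    rewrite bilC -dotE; have /mem_perp := subvP kl k (memv_line k); apply.
    by rewrite conjV_line memv_line.
  move: d2 cr; rewrite imgV_line pi_mid_admissible //; set m := k - _ => d2 cr.
  split; [by split; [case: nl | case: nk] | by case: nl | by case: nk | done | split].
    rewrite -/m; apply/eqP => m0; move: d2.
    have -> : <[m]>%VS = 0%VS by apply/eqP; rewrite -dimv_eq0 dim_vline m0 eqxx.
    by rewrite addv0 dim_vline (proj1 nl).
  apply: cr; first by apply: (subvP (addvSl _ _)); apply: memv_line.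
  by apply: (subvP (addvSr _ _)); apply: memv_line.
move=> [l [k [alk -> ->]]]; have [nl nk] := adm_null alk.
case: alk => _ ll kk kl' [m0 lm].
split; [exact: isotropic_vline | exact: isotropic_vline | | ].
  apply/subvP => x /vlineP[c ->]; apply/mem_perp => u; rewrite conjV_line => /vlineP[d ->].
  by rewrite dotE bilZl bilZr (bilC _ k) kl' !mulr0.
rewrite imgV_line pi_mid_admissible //; move: m0 lm; set m := k - _ => m0 lm.
have l'l' : bil (mxbar l) (mxbar l) = 0 by rewrite bil_bar ll rmorph0.
have ml' : bil m (mxbar l) = 0 by rewrite /m bilDl bilNl bilZl kl' l'l' mulr0 subr0.
clearbody m.
have N0 := norm_neq0 (proj1 nl).
have lm0 : bil l m = 0 by apply: Ann_orth => //; case: nl.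
have mm : bil m m = 0 by apply: (Ann_isotropic _ (proj1 nl)) => //; rewrite pnatr_eq0.
have mxl : cprod m l = 0 by rewrite cprod_anti lm oppr0.
have ml : bil m l = 0 by rewrite bilC.
split.
- rewrite dimv_disjoint_sum ?dim_vline ?m0 ?(proj1 nl) //.
  apply/eqP; rewrite -subv0; apply/subvP => x; rewrite memv_cap.
  move=> /andP[/vlineP[c ->] /vlineP[d /(congr1 (bil (mxbar l)))]].
  rewrite !bilZr (bilC _ m) ml' mulr0 (bilC _ l) => /eqP.
  by rewrite mulf_eq0 (negPf N0) orbF => /eqP ->; rewrite scale0r mem0v.
- move=> u v /memv_addP[_ /vlineP[c ->] [_ /vlineP[d ->] ->]].
  move=> /memv_addP[_ /vlineP[c' ->] [_ /vlineP[d' ->] ->]].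
  by rewrite dotE !(bilDl, bilDr, bilZl, bilZr) ll mm lm0 ml !mulr0 !addr0.
move=> u v /memv_addP[_ /vlineP[c ->] [_ /vlineP[d ->] ->]].
move=> /memv_addP[_ /vlineP[c' ->] [_ /vlineP[d' ->] ->]].
rewrite crossE !(cprodDl, cprodDr, cprodZl, cprodZr) !cprodxx lm mxl.
by rewrite !scaler0 !addr0.
Qed.

Lemma sV_conjVP l : l != 0 -> (sV <[l]> = conjV <[l]>)%VS <->
  exists2 c, c != 0 & conj_s (smx R) l = c *: l.
Proof.
move=> l0; rewrite /sV imgV_line conjV_line; split=> [h|[c c0 jl]].
  have : smx R *m l \in <[mxbar l]>%VS by rewrite -h memv_line.
  move=> /vlineP[c sl]; have c0 : c != 0.
    apply: contra l0 => /eqP c0; rewrite -[l]mul1mx -(smx_sq R) -mulmxA sl c0.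
    by rewrite scale0r mulmx0.
  exists c^*; first by rewrite conjC_eq0.
  by rewrite /conj_s -mxbar_smx -mxbarM sl mxbarZ mxbarK.
have -> : smx R *m l = c^* *: mxbar l.
  by rewrite -mxbarZ -jl /conj_s mxbarM mxbarK mxbar_smx.
by apply: vline_scale; rewrite conjC_eq0.
Qed.

End Subspaces.

(** * The generators are twisted *)
Section LoopGroup.
Variable R : realType.
Local Notation C := (R[i]%C).
Local Notation K := (ratfun R).
Implicit Types (l k : 'cV[C]_7) (a b c : C) (f g h : loop R).

Lemma orth_inv (F : fieldType) (g : 'M[F]_7) : g^T *m g = 1%:M -> invmx g = g^T.
Proof.
move=> og; have [gT gu] := mulmx1_unit og.
by rewrite -[LHS]mul1mx -og -mulmxA mulmxV // mulmx1.
Qed.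

Lemma orthM (F : fieldType) (g h : 'M[F]_7) : g^T *m g = 1%:M -> h^T *m h = 1%:M ->
  (g *m h)^T *m (g *m h) = 1%:M.
Proof. by move=> og oh; rewrite trmx_mul mulmxA -(mulmxA h^T) og mulmx1. Qed.

(** The value at infinity is the identity. *)
Definition normalized g := forall i j, vanishing ((g - 1%:M) i j).

Lemma normalizedM g h : normalized g -> normalized h -> normalized (g *m h).
Proof.
move=> sg sh i j.
have -> : g *m h - 1%:M = (g - 1%:M) *m (h - 1%:M) + (g - 1%:M) + (h - 1%:M).
  rewrite mulmxBl mul1mx !mulmxBr !mulmx1.
  by apply/matrixP => i' j'; rewrite !mxE; ring.
rewrite mxE [X in vanishing (X + _)]mxE; apply: vanishingD => //; apply: vanishingD => //.
by rewrite mxE; apply: vanishing_sum => k; apply: vanishingM.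
Qed.

Lemma normalizedT g : normalized g -> normalized g^T.
Proof.
by move=> sg i j; have := sg j i; rewrite !mxE eq_sym.
Qed.

Lemma normalized1 : normalized 1%:M.
Proof. by move=> i j; rewrite subrr mxE; apply: vanishing0. Qed.

Lemma rg_orth g : real_G2_loop g -> g^T *m g = 1%:M.
Proof. by case=> -[]. Qed.

Lemma real_G2_loop1 : real_G2_loop (1%:M : loop R).
Proof.
by split; [exact: is_G2_1 | rewrite map_mx1 | exact: normalized1].
Qed.

Lemma real_G2_loopM g h : real_G2_loop g -> real_G2_loop h -> real_G2_loop (g *m h).
Proof.
move=> [Gg bg ig] [Gh bh ih]; split; [exact: is_G2M | | exact: normalizedM].
by rewrite map_mxM bg bh.
Qed.

Lemma real_G2_loopT g : real_G2_loop g -> real_G2_loop g^T.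
Proof.
move=> [Gg bg ig]; split; [exact: is_G2V | | exact: normalizedT].
by rewrite -map_trmx bg.
Qed.

Lemma cstm_sq : cstm (smx R) *m cstm (smx R) = 1%:M.
Proof. by rewrite /cstm -map_mxM smx_sq map_mx1. Qed.

Lemma twistM g h : twist (g *m h) = twist g *m twist h.
Proof.
rewrite /twist map_mxM -!mulmxA (mulmxA (cstm (smx R)) (cstm (smx R))).
by rewrite cstm_sq mul1mx.
Qed.

Lemma twist1 : twist (1%:M : loop R) = 1%:M.
Proof. by rewrite /twist map_mx1 mulmx1 cstm_sq. Qed.

Lemma twistT g : twist g^T = (twist g)^T.
Proof.
by rewrite /twist !trmx_mul -!map_trmx /cstm !map_trmx smx_tr mulmxA.
Qed.

Lemma twistK g : twist (twist g) = g.
Proof.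
rewrite /twist !map_mxM !ropp_cstm -map_mx_comp.
have -> : map_mx (ropp \o ropp) g = g.
  by apply/matrixP => i j; rewrite mxE /= roppK.
by rewrite !mulmxA cstm_sq mul1mx -mulmxA cstm_sq mulmx1.
Qed.

Lemma hol_twist g a : hol g a -> hol (twist g) (- a).
Proof.
move=> [A gA]; eexists; apply: mvalM (mval_cstm _ _).
by apply: mvalM (mval_cstm _ _) _; apply: mval_ropp gA.
Qed.

Lemma hol_twistN g a : hol g (- a) -> hol (twist g) a.
Proof. by move=> /hol_twist; rewrite opprK. Qed.

Lemma hol_bar g a : hol g a -> hol (map_mx rbar g) a^*.
Proof. by move=> [A gA]; eexists; apply: mval_rbar gA. Qed.

Lemma normalized_sf a l : normalized (simple_factor a l).
Proof. by move=> i j; apply: sf_infty. Qed.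

Lemma normalized_twist g : normalized g -> normalized (twist g).
Proof.
move=> sg i j.
have -> : twist g - 1%:M = cstm (smx R) *m map_mx ropp (g - 1%:M) *m cstm (smx R).
  by rewrite map_mxB map_mx1 mulmxBr mulmxBl mulmx1 cstm_sq.
rewrite mxE; apply: vanishing_sum => m; rewrite mulrC [X in _ * X]mxE [X in X * _]mxE.
apply: vanishingZ; apply: vanishing_sum => n; rewrite [X in X * _]mxE.
by apply: vanishingZ; rewrite mxE; apply: vanishing_ropp (sg _ _).
Qed.

Definition pair_loop a l k : loop R := simple_factor a l *m simple_factor a k.

Lemma pair_loopE a l k : pair_loop a l k = simple_factor a l *m simple_factor a k.
Proof. by []. Qed.

Local Opaque pair_loop.

Lemma pair_orth a l k : null l -> null k ->
  (pair_loop a l k)^T *m pair_loop a l k = 1%:M.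
Proof. by move=> nl nk; rewrite !pair_loopE; apply: orthM; apply: sf_orth. Qed.

Lemma pair_bar a l k : map_mx rbar (pair_loop a l k) = pair_loop a l k.
Proof.
rewrite (pair_loopE a l k) map_mxM.
exact: (congr2 mulmx (sf_bar a l) (sf_bar a k)).
Qed.

Lemma normalized_pair a l k : normalized (pair_loop a l k).
Proof. by rewrite pair_loopE; apply: normalizedM; apply: normalized_sf. Qed.

Lemma pair_hol a l k b : b != a -> b != a^* -> hol (pair_loop a l k) b.
Proof. by move=> h1 h2; rewrite pair_loopE; apply: holM; apply: sf_hol. Qed.

Lemma pair_real_G2 a l k : a^* != a -> admissible_pair l k -> real_G2_loop (pair_loop a l k).
Proof.
move=> ra al; split; [| exact: pair_bar | exact: normalized_pair].
by rewrite pair_loopE; apply: adm_pair_G2.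
Qed.

Lemma pair_twist a l k :
  twist (pair_loop a l k) = pair_loop (- a) (smx R *m l) (smx R *m k).
Proof.
rewrite (pair_loopE a l k) (pair_loopE (- a)) twistM.
exact: (congr2 mulmx (sf_twist a l) (sf_twist a k)).
Qed.

(** The twist moves the pole to -a = conj a and l to s l, a multiple of conj l;
[sf_conj] leads back. *)
Lemma sf_twist_fixed a l c : a^* = - a -> c != 0 -> conj_s (smx R) l = c *: l ->
  twist (simple_factor a l) = simple_factor a l.
Proof.
move=> ia c0 jl; rewrite sf_twist -ia.
have -> : smx R *m l = mxbar (conj_s (smx R) l).
  by rewrite /conj_s mxbarM mxbar_smx mxbarK.
by rewrite sf_conj jl sfZ.
Qed.

Lemma adm_smx l k : admissible_pair l k -> admissible_pair (smx R *m l) (smx R *m k).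
Proof.
move=> [[l0 k0] ll kk kl' [m0 lm]].
have bS x y : bil (smx R *m x) (smx R *m y) = bil x y.
  by rewrite bil_mull smx_tr mulmxA smx_sq mul1mx.
have barS (x : 'cV[C]_7) : mxbar (smx R *m x) = smx R *m mxbar x.
  by rewrite mxbarM mxbar_smx.
have S0 (x : 'cV[C]_7) : x != 0 -> smx R *m x != 0.
  apply: contra => /eqP h; rewrite -[x]mul1mx -(smx_sq R) -mulmxA h mulmx0 //.
split.
- by split; apply: S0.
- by rewrite bS.
- by rewrite bS.
- by rewrite barS bS.
rewrite /= !barS !bS scalemxAr -mulmxBr; split; first exact: S0.
by rewrite (proj2 (smx_G2 R)) lm mulmx0.
Qed.

(** Liouville's theorem for g h^-1. *)
Lemma equal_of_hol g h : g^T *m g = 1%:M -> h^T *m h = 1%:M ->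
  normalized g -> normalized h -> (forall a, hol (g *m h^T) a) -> g = h.
Proof.
move=> og oh sg sh H.
have E : g *m h^T = 1%:M.
  by apply: loop_liouville => //; apply: normalizedM => //; apply: normalizedT.
by rewrite -[g]mulmx1 -oh mulmxA E mul1mx.
Qed.

(** Iterate [reduce_pole] without regard to the twist. *)
Lemma remove_pole a n g : a^* != a -> is_G2 g -> hol (lin a ^+ n *: g) a ->
  exists h, [/\ real_G2_loop h, forall b, b != a -> b != a^* -> hol h b &
    hol (h *m g) a].
Proof.
move=> ra; elim: n g => [|n IH] g Gg hg.
  exists 1%:M; split; [exact: real_G2_loop1 | | ].
    by move=> b _ _; exists 1%:M; rewrite -(map_mx1 cst); apply: mval_cstm.
  by rewrite mul1mx -[g]scale1r -(expr0 (lin a)).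
have [h|nh] := pselect (hol (lin a ^+ n *: g) a); first exact: IH.
have [l [k [al _ hr]]] := reduce_pole (symm := false) ra Gg hg nh
  (fun E => False_ind _ (notF E)).
have Gp : is_G2 (pair_loop a l k) by rewrite pair_loopE; apply: adm_pair_G2.
rewrite mulmxA -pair_loopE in hr.
have [h [rh hh hhg]] := IH _ (is_G2M Gp Gg) hr.
exists (h *m pair_loop a l k); split.
- by apply: real_G2_loopM rh _; apply: pair_real_G2.
- by move=> b b1 b2; apply: holM (hh _ b1 b2) _; apply: pair_hol.
- by rewrite -mulmxA.
Qed.

(** With q = f p and r = q (twist p)^-1, the loop twist(q) q^-1 equals both
twist(f) r^-1 and twist(r) f^-1.  The first is holomorphic away from a and
conj a, the second at these two points; Liouville's theorem applies. *)
Lemma twist_product_fixed a f p : - a != a -> - a != a^* ->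
  f^T *m f = 1%:M -> p^T *m p = 1%:M -> normalized f -> normalized p ->
  (forall z, z != - a -> z != - a^* -> hol f z) ->
  (forall z, z != a -> z != a^* -> hol (f *m p *m (twist p)^T) z) ->
  twist (f *m p) = f *m p.
Proof.
move=> aa aa' of_ op nf np hf; set r := _ *m (twist p)^T => hr.
have otp : (twist p)^T *m twist p = 1%:M by rewrite -twistT -twistM op twist1.
have oq := orthM of_ op.
have fpE : f *m p = r *m twist p by rewrite -mulmxA otp mulmx1.
move: r hr fpE => r hr fpE.
have E1 : twist (f *m p) *m (f *m p)^T = twist r *m f^T.
  by rewrite {1}fpE twistM twistK trmx_mul -mulmxA (mulmxA p) (mulmx1C op) mul1mx.
have E2 : twist (f *m p) *m (f *m p)^T = twist f *m r^T.
  have -> : (f *m p)^T = (twist p)^T *m r^T by rewrite fpE trmx_mul.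
  by rewrite twistM -mulmxA (mulmxA (twist p)) (mulmx1C otp) mul1mx.
apply: equal_of_hol; [|exact: oq| |exact: normalizedM|].
- by rewrite -twistT -twistM oq twist1.
- by apply: normalized_twist; apply: normalizedM.
move=> z; have [za|] := boolP ((z == a) || (z == a^*)); last first.
  rewrite negb_or => /andP[z1 z2]; rewrite E2; apply: holM.
    by apply: hol_twistN; apply: hf; rewrite eqr_opp.
  by apply: hol_tr; apply: hr.
have [z1 z2] : z != - a /\ z != - a^*.
  case/orP: za => /eqP ->; split; rewrite eq_sym //.
    by rewrite eqr_oppLR eq_sym in aa'.
  by rewrite -rmorphN (inj_eq (fmorph_inj Num.conj)).
rewrite E1; apply: holM; last by apply: hol_tr; apply: hf.
by apply: hol_twistN; apply: hr; rewrite eqr_oppLR.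
Qed.

(** The generator q_{a,L,K} = f p in terms of spanning vectors: k1 spans (sK)', l1
spans (sL)', and D is the dressed loop whose value at -a defines l1. *)
Section Quad.
Variables (a : C) (l k : 'cV[C]_7).
Hypotheses (ra : a^* != a) (ia : a^* != - a) (al : admissible_pair l k).
Local Notation b := (- a).
Local Notation s := (smx R).
Let p := pair_loop a l k.
Let tp := pair_loop b (s *m l) (s *m k).

Let ba : b != a.
Proof.
apply: contra ra => /eqP h.
have a0 : a = 0.
  apply/eqP; have : a *+ 2 == 0 by rewrite mulr2n -{1}h addNr.
  by rewrite mulrn_eq0.
by rewrite a0 rmorph0.
Qed.
Let ba' : b != a^*. Proof. by rewrite eq_sym. Qed.
Let rb : b^* != b. Proof. by rewrite rmorphN /= eqr_opp. Qed.

Let P := eval p b.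
Let pP : mval p b P.
Proof.
have [A pA] := pair_hol l k ba ba'.
by apply: mval_eval; case: (eval_mval pA).
Qed.
Let k1 := P *m (s *m k).
Let D := simple_factor b k1 *m p *m (simple_factor b (s *m k))^T.
Let l1 := eval D b *m (s *m l).
Let f := pair_loop b l1 k1.

Definition quad_loop : loop R := f *m p.

Let nl : null l. Proof. by case: (adm_null al). Qed.
Let nk : null k. Proof. by case: (adm_null al). Qed.
Let nsl : null (s *m l). Proof. by case: (adm_null (adm_smx al)). Qed.
Let nsk : null (s *m k). Proof. by case: (adm_null (adm_smx al)). Qed.
Let op : p^T *m p = 1%:M. Proof. exact: pair_orth. Qed.

Let value_orth g A c : g^T *m g = 1%:M -> mval g c A -> A^T *m A = 1%:M.
Proof.
move=> og gA; apply: mval_uniq (mvalM (mval_tr gA) gA) _.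
by rewrite og -(map_mx1 cst); apply: mval_cstm.
Qed.

Let null_orth (A : 'M[C]_7) x : A^T *m A = 1%:M -> null x -> null (A *m x).
Proof.
move=> oA [x0 xx]; split; last by rewrite bil_mull mulmxA oA mul1mx.
by apply: contra x0 => /eqP h; rewrite -[x]mul1mx -oA -mulmxA h mulmx0.
Qed.

Let nk1 : null k1. Proof. exact: null_orth (value_orth op pP) nsk. Qed.

Let DD : mval D b (eval D b).
Proof.
have [A DA] := dressing_hol rb nsk op pP.
by apply: mval_eval; case: (eval_mval DA).
Qed.

Let oD : D^T *m D = 1%:M.
Proof.
apply: orthM; first exact: orthM (sf_orth _ nk1) op.
by rewrite trmxK; apply: mulmx1C; apply: sf_orth.
Qed.

Let nl1 : null l1. Proof. exact: null_orth (value_orth oD DD) nsl. Qed.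
Let of_ : f^T *m f = 1%:M. Proof. exact: pair_orth. Qed.

Let r := f *m p *m tp^T.

(** Two successive dressings, by k1 and by l1, cancel the pole of (twist p)^-1. *)
Let r_hol : hol r b.
Proof.
have -> : r = simple_factor b l1 *m D *m (simple_factor b (s *m l))^T.
  by rewrite /r /f /tp !pair_loopE (trmx_mul (simple_factor b (s *m l))) /D !mulmxA.
exact: dressing_hol rb nsl oD DD.
Qed.

Let Gp : is_G2 p. Proof. by rewrite /p pair_loopE; apply: adm_pair_G2. Qed.
Let Gtp : is_G2 tp.
Proof. by rewrite /tp pair_loopE; apply: adm_pair_G2 rb _; apply: adm_smx. Qed.

(** The loop f is not known to come from an admissible pair.  A product f' of
G2-valued pairs at -a exists for which f' p (twist p)^-1 is holomorphic at -a;
as r has the same property, f and f' agree by Liouville's theorem. *)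
Let f_real_G2 : real_G2_loop f.
Proof.
have hG : hol (lin b ^+ 2 *: (p *m tp^T)) b.
  have h1 x : null x -> hol (lin b *: (simple_factor b x)^T) b.
    by move=> nx; rewrite -trmx_scale; apply: hol_tr; eexists; apply: sf_polar.
  rewrite scalemxAr /tp pair_loopE trmx_mul expr2 -scalerA scalemxAl scalemxAr.
  by apply: holM; [exists P | apply: holM; apply: h1].
have [f' [rf' hf' hf'G]] := remove_pole rb (is_G2M Gp (is_G2V Gtp)) hG.
suff -> : f = f' by [].
have of' := rg_orth rf'.
apply: equal_of_hol => //; [exact: normalized_pair | by case: rf' |].
have E : f *m f'^T = r *m (f' *m (p *m tp^T))^T.
  rewrite (trmx_mul f') mulmxA; congr (_ *m _).
  by rewrite /r -(mulmxA f) -(mulmxA f) (mulmx1C (proj1 (is_G2M Gp (is_G2V Gtp)))) mulmx1.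
have hb : hol (f *m f'^T) b by rewrite E; apply: holM => //; apply: hol_tr.
move=> z; have [->//|zb] := eqVneq z b.
have [->|zb'] := eqVneq z b^*.
  have := hol_bar hb; rewrite map_mxM -map_trmx pair_bar (rg_bar rf').
  by [].
by apply: holM; [exact: pair_hol | apply: hol_tr; apply: hf'].
Qed.

Lemma quad_real_G2 : real_G2_loop quad_loop.
Proof. by apply: real_G2_loopM f_real_G2 _; apply: pair_real_G2. Qed.

Lemma quad_hol z : z != a -> z != a^* -> z != - a -> z != (- a)^* -> hol quad_loop z.
Proof. by move=> z1 z2 z3 z4; apply: holM; apply: pair_hol. Qed.

Lemma quad_hol_left g n : hol (lin a ^+ n *: (p *m g)) a ->
  hol (lin a ^+ n *: (quad_loop *m g)) a.
Proof.
move=> h; rewrite /quad_loop -mulmxA scalemxAr; apply: holM h; apply: pair_hol.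
  by rewrite eq_sym.
by rewrite rmorphN /= -eqr_oppLR eq_sym.
Qed.

Lemma quad_twist : twist quad_loop = quad_loop.
Proof.
have tpE : twist p = tp by rewrite /p pair_twist.
have r_bar : map_mx rbar r = r.
  transitivity (map_mx rbar f *m map_mx rbar p *m (map_mx rbar tp)^T).
    by rewrite map_trmx -!map_mxM.
  exact: (congr2 mulmx (congr2 mulmx (pair_bar _ _ _) (pair_bar _ _ _))
    (congr1 trmx (pair_bar _ _ _))).
have r_hol' : hol r b^* by rewrite -r_bar; exact: hol_bar r_hol.
have nf : normalized f := normalized_pair _ _ _.
have np : normalized p := normalized_pair _ _ _.
apply: (twist_product_fixed ba ba' of_ op nf np).
  by move=> z z1 z2; apply: pair_hol; [exact: z1 | rewrite rmorphN].
move=> z z1 z2; rewrite tpE -/r.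
have [->|z3] := eqVneq z b; first exact: r_hol.
have [->|z4] := eqVneq z b^*; first exact: r_hol'.
by apply: holM; [apply: holM; apply: pair_hol | apply: hol_tr; apply: pair_hol].
Qed.

Lemma q2E : q2 a <[l]> <[k]> = quad_loop.
Proof.
have oP := value_orth op pP.
have p2E c u v : null u -> null v -> p2 c <[u]> <[v]> = pair_loop c u v.
  by move=> nu nv; rewrite /p2 (p1E nu c) (p1E nv c) pair_loopE.
have KE : imgV (eval p b) (sV <[k]>) = <[k1]>%VS by rewrite /sV !imgV_line.
have LE : imgV (eval D b) (sV <[l]>) = <[l1]>%VS by rewrite /sV !imgV_line.
have DE : dress b <[k1]> p = D.
  rewrite /dress imgV_line (p1E nk1 b).
  have -> : invmx (eval p b) *m k1 = s *m k.
    have -> : invmx (eval p b) = P^T by exact: orth_inv oP.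
    by rewrite /k1 (mulmxA P^T P) oP mul1mx.
  by rewrite (p1E nsk b) (orth_inv (sf_orth _ nsk)).
rewrite /q2 (p2E a l k nl nk) -/p KE DE LE.
exact: (congr1 (mulmx^~ p) (p2E b l1 k1 nl1 nk1)).
Qed.

End Quad.
End LoopGroup.

Local Opaque pair_loop.

(** * Generation *)
Section Generation.
Variable R : realType.
Local Notation C := (R[i]%C).
Local Notation K := (ratfun R).
Implicit Types (l k : 'cV[C]_7) (a b c : C) (f g h : loop R) (s : seq C).

Lemma conj_real a : (a^* == a) = (complex.Im a == 0).
Proof.
case: a => x y; rewrite -[_^*]/(x -i* y)%C eq_complex /= eqxx /=.
by rewrite eq_sym -subr_eq0 opprK -mulr2n mulrn_eq0.
Qed.

Lemma conj_imag a : (a^* == - a) = (complex.Re a == 0).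
Proof.
case: a => x y; rewrite -[_^*]/(x -i* y)%C -[- (_ +i* _)%C]/((- x) -i* y)%C.
rewrite eq_complex /= eqxx andbT.
by rewrite -subr_eq0 opprK -mulr2n mulrn_eq0.
Qed.

Definition imaginary_generator h :=
  exists b l k, [/\ b^* = - b, b != 0, admissible_pair l k,
    (exists2 c, c != 0 & conj_s (smx R) l = c *: l) /\
    (exists2 c, c != 0 & conj_s (smx R) k = c *: k) & h = pair_loop b l k].

Definition generic_generator h :=
  exists a l k, [/\ a^* != a, a^* != - a, admissible_pair l k & h = quad_loop a l k].

Lemma imag_nonreal b : b^* = - b -> b != 0 -> b^* != b.
Proof.
move=> -> b0; apply: contra b0 => /eqP h.
have : b *+ 2 == 0 by rewrite mulr2n -{1}h addNr.
by rewrite mulrn_eq0.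
Qed.

Lemma p2_pair a l k : null l -> null k -> p2 a <[l]> <[k]> = pair_loop a l k.
Proof. by move=> nl nk; rewrite /p2 (p1E nl a) (p1E nk a) pair_loopE. Qed.

Lemma imaginary_generatorP h : imaginary_generator h <->
  exists (b : C) (M N : {vspace C7 R}),
    [/\ complex.Re b = 0 /\ b <> 0, admissible M N,
        sV M = conjV M, sV N = conjV N & h = p2 b M N].
Proof.
split.
  move=> [b [l [k [ib b0 al [jl jk] ->]]]]; have [nl nk] := adm_null al.
  exists b, <[l]>%VS, <[k]>%VS; split.
  - by split; [apply/eqP; rewrite -conj_imag ib | apply/eqP].
  - by apply/admissibleP; exists l, k.
  - by apply/sV_conjVP => //; case: nl.
  - by apply/sV_conjVP => //; case: nk.
  - by rewrite p2_pair.
move=> [b [M [N [[b1 /eqP b0] /admissibleP[l [k [al -> ->]]] sl sk ->]]]].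
have [nl nk] := adm_null al.
exists b, l, k; split; [|exact: b0|exact: al| |by rewrite p2_pair].
  by apply/eqP; rewrite conj_imag b1.
by split; apply/sV_conjVP => //; [case: nl | case: nk].
Qed.

Lemma generic_generatorP h : generic_generator h <->
  exists (a : C) (L N : {vspace C7 R}),
    [/\ complex.Im a <> 0, complex.Re a <> 0, admissible L N & h = q2 a L N].
Proof.
split.
  move=> [a [l [k [ra ia al ->]]]]; exists a, <[l]>%VS, <[k]>%VS; split.
  - by apply/eqP; rewrite -conj_real.
  - by apply/eqP; rewrite -conj_imag.
  - by apply/admissibleP; exists l, k.
  - by rewrite q2E.
move=> [a [L [N [/eqP a1 /eqP a2 /admissibleP[l [k [al -> ->]]] ->]]]].
have ra : a^* != a by rewrite conj_real.
have ia : a^* != - a by rewrite conj_imag.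
by exists a, l, k; split; [| | | rewrite q2E].
Qed.

Definition twisted g := real_G2_loop g /\ twist g = g.

Lemma twisted1 : twisted (1%:M : loop R).
Proof. by split; [exact: real_G2_loop1 | exact: twist1]. Qed.

Lemma twistedM g h : twisted g -> twisted h -> twisted (g *m h).
Proof.
by move=> [rg tg] [rh th]; split; [exact: real_G2_loopM | rewrite twistM tg th].
Qed.

Lemma twistedV g : twisted g -> twisted (invmx g).
Proof.
move=> [rg tg]; rewrite (orth_inv (rg_orth rg)).
by split; [exact: real_G2_loopT | rewrite twistT tg].
Qed.

Lemma imaginary_twisted h : imaginary_generator h -> twisted h.
Proof.
move=> [b [l [k [ib b0 al [[c c0 jl] [d d0 jk]] ->]]]].
split; first by apply: pair_real_G2 => //; exact: imag_nonreal.
rewrite pair_loopE twistM.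
exact: (congr2 mulmx (sf_twist_fixed ib c0 jl) (sf_twist_fixed ib d0 jk)).
Qed.

Lemma generic_twisted h : generic_generator h -> twisted h.
Proof.
move=> [a [l [k [ra ia al ->]]]]; split; first exact: quad_real_G2.
exact: quad_twist.
Qed.

Lemma hol_scale (x : K) c g a : has_value x a c -> hol g a -> hol (x *: g) a.
Proof. by move=> hx [A gA]; exists (c *: A); apply: mvalZ. Qed.

Lemma hol_order_le m n g a : (m <= n)%N ->
  hol (lin a ^+ m *: g) a -> hol (lin a ^+ n *: g) a.
Proof.
move=> mn; rewrite -(subnK mn) exprD -scalerA.
by apply: hol_scale; apply: has_valueX; apply: lin_a.
Qed.

Lemma hol_order_bar n g a : map_mx rbar g = g ->
  hol (lin a ^+ n *: g) a -> hol (lin a^* ^+ n *: g) a^*.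
Proof.
move=> bg /hol_bar; rewrite map_mxZ bg rmorphXn /= rbar_lin; exact id.
Qed.

Lemma hol_order_twist n g a : twist g = g ->
  hol (lin a ^+ n *: g) a -> hol (lin (- a) ^+ n *: g) (- a).
Proof.
move=> tg /hol_twist h.
have -> : lin (- a) ^+ n *: g = (-1) ^+ n *: twist (lin a ^+ n *: g).
  rewrite /twist map_mxZ rmorphXn /= ropp_lin -scalemxAr -scalemxAl.
  by rewrite -[cstm _ *m _ *m _]/(twist g) tg scalerA -exprMn mulN1r opprK.
apply: hol_scale h; apply: has_valueX; rewrite -(rmorph1 cst) -rmorphN.
exact: has_value_cst.
Qed.

Lemma symmetric_order n g a b : twisted g ->
  [|| b == a, b == a^*, b == - a | b == (- a)^*] ->
  hol (lin a ^+ n *: g) a -> hol (lin b ^+ n *: g) b.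
Proof.
move=> [[_ bg _] tg] /or4P[] /eqP -> h //.
- exact: hol_order_bar.
- exact: hol_order_twist.
- by apply: hol_order_bar => //; apply: hol_order_twist.
Qed.

Lemma symmetric_order_inv n g a b : twisted g ->
  [|| b == a, b == a^*, b == - a | b == (- a)^*] ->
  hol (lin b ^+ n *: g) b -> hol (lin a ^+ n *: g) a.
Proof.
move=> tg ab; apply: symmetric_order => //.
case/or4P: ab => /eqP ->; rewrite ?conjCK ?opprK ?eqxx ?orbT //.
have -> : (- (- a)^*)^* = a by rewrite rmorphN /= conjCK opprK.
by rewrite eqxx !orbT.
Qed.

(** The leading coefficient A is real and satisfies A^T A = 0, so each A x has
hermitian norm zero. *)
Lemma no_real_pole n g a : real_G2_loop g -> a^* = a ->
  hol (lin a ^+ n.+1 *: g) a -> hol (lin a ^+ n *: g) a.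
Proof.
move=> [[og _] bg _] ra [A fA].
have [f1 [A1 [fE f1A]]] := mval_expand fA.
have ff : (lin a ^+ n.+1 *: g)^T *m (lin a ^+ n.+1 *: g) = (lin a ^+ (n + n).+2)%:M.
  by rewrite trmx_scale -scalemxAl -scalemxAr scalerA og scalemx1 -exprD addSn addnS.
have [iso _] := orth_expand ff fE f1A.
have Abar : mxbar A = A.
  have := mval_rbar fA; rewrite map_mxZ bg rmorphXn /= rbar_lin ra => h.
  exact: mval_uniq h fA.
have A0 : A = 0.
  apply: col_ext => x; rewrite mul0mx; apply/eqP; apply: contraTT isT => /norm_neq0.
  by rewrite mxbarM Abar bil_mull mulmxA iso mul0mx bilx0 eqxx.
exists A1; suff -> : lin a ^+ n *: g = f1 by [].
apply: (scalerI (lin_neq0 a)); rewrite scalerA -exprS fE A0.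
by rewrite /cstm map_mx0 add0r.
Qed.

Lemma cancel_outer (F : fieldType) (x y w : F) : x != 0 -> w != 0 ->
  (x * w)^-1 * (x * (y * w)) = y.
Proof. by move=> x0 w0; field; rewrite x0 w0. Qed.

Lemma prod_lin_order s b : exists (w : K) (c : C), [/\ c != 0, has_value w b c &
  \prod_(z <- s) lin z = lin b ^+ count_mem b s * w].
Proof.
elim: s => [|z s [w [c [c0 wc E]]]].
  exists 1, 1; rewrite oner_neq0 big_nil expr0 mul1r; split=> //.
  by rewrite -(rmorph1 cst); apply: has_value_cst.
rewrite big_cons E; have [->|zb] := eqVneq z b.
  by exists w, c; split; [exact: c0 | exact: wc | rewrite /= eqxx add1n exprS mulrA].
exists (lin z * w), ((b - z) * c); split.
- by rewrite mulf_neq0 // subr_eq0 eq_sym.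
- exact: has_valueM (has_value_lin _ _) wc.
- by rewrite /= (negPf zb) add0n mulrCA.
Qed.

(** The roots of a common denominator, with multiplicity, bound the poles. *)
Lemma pole_divisor g : exists s, forall b, hol (lin b ^+ count_mem b s *: g) b.
Proof.
have [q qP] : exists q : 'I_7 -> 'I_7 -> {poly C},
    forall i j, q i j != 0 /\ exists p, g i j = tofrac p / tofrac (q i j).
  exists (fun i j => xget 1 [set q | q != 0 /\ exists p, g i j = tofrac p / tofrac q]%classic).
  move=> i j; case: xgetP => [q0 _ [h1 h2]|h]; first by split.
  by have [p [q [q0 E]]] := fraction_numden (g i j); case: (h q); split=> //; exists p.
pose d := \prod_i \prod_j q i j.
have d0 : d != 0.
  by apply/prodf_neq0 => i _; apply/prodf_neq0 => j _; case: (qP i j).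
have hd b : hol (tofrac d *: g) b.
  apply: hol_entries => i j; have [q0 [p E]] := qP i j.
  have [r dE] : exists r, d = r * q i j.
    by rewrite /d (bigD1 i) //= (bigD1 j) //= -mulrA mulrC; eexists.
  exists (r.[b] * p.[b]); rewrite mxE E dE tofracM -mulrA [tofrac (q i j) * _]mulrC.
  rewrite divfK; last by rewrite tofrac_eq0.
  by apply: has_valueM; apply: has_value_poly.
have [s dE] := closed_field_poly_normal d.
exists s => b; have [w [c [c0 wc E]]] := prod_lin_order s b.
have w0 : w != 0.
  apply: contra c0 => /eqP w0; apply/eqP; apply: has_value_uniq wc _.
  by rewrite w0 -(rmorph0 cst); apply: has_value_cst.
have l0 : lead_coef d != 0 by rewrite lead_coef_eq0.
have dK : tofrac d = cst (lead_coef d) * (lin b ^+ count_mem b s * w).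
  rewrite -E {1}dE -mul_polyC tofracM; congr (_ * _).
  exact: rmorph_prod.
have -> : lin b ^+ count_mem b s *: g = (cst (lead_coef d) * w)^-1 *: (tofrac d *: g).
  have cl0 : cst (lead_coef d) != 0 :> K by rewrite cst_eq0.
  by rewrite scalerA dK (cancel_outer _ cl0 w0).
apply: hol_scale (hd b); apply: has_valueV (mulf_neq0 l0 c0) _.
exact: has_valueM (has_value_cst _ _) wc.
Qed.

Lemma pole_reduction n g a : twisted g ->
  hol (lin a ^+ n.+1 *: g) a -> ~ hol (lin a ^+ n *: g) a ->
  exists h, [/\ imaginary_generator h \/ generic_generator h,
    forall b, ~~ [|| b == a, b == a^*, b == - a | b == (- a)^*] -> hol h b &
    hol (lin a ^+ n *: (h *m g)) a].
Proof.
move=> [rg tg] hg nh; have [Gg bg _] := rg.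
have ra : a^* != a.
  by apply/eqP => ra; apply: nh; apply: no_real_pole.
have tgg : theta g = g by rewrite /theta bg.
have [ia|ia] := eqVneq a^* (- a).
  have [l [k [al jlk hlk]]] := reduce_pole (symm := true) ra Gg hg nh
    (fun _ => conj ia tgg).
  have [jl jk] := jlk isT.
  exists (pair_loop a l k); split.
  - left; exists a, l, k; split; [exact: ia | | exact: al | | by []].
      by apply: contra ra => /eqP ->; rewrite rmorph0.
    by split; exists 1; rewrite ?oner_neq0 ?scale1r.
  - by move=> b; rewrite !negb_or => /and4P[b1 b2 _ _]; apply: pair_hol.
  - by move: hlk; rewrite mulmxA -pair_loopE.
have [l [k [al _ hlk]]] := reduce_pole (symm := false) ra Gg hg nh
  (fun E => False_ind _ (notF E)).
exists (quad_loop a l k); split.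
- by right; exists a, l, k.
- by move=> b; rewrite !negb_or => /and4P[b1 b2 b3 b4]; apply: quad_hol.
- by apply: quad_hol_left => //; move: hlk; rewrite mulmxA -pair_loopE.
Qed.

(** Induction on the list s that bounds the poles.  If the bound at its head a is
not attained, drop a.  Otherwise multiply by the generator of [pole_reduction]:
by symmetry the order drops on the whole orbit of a, and no pole appears or grows
elsewhere, so the tail of s bounds the poles of the product. *)
Lemma generated_from_poles (S : loop R -> Prop) s g :
  (forall h, imaginary_generator h \/ generic_generator h -> S h) ->
  twisted g -> (forall b, hol (lin b ^+ count_mem b s *: g) b) -> generated S g.
Proof.
move=> HS; elim: s g => [|a s IH] g tg hg.
  have -> : g = 1%:M.
    apply: loop_liouville; last by case: tg => -[].
    by move=> b; have := hg b; rewrite expr0 scale1r.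
  exact: generated_one.
have count_neq b : b != a -> count_mem b (a :: s) = count_mem b s.
  by rewrite /= eq_sym => /negPf ->.
have [h|nh] := pselect (hol (lin a ^+ count_mem a s *: g) a).
  apply: IH tg _ => b; have [->//|ba] := eqVneq b a.
  by rewrite -(count_neq b ba).
have hga : hol (lin a ^+ (count_mem a s).+1 *: g) a.
  by have := hg a; rewrite /= eqxx add1n.
have [h [gen hh hr]] := pole_reduction tg hga nh.
have th : twisted h.
  by case: gen; [exact: imaginary_twisted | exact: generic_twisted].
have -> : g = invmx h *m (h *m g).
  rewrite (orth_inv (rg_orth (proj1 th))) mulmxA (rg_orth (proj1 th)) mul1mx.
  by [].
apply: generated_mul; first by apply: generated_inv; apply: generated_mem; apply: HS.
have thg := twistedM th tg.
apply: (IH _ thg) => b.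
have [sym|nsym] := boolP [|| b == a, b == a^*, b == - a | b == (- a)^*].
  apply: (@hol_order_le (count_mem a s)); last exact: symmetric_order thg sym hr.
  have [->//|ba] := eqVneq b a.
  rewrite -(count_neq b ba) leqNgt; apply/negP => lt; apply: nh.
  exact: hol_order_le (ltnW lt) (symmetric_order_inv tg sym (hg b)).
have ba : b != a by move: nsym; rewrite !negb_or => /and4P[].
rewrite scalemxAr; apply: holM (hh b nsym) _.
by rewrite -(count_neq b ba).
Qed.

End Generation.

Theorem theorem6p13 (R : realType) (g : loop R) :
  twisted_loop_group g <->
  generated
    (fun h : loop R =>
       (exists (b : R[i]%C) (M N : {vspace C7 R}),
          [/\ complex.Re b = 0 /\ b <> 0, admissible M N,
              sV M = conjV M, sV N = conjV N & h = p2 b M N])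
       \/
       (exists (a : R[i]%C) (L K : {vspace C7 R}),
          [/\ complex.Im a <> 0, complex.Re a <> 0, admissible L K
            & h = q2 a L K])) g.
Proof.
split=> [/twisted_loopP tg|].
  have [s hs] := pole_divisor g.
  apply: generated_from_poles tg hs => h [gen|gen].
    by left; apply/imaginary_generatorP.
  by right; apply/generic_generatorP.
move=> gg; apply/twisted_loopP; rewrite -/(twisted g).
elim: gg => {g} [g [gen|gen]| |g h _ tg _ th|g _ tg].
- by apply: imaginary_twisted; apply/imaginary_generatorP.
- by apply: generic_twisted; apply/generic_generatorP.
- exact: twisted1.
- exact: twistedM.
- exact: twistedV.
Qed.
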